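(* Let $g(n)$ be defined as in the context. Then: (i) There exists a real number $\alpha<\frac{1}{2}$ such that $g(n)<n^{\alpha}$ for all sufficiently large integers $n$. (ii) For every $\varepsilon>0$ there is a constant $C_\varepsilon>0$, depending only on $\varepsilon$, such that for all sufficiently large $X$, $$\#\{n\le X:\ g(n)\ge n^{\varepsilon}\}\le C_\varepsilon\, X\exp\!\big(-(\log X)^{\frac{1}{3}-\varepsilon}\big).$$
   Context: For integers $n>1$ and $k\ge 1$, say that $(n,k)$ has a prime representation if there are distinct primes $P_1,\dots,P_k$ with $P_j\mid (n+j)$ for $1\le j\le k$. Define $g(n)$ to be the largest positive integer $k$ such that $(n,k)$ has a prime representation. *)

(* Defs.v *)
From Stdlib Require Import Reals Arith ZArith Znumtheory List ClassicalEpsilon.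
Open Scope R_scope.

Definition prime_rep (n k : nat) : Prop :=
  exists P : nat -> nat,
    (forall j, (1 <= j <= k)%nat ->
        Znumtheory.prime (Z.of_nat (P j)) /\ Nat.divide (P j) (n + j)) /\
    (forall i j, (1 <= i <= k)%nat -> (1 <= j <= k)%nat -> P i = P j -> i = j).

(* g n = the largest positive k such that (n,k) has a prime representation
   (chosen by the epsilon operator; for n > 1 such a largest k exists). *)
Definition is_g (n k : nat) : Prop :=
  (1 <= k)%nat /\ prime_rep n k /\ forall k', (1 <= k')%nat -> prime_rep n k' -> (k' <= k)%nat.

Definition g (n : nat) : nat := epsilon (inhabits 0%nat) (is_g n).

Definition count_large (eps X : R) : nat :=
  length (filter (fun n => if Rle_dec (Rpower (INR n) eps) (INR (g n)) then true else false)
                 (seq 2 (Z.to_nat (Int_part X) - 1))).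

(* Main.v *)
Require Import Defs.
From Stdlib Require Import Reals Arith ZArith Znumtheory List FinFun ClassicalEpsilon Lra Lia Psatz.
Import ListNotations.
Open Scope R_scope.

(** Call [m] [y]-smooth if all its prime factors are at most [y].  If [(n, k)] has a prime
    representation, then [(n, n+k]] contains at most [y] numbers that are [y]-smooth, for every [y].
    So it suffices to produce more than [y] smooth numbers in the interval.

    (i) Let [n] be about [w^23] and [k = w^11].  For [a] about [w^5] and coprime [p, q] up to [w^2],
    write [4pq bc = E^2 - D^2] with [E = qb + pc], [D = pc - qb].  For each of about [w] values of [E]
    just above [2 sqrt (pqn/a)] there is an admissible [D] with [n < abc <= n + k].  This gives about [w^10]
    products [abc], all [O(w^9)]-smooth, and the divisor bound shows that few of them coincide.
    Varying [p/q] is what pushes the exponent below [1/2].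

    (ii) Let [M] be a small power of [n], [Z = M^r] with [n] about [MZ], and count the products [mg] near [n]
    with [m] about [M] and [g] ranging over the smooth numbers in [(Z, 2Z]].  In the variable [ln n], the counting
    function with a trigonometric kernel of width [1/Z] is compared with the one for a much coarser kernel, for which
    the lower bound is trivial.  The difference is small in mean square: high frequencies [j] are controlled by
    the power saving of van der Corput and Kuzmin-Landau in [sum m^(ij)] and by the large sieve for [sum g^(ij)].
    Hence all but [O(X^(1 - 1/D))] of the [n <= X] see smooth numbers in most of their subwindows. *)

(** * Lists and divisors *)

Open Scope nat_scope.

(** For (i), take [a] of size [A] and [p, q] of size [R]. Each triple [(a, p, q)] admits about
    [k^2 / (A^(3/2) R n^(1/2))] values of [E], so there are about [R k^2 / (A n)^(1/2)] products,
    whose factors are at most about [(n / A)^(1/2)]. Up to divisor functions the count wins once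
    [k^2 > n / R]: the choice [p = q = 1] stops exactly at the square root, and the gain is [R].
    With [A = w^5], [R = w^2], [k = w^11] about [w] values of [E] remain per triple, and a spare
    factor [w] pays for the divisor function.

    For (ii), the smooth numbers [g] have density at least [1/w] in [(Z, 2Z]], so the large sieve
    loses at most a factor [w] against the square of their number, while the squared exponential sum
    over [m] saves [w^2]. The net gain [w] is a fixed power of [n], and the resulting [X^(1 - 1/D)]
    lies far below the required bound. At the lowest frequencies the sum over [m] saves nothing;
    there the two kernels have nearly equal coefficients. *)

Definition holdsb (P : Prop) : bool := if excluded_middle_informative P then true else false.

Lemma holdsb_true (P : Prop) : holdsb P = true <-> P.
Proof. unfold holdsb; destruct (excluded_middle_informative P); split; auto; discriminate. Qed.

Lemma inj_length {A B : Type} (f : A -> B) (T : list A) (L : list B) :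
  NoDup T -> (forall x y, In x T -> In y T -> f x = f y -> x = y) ->
  (forall x, In x T -> In (f x) L) -> length T <= length L.
Proof.
  intros HT Hinj Hin. rewrite <- (length_map f T).
  apply NoDup_incl_length.
  - clear Hin. induction HT as [|a T Ha HT IH]; simpl; constructor.
    + intros H. apply in_map_iff in H. destruct H as [y [Hy Hy']].
      assert (y = a) by (apply Hinj; simpl; auto). subst; auto.
    + apply IH. intros; apply Hinj; simpl; auto.
  - intros y Hy. apply in_map_iff in Hy. destruct Hy as [x [<- Hx]]; auto.
Qed.

Lemma flat_map_length_le {A B : Type} (f : A -> list B) (l : list A) (c : nat) :
  (forall x, In x l -> length (f x) <= c) -> length (flat_map f l) <= length l * c.
Proof.
  induction l as [|a l IH]; simpl; intros H; [lia|].
  rewrite length_app. specialize (H a (or_introl eq_refl)) as Ha.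
  assert (length (flat_map f l) <= length l * c) by (apply IH; intros; apply H; auto). lia.
Qed.

Lemma NoDup_flat_map_disjoint {A B : Type} (f : A -> list B) (l : list A) :
  NoDup l -> (forall x, In x l -> NoDup (f x)) ->
  (forall x y z, In x l -> In y l -> In z (f x) -> In z (f y) -> x = y) ->
  NoDup (flat_map f l).
Proof.
  induction 1 as [|a l Ha Hl IH]; simpl; intros H1 H2; [constructor|].
  apply NoDup_app.
  - apply H1; auto.
  - apply IH; [intros; apply H1; auto|]. intros x y z Hx Hy; apply H2; auto.
  - intros z Hz Hz'. apply in_flat_map in Hz'. destruct Hz' as [x [Hx Hx']].
    apply Ha. rewrite (H2 a x z); auto.
Qed.

Lemma NoDup_list_prod {A B : Type} (l : list A) (l' : list B) :
  NoDup l -> NoDup l' -> NoDup (list_prod l l').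
Proof.
  intros Hl Hl'. induction Hl as [|a l Ha Hl IH]; simpl; [constructor|].
  apply NoDup_app; auto.
  - apply FinFun.Injective_map_NoDup; auto. intros x y H; inversion H; auto.
  - intros [x y] H1 H2. apply in_map_iff in H1. destruct H1 as [z [E _]].
    inversion E; subst. apply in_prod_iff in H2. tauto.
Qed.

Fixpoint lists_of {A : Type} (r : nat) (l : list A) : list (list A) :=
  match r with
  | 0 => [[]]
  | S r' => flat_map (fun x => map (cons x) (lists_of r' l)) l
  end.

Lemma lists_of_length {A : Type} (r : nat) (l : list A) :
  length (lists_of r l) = length l ^ r.
Proof.
  induction r as [|r IH]; simpl; auto.
  rewrite (@flat_map_constant_length _ _ (length l ^ r)); [lia|].
  intros x _. now rewrite length_map.
Qed.

Lemma lists_of_NoDup {A : Type} (r : nat) (l : list A) : NoDup l -> NoDup (lists_of r l).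
Proof.
  intros Hl. induction r as [|r IH]; simpl.
  - repeat constructor. intros [].
  - apply NoDup_flat_map_disjoint; auto.
    + intros x _. apply FinFun.Injective_map_NoDup; auto. intros u v H; inversion H; auto.
    + intros x y z _ _ H1 H2. apply in_map_iff in H1. apply in_map_iff in H2.
      destruct H1 as [u [<- _]]. destruct H2 as [v [E _]]. inversion E; auto.
Qed.

Lemma in_lists_of {A : Type} (r : nat) (l : list A) (t : list A) :
  In t (lists_of r l) <-> length t = r /\ incl t l.
Proof.
  revert t. induction r as [|r IH]; simpl; intros t.
  - split.
    + intros [<-|[]]; split; auto. intros x [].
    + intros [H _]. destruct t; [auto|discriminate].
  - rewrite in_flat_map. split.
    + intros [x [Hx H]]. apply in_map_iff in H. destruct H as [u [<- Hu]].
      apply IH in Hu. destruct Hu as [Hu1 Hu2]. split; simpl; auto.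
      intros y [<-|Hy]; auto.
    + intros [H1 H2]. destruct t as [|x u]; [discriminate|].
      exists x. split; [apply H2; simpl; auto|]. apply in_map_iff. exists u. split; auto.
      apply IH. split; [simpl in H1; lia|]. intros y Hy; apply H2; simpl; auto.
Qed.

Lemma pow_ge_1 (w j : nat) : 1 <= w -> 1 <= w ^ j.
Proof. intros H. assert (w ^ j <> 0) by (apply Nat.pow_nonzero; lia). lia. Qed.

(** * Primes and the divisor bound *)

Definition nprime (p : nat) : Prop := Znumtheory.prime (Z.of_nat p).

Lemma nprime_ge2 (p : nat) : nprime p -> 2 <= p.
Proof. intros H. apply prime_ge_2 in H. lia. Qed.

Lemma divide_Z (a b : nat) : Nat.divide a b <-> (Z.of_nat a | Z.of_nat b)%Z.
Proof.
  split.
  - intros [c ->]. exists (Z.of_nat c). lia.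
  - intros [c Hc]. destruct (Nat.eq_dec a 0) as [->|Ha].
    + exists 0. lia.
    + exists (Z.to_nat c). nia.
Qed.

Lemma nprime_mul (p a b : nat) :
  nprime p -> Nat.divide p (a * b) -> Nat.divide p a \/ Nat.divide p b.
Proof.
  intros Hp H. apply divide_Z in H. rewrite Nat2Z.inj_mul in H.
  apply prime_mult in H; auto. rewrite !divide_Z. tauto.
Qed.

Lemma exists_nprime_divisor (m : nat) : 2 <= m -> exists p, nprime p /\ Nat.divide p m.
Proof.
  induction m as [m IH] using lt_wf_ind. intros Hm.
  destruct (prime_dec (Z.of_nat m)) as [Hp|Hp].
  - exists m. split; auto. apply Nat.divide_refl.
  - apply not_prime_divide in Hp; [|lia]. destruct Hp as [c [Hc1 Hc2]].
    destruct (IH (Z.to_nat c)) as [p [Hp1 Hp2]]; try lia.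
    exists p. split; auto. apply (Nat.divide_trans _ (Z.to_nat c)); auto.
    apply divide_Z. rewrite Z2Nat.id; auto. lia.
Qed.

Lemma nprime_gcd (p d : nat) : nprime p -> ~ Nat.divide p d -> Nat.gcd d p = 1.
Proof.
  intros Hp Hd.
  destruct (Nat.eq_dec (Nat.gcd d p) 1) as [|Hg]; auto. exfalso.
  assert (Hg0 : Nat.gcd d p <> 0).
  { intros H0. apply Nat.gcd_eq_0_r in H0. apply nprime_ge2 in Hp. lia. }
  pose proof (Nat.gcd_divide_r d p) as Hr. apply divide_Z in Hr.
  destruct (prime_divisors _ Hp _ Hr) as [H|[H|[H|H]]]; try lia.
  apply Hd. replace p with (Nat.gcd d p) by lia. apply Nat.gcd_divide_l.
Qed.

Definition divs (m : nat) : list nat := filter (fun d => m mod d =? 0) (seq 1 m).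

Lemma in_divs (m d : nat) : 1 <= m -> (In d (divs m) <-> Nat.divide d m).
Proof.
  intros Hm. unfold divs. rewrite filter_In, in_seq, Nat.eqb_eq. split.
  - intros [H1 H2]. apply Nat.Div0.mod_divides in H2; try lia.
    destruct H2 as [c Hc]. exists c. lia.
  - intros [c Hc]. destruct d as [|d]; [lia|]. assert (c <> 0) by nia.
    split; [nia|]. subst. apply Nat.Div0.mod_mul.
Qed.

Lemma NoDup_divs (m : nat) : NoDup (divs m).
Proof. apply NoDup_filter, seq_NoDup. Qed.

(** A divisor [d] of [a * b] is recovered from [gcd d a] and [d / gcd d a]. The cofactor divides [b]
    by Gauss, being coprime to [a / gcd d a]. *)
Lemma divs_mul_le (a b : nat) : 1 <= a -> 1 <= b ->
  length (divs (a * b)) <= length (divs a) * length (divs b).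
Proof.
  intros Ha Hb. rewrite <- length_prod.
  apply (inj_length (fun d => (Nat.gcd d a, d / Nat.gcd d a))).
  - apply NoDup_divs.
  - intros x y _ _ E. injection E as E1 E2. rewrite <- E1 in E2.
    assert (Hg : Nat.gcd x a <> 0) by (intros H; apply Nat.gcd_eq_0_r in H; lia).
    destruct (Nat.gcd_divide_l x a) as [u Hu]. destruct (Nat.gcd_divide_l y a) as [v Hv].
    rewrite <- E1 in Hv. set (g := Nat.gcd x a) in *. clearbody g.
    rewrite Hu, Hv in E2. rewrite !Nat.div_mul in E2 by auto. congruence.
  - intros d Hd. apply in_divs in Hd; [|nia].
    assert (Hg : Nat.gcd d a <> 0) by (intros H; apply Nat.gcd_eq_0_r in H; lia).
    apply in_prod.
    + apply in_divs; auto. apply Nat.gcd_divide_r.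
    + apply in_divs; auto.
      assert (Hc := Nat.gcd_div_gcd d a _ Hg eq_refl).
      destruct (Nat.gcd_divide_l d a) as [u Hu]. destruct (Nat.gcd_divide_r d a) as [v Hv].
      set (g := Nat.gcd d a) in *. clearbody g.
      rewrite Hu, Hv in Hc. rewrite !Nat.div_mul in Hc by auto.
      rewrite Hu at 1. rewrite Nat.div_mul by auto.
      apply (Nat.gauss u v b); auto.
      destruct Hd as [c Hc']. exists c.
      apply (Nat.mul_cancel_r _ _ g); auto. rewrite Hu, Hv in Hc'. lia.
Qed.

Lemma gcd1_divide_pow (d p e : nat) : Nat.gcd d p = 1 -> Nat.divide d (p ^ e) -> d = 1.
Proof.
  intros Hg. induction e as [|e IH]; simpl; intros H.
  - now apply Nat.divide_1_r.
  - apply IH. apply (Nat.gauss d p); auto.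
Qed.

Lemma divs_prime_pow (p e : nat) : nprime p -> length (divs (p ^ e)) <= e + 1.
Proof.
  intros Hp. pose proof (nprime_ge2 p Hp) as Hp2. induction e as [|e IH]; [simpl; lia|].
  apply Nat.le_trans with (length (1 :: map (Nat.mul p) (divs (p ^ e)))).
  2:{ simpl. rewrite length_map. lia. }
  assert (Hpe : forall k, 1 <= p ^ k) by (intros; apply pow_ge_1; lia).
  apply NoDup_incl_length; [apply NoDup_divs|].
  intros d Hd. apply in_divs in Hd; auto.
  destruct (Zdivide_dec (Z.of_nat p) (Z.of_nat d)) as [Hpd|Hpd]; rewrite <- divide_Z in Hpd.
  - right. destruct Hpd as [c ->]. apply in_map_iff. exists c. split; [lia|].
    apply in_divs; auto. destruct Hd as [f Hf]. exists f. simpl in Hf. nia.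
  - left. symmetry. apply (gcd1_divide_pow d p (S e)); auto. apply nprime_gcd; auto.
Qed.

Lemma prime_part (p m : nat) : 2 <= p -> 1 <= m ->
  exists e m', m = p ^ e * m' /\ ~ Nat.divide p m'.
Proof.
  intros Hp. induction m as [m IH] using lt_wf_ind. intros Hm.
  destruct (excluded_middle_informative (Nat.divide p m)) as [[c Hc]|H].
  - destruct (IH c) as [e [m' [E H]]]; [nia|nia|].
    exists (S e), m'. split; auto. rewrite Hc, E. simpl. ring.
  - exists 0, m. split; auto.
Qed.

(** Induction on [B] strips off the prime [S B], if it is one. Its exponent is at most [log2 m], so
    it contributes at most one factor [log2 m + 1]. *)
Lemma smooth_divs (B m : nat) : 1 <= m ->
  (forall p, nprime p -> Nat.divide p m -> p <= B) ->
  length (divs m) <= (Nat.log2 m + 1) ^ B.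
Proof.
  revert m. induction B as [|B IH]; intros m Hm HB.
  - destruct (Nat.eq_dec m 1) as [->|]; [simpl; lia|].
    destruct (exists_nprime_divisor m) as [p [H1 H2]]; [lia|].
    specialize (HB p H1 H2). apply nprime_ge2 in H1. lia.
  - destruct (excluded_middle_informative (nprime (S B))) as [Hp|Hp].
    + pose proof (nprime_ge2 _ Hp) as Hp2.
      destruct (prime_part (S B) m Hp2 Hm) as [e [m' [E Hn]]].
      assert (Hm' : 1 <= m') by (destruct m'; lia).
      assert (Hpe : 1 <= S B ^ e) by (apply pow_ge_1; lia).
      assert (H1 : length (divs m') <= (Nat.log2 m' + 1) ^ B).
      { apply IH; auto. intros p Hp' Hd.
        assert (p <= S B) by (apply HB; auto; rewrite E; now apply Nat.divide_mul_r).
        destruct (Nat.eq_dec p (S B)); [subst; contradiction|lia]. }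
      assert (H2 : Nat.log2 m' <= Nat.log2 m) by (apply Nat.log2_le_mono; nia).
      assert (H3 : e <= Nat.log2 m).
      { apply Nat.log2_le_pow2; [lia|]. apply Nat.le_trans with (S B ^ e).
        - apply Nat.pow_le_mono_l; lia. - nia. }
      rewrite E at 1. eapply Nat.le_trans; [apply divs_mul_le; auto|].
      rewrite Nat.pow_succ_r'. apply Nat.mul_le_mono.
      * eapply Nat.le_trans; [apply divs_prime_pow; auto|]. lia.
      * eapply Nat.le_trans; [apply H1|]. apply Nat.pow_le_mono_l. lia.
    + eapply Nat.le_trans; [apply IH; auto|].
      * intros p Hp' Hd. assert (p <= S B) by auto.
        destruct (Nat.eq_dec p (S B)); [subst; contradiction|lia].
      * apply Nat.pow_le_mono_r; lia.
Qed.

(** Halving [l] lets one factor cost [2^h] and the remaining [K] factors cost [C * 2^h] by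
    induction, with [2 * h <= l]. *)
Lemma pow_le_exp2 (K : nat) : exists C, forall l, (l + 1) ^ K <= C * 2 ^ l.
Proof.
  induction K as [|K [C HC]].
  - exists 1. intros l. simpl. pose proof (pow_ge_1 2 l). lia.
  - exists (2 ^ S K * C). intros l.
    pose proof (Nat.div_mod_eq l 2) as Hl. pose proof (Nat.mod_upper_bound l 2 ltac:(lia)) as Hl2.
    set (h := l / 2) in *. assert (Hh : l + 1 <= 2 * (h + 1)) by lia.
    assert (H1 : h + 1 <= 2 ^ h).
    { clear. induction h; simpl; lia. }
    apply Nat.le_trans with ((2 * (h + 1)) ^ S K); [apply Nat.pow_le_mono_l; auto|].
    rewrite Nat.pow_mul_l. rewrite (Nat.pow_succ_r' (h+1)).
    apply Nat.le_trans with (2 ^ S K * (2 ^ h * (C * 2 ^ h))).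
    + apply Nat.mul_le_mono_l. apply Nat.mul_le_mono; auto.
    + replace (2 ^ S K * (2 ^ h * (C * 2 ^ h))) with (2 ^ S K * C * (2 ^ (h + h))).
      * apply Nat.mul_le_mono_l. apply Nat.pow_le_mono_r; lia.
      * rewrite Nat.pow_add_r. ring.
Qed.

(** The bound [d(m) << m^(1/s)] without real exponents. Removing a prime [p > 2^s] at most halves
    the divisor count, so the [s]-th power drops by at most [2^s < p]. What is left is [2^s]-smooth
    and has only polylogarithmically many divisors. *)
Lemma divisor_bound (s : nat) : exists C, forall m, 1 <= m -> length (divs m) ^ s <= C * m.
Proof.
  destruct (pow_le_exp2 (2 ^ s * s)) as [C HC]. exists C.
  intros m. induction m as [m IH] using lt_wf_ind. intros Hm.
  destruct (excluded_middle_informative (exists p, nprime p /\ Nat.divide p m /\ 2 ^ s < p))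
    as [[p [Hp [[c Hc] Hps]]]|Hno].
  - pose proof (nprime_ge2 p Hp). assert (1 <= c) by (destruct c; lia).
    assert (Hlt : c < m) by nia. specialize (IH c Hlt ltac:(auto)).
    assert (H1 : length (divs m) <= length (divs c) * 2).
    { rewrite Hc. eapply Nat.le_trans; [apply divs_mul_le; lia|].
      apply Nat.mul_le_mono_l. pose proof (divs_prime_pow p 1 Hp) as H2.
      rewrite Nat.pow_1_r in H2. lia. }
    eapply Nat.le_trans; [apply Nat.pow_le_mono_l; exact H1|].
    rewrite Nat.pow_mul_l. rewrite Hc.
    apply Nat.le_trans with (C * c * p); [|nia].
    apply Nat.mul_le_mono; auto; lia.
  - assert (Hs : length (divs m) <= (Nat.log2 m + 1) ^ (2 ^ s)).
    { apply smooth_divs; auto. intros p Hp Hd.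
      destruct (le_lt_dec p (2 ^ s)); auto. exfalso; apply Hno; eauto. }
    eapply Nat.le_trans; [apply Nat.pow_le_mono_l; exact Hs|].
    rewrite <- Nat.pow_mul_r. eapply Nat.le_trans; [apply HC|].
    apply Nat.mul_le_mono_l. apply Nat.log2_spec; lia.
Qed.

(** * Smooth numbers and prime representations *)

Definition smooth (y m : nat) : Prop := forall p, nprime p -> Nat.divide p m -> p <= y.

Lemma smooth_le (y m : nat) : 1 <= m <= y -> smooth y m.
Proof. intros H p _ Hd. apply Nat.divide_pos_le in Hd; lia. Qed.

Lemma smooth_mul (y a b : nat) : smooth y a -> smooth y b -> smooth y (a * b).
Proof. intros Ha Hb p Hp Hd. apply nprime_mul in Hd; auto. destruct Hd; auto. Qed.

Lemma smooth_mono (y z m : nat) : y <= z -> smooth y m -> smooth z m.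
Proof. intros H Hs p Hp Hd. specialize (Hs p Hp Hd). lia. Qed.

Lemma prime_rep_mono (n k k' : nat) : k' <= k -> prime_rep n k -> prime_rep n k'.
Proof.
  intros H [P [H1 H2]]. exists P. split.
  - intros j Hj. apply H1. lia.
  - intros i j Hi Hj. apply H2; lia.
Qed.

(** The easy direction of Hall's theorem: sending [m] to its prime [P (m - n)] is injective, and for
    a [y]-smooth [m] this prime lies in [[1, y]]. *)
Lemma hall_smooth (n k y : nat) (S : list nat) :
  prime_rep n k -> NoDup S -> (forall m, In m S -> n < m <= n + k /\ smooth y m) ->
  length S <= y.
Proof.
  intros [P [H1 H2]] HS Hin. rewrite <- (length_seq y 1).
  apply (inj_length (fun m => P (m - n))); auto.
  - intros u v Hu Hv E. apply Hin in Hu, Hv. apply H2 in E; lia.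
  - intros u Hu. apply Hin in Hu. destruct Hu as [Hu Hs].
    destruct (H1 (u - n)) as [Hp Hd]; [lia|].
    replace (n + (u - n)) with u in Hd by lia.
    pose proof (Hs _ Hp Hd). apply nprime_ge2 in Hp. apply in_seq. lia.
Qed.

Lemma prime_rep_1 (n : nat) : 1 <= n -> prime_rep n 1.
Proof.
  intros Hn. destruct (exists_nprime_divisor (n + 1)) as [p [H1 H2]]; [lia|].
  exists (fun _ => p). split.
  - intros j Hj. replace j with 1 by lia. auto.
  - intros; lia.
Qed.

(** Since [g] is chosen by epsilon, a maximum must be exhibited first. One failing [k] bounds all
    representable lengths by monotonicity, and length 1 is always representable. *)
Lemma g_spec (n k : nat) : 1 <= n -> ~ prime_rep n k -> is_g n (g n) /\ g n < k.
Proof.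
  intros Hn Hk.
  assert (Hex : exists j, is_g n j).
  { destruct k as [|k].
    { exfalso. apply Hk. apply (prime_rep_mono n 1); [lia|]. apply prime_rep_1; auto. }
    revert Hk. induction k as [|k IH]; intros Hk.
    - exfalso; apply Hk. now apply prime_rep_1.
    - destruct (excluded_middle_informative (prime_rep n (S k))) as [H|H]; auto.
      exists (S k). split; [lia|]. split; auto. intros k' _ H'.
      destruct (le_lt_dec k' (S k)); auto. exfalso. apply Hk. apply (prime_rep_mono n k'); auto. }
  assert (Hg : is_g n (g n)) by (unfold g; apply epsilon_spec; auto).
  split; auto. destruct Hg as [_ [Hg _]].
  destruct (le_lt_dec k (g n)); auto. exfalso. apply Hk. apply (prime_rep_mono n (g n)); auto.
Qed.

(** * Coprime pairs and lattice points near a hyperbola *)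

Lemma nat_crossing (P : nat -> Prop) (N : nat) :
  P 0 -> ~ P N -> exists i, P i /\ ~ P (S i).
Proof.
  intros H0. induction N as [|N IH]; intros HN; [contradiction|].
  destruct (excluded_middle_informative (P N)) as [H|H]; [exists N; auto|auto].
Qed.

Section Coprime.
Local Open Scope R_scope.

(** Keeping the term [1/4] at [d = 2] exact and telescoping the rest gives [1/4 + 1/2 = 3/4]. A
    constant below 1 is what leaves a positive proportion of coprime pairs. *)
Lemma sum_inv_squares (R m : nat) : (1 <= m)%nat ->
  INR (list_sum (map (fun d => (R / d) * (R / d))%nat (seq 2 m)))
    <= INR R ^ 2 * (3 / 4 - / INR (m + 1)).
Proof.
  assert (Hd : forall d, (1 <= d)%nat -> INR ((R / d) * (R / d)) <= INR R ^ 2 * (/ INR d) ^ 2).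
  { intros d Hd. assert (0 < INR d) by (apply lt_0_INR; lia).
    assert (H1 : INR (R / d) <= INR R * / INR d).
    { apply Rmult_le_reg_r with (INR d); auto. rewrite Rmult_assoc, Rinv_l, Rmult_1_r by lra.
      rewrite <- mult_INR. apply le_INR. rewrite Nat.mul_comm. apply Nat.Div0.mul_div_le. }
    rewrite mult_INR, <- Rpow_mult_distr. pose proof (pos_INR (R / d)). simpl. nra. }
  induction m as [|m IH]; intros Hm; [lia|].
  destruct (Nat.eq_dec m 0) as [->|Hm0].
  - replace (list_sum (map (fun d => (R / d * (R / d))%nat) (seq 2 1)))
      with ((R / 2) * (R / 2))%nat by (cbn [seq map list_sum fold_right]; lia).
    eapply Rle_trans; [apply Hd; lia|]. simpl. pose proof (pos_INR R). nra.
  - rewrite seq_S, map_app, list_sum_app, plus_INR.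
    specialize (IH ltac:(lia)). cbn [map list_sum fold_right]. rewrite Nat.add_0_r.
    specialize (Hd (2 + m)%nat ltac:(lia)).
    assert (H1 : (/ INR (2 + m)) ^ 2 <= / INR (m + 1) - / INR (S m + 1)).
    { replace (S m + 1)%nat with (2 + m)%nat by lia.
      rewrite !plus_INR. pose proof (pos_INR m). simpl INR.
      apply Rle_trans with (/ (1 + 1 + INR m) * / (INR m + 1)).
      - simpl. rewrite Rmult_1_r. apply Rmult_le_compat_l.
        + left; apply Rinv_0_lt_compat; lra.
        + apply Rinv_le_contravar; lra.
      - right. field. lra. }
    assert (0 <= INR R ^ 2) by (apply pow2_ge_0). nra.
Qed.

End Coprime.

Definition coprime_pairs (R : nat) : list (nat * nat) :=
  filter (fun x => Nat.gcd (fst x) (snd x) =? 1) (list_prod (seq 1 R) (seq 1 R)).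

(** Each pair that is not coprime lies in the box of multiples of some [d >= 2], and these boxes
    together hold at most [3/4] of all pairs. *)
Lemma coprime_pairs_length (R : nat) : R * R <= 4 * length (coprime_pairs R).
Proof.
  destruct (le_lt_dec R 1) as [H1|H1].
  { destruct R as [|[|]]; try lia. simpl. lia. }
  pose proof (filter_length (fun x => Nat.gcd (fst x) (snd x) =? 1)
    (list_prod (seq 1 R) (seq 1 R))) as HF.
  rewrite length_prod, length_seq in HF. fold (coprime_pairs R) in HF.
  set (L := filter _ _) in HF at 1.
  assert (HL : 4 * length L <= 3 * (R * R)).
  { set (box := fun d => map (fun x : nat * nat => (d * fst x, d * snd x))
                   (list_prod (seq 1 (R / d)) (seq 1 (R / d)))).
    assert (HI : length L <= length (flat_map box (seq 2 (R - 1)))).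
    { apply NoDup_incl_length.
      - apply NoDup_filter, NoDup_list_prod; apply seq_NoDup.
      - intros [p q] H. apply filter_In in H. destruct H as [H H2].
        apply in_prod_iff in H. rewrite !in_seq in H. simpl in H2.
        destruct (Nat.gcd_divide_l p q) as [u Hu]. destruct (Nat.gcd_divide_r p q) as [v Hv].
        set (d := Nat.gcd p q) in *. clearbody d.
        assert (Hd1 : d <> 1) by (intros ->; discriminate).
        assert (Hd0 : d <> 0) by lia. assert (u <> 0) by lia. assert (v <> 0) by lia.
        apply in_flat_map. exists d. split; [apply in_seq; nia|].
        apply in_map_iff. exists (u, v). split; [simpl; f_equal; lia|].
        apply in_prod_iff. rewrite !in_seq.
        assert (u <= R / d) by (apply Nat.div_le_lower_bound; lia).
        assert (v <= R / d) by (apply Nat.div_le_lower_bound; lia). lia. }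
    rewrite length_flat_map in HI.
    replace (map (fun x => length (box x)) (seq 2 (R - 1)))
      with (map (fun d => (R / d) * (R / d)) (seq 2 (R - 1))) in HI.
    2:{ apply map_ext. intros d. unfold box. now rewrite length_map, length_prod, length_seq. }
    pose proof (sum_inv_squares R (R - 1) ltac:(lia)) as HS.
    apply le_INR in HI. apply INR_le. rewrite !mult_INR.
    assert (0 < / INR (R - 1 + 1))%R by (apply Rinv_0_lt_compat, lt_0_INR; lia).
    simpl INR. simpl pow in *. nra. }
  lia.
Qed.

(** The lower bound [R / 16] on both coordinates fixes the sizes of [b] and [c] up to constants. The
    two discarded strips hold at most [R^2 / 8] pairs, half of the guaranteed [R^2 / 4]. *)
Definition balanced_pairs (R : nat) : list (nat * nat) :=
  filter (fun x => ((R <? 16 * fst x) && (R <? 16 * snd x))%bool) (coprime_pairs R).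

Lemma in_balanced_pairs (R p q : nat) : In (p, q) (balanced_pairs R) ->
  Nat.gcd p q = 1 /\ p <= R /\ q <= R /\ R < 16 * p /\ R < 16 * q.
Proof.
  unfold balanced_pairs, coprime_pairs. rewrite !filter_In, in_prod_iff, !in_seq.
  simpl. rewrite Bool.andb_true_iff, Nat.eqb_eq, !Nat.ltb_lt. lia.
Qed.

Lemma NoDup_balanced_pairs (R : nat) : NoDup (balanced_pairs R).
Proof. apply NoDup_filter, NoDup_filter, NoDup_list_prod; apply seq_NoDup. Qed.

Lemma balanced_pairs_length (R : nat) : R * R <= 8 * length (balanced_pairs R).
Proof.
  pose proof (coprime_pairs_length R) as HC.
  pose proof (filter_length (fun x => ((R <? 16 * fst x) && (R <? 16 * snd x))%bool)
    (coprime_pairs R)) as HF. fold (balanced_pairs R) in HF.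
  set (L := filter _ _) in HF at 1.
  assert (HL : length L <= length (list_prod (seq 1 (R / 16)) (seq 1 R)
                                   ++ list_prod (seq 1 R) (seq 1 (R / 16)))).
  { apply NoDup_incl_length.
    - apply NoDup_filter, NoDup_filter, NoDup_list_prod; apply seq_NoDup.
    - intros [p q] H. apply filter_In in H. destruct H as [H H2].
      apply filter_In in H. destruct H as [H _]. apply in_prod_iff in H. rewrite !in_seq in H.
      simpl in H2. rewrite Bool.negb_true_iff, Bool.andb_false_iff, !Nat.ltb_ge in H2.
      apply in_app_iff. rewrite !in_prod_iff, !in_seq.
      destruct H2 as [H2|H2]; [left|right].
      + assert (p <= R / 16) by (apply Nat.div_le_lower_bound; lia). lia.
      + assert (q <= R / 16) by (apply Nat.div_le_lower_bound; lia). lia. }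
  rewrite length_app, !length_prod, !length_seq in HL.
  assert (16 * (R / 16) <= R) by (apply Nat.Div0.mul_div_le). nia.
Qed.

Section Lattice.
Local Open Scope Z_scope.

Lemma pos_of_mul_pos (q b : Z) : 0 < q -> 0 < q * b -> 0 < b.
Proof. nia. Qed.

Lemma le_mul_sq (a x : Z) : 1 <= a -> 1 <= x -> x <= a * x ^ 2.
Proof. nia. Qed.

Lemma sq_lt_inv (x y : Z) : 0 <= y -> x ^ 2 < y ^ 2 -> x < y.
Proof. nia. Qed.

(** The solutions of [q b + p c = E] form a progression along which [D = p c - q b] moves in steps
    of [2pq]. Take a step where [a D^2] is still below [W = a E^2 - 4pqn] but the next value is not.
    From [4pq abc = a E^2 - a D^2] the product exceeds [n], by at most [a D + a p q]. Each of these
    two terms is at most [k / 2], by the second and third inequality assumed. *)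
Lemma lattice_point (n k a p q E : Z) :
  0 < n -> 0 < k -> 0 < a -> 0 < p -> 0 < q -> 0 < E -> rel_prime p q ->
  4 * p * q * n + a * (2 * p * q) ^ 2 < a * E ^ 2 ->
  4 * a * (a * E ^ 2 - 4 * p * q * n) <= k ^ 2 ->
  2 * a * p * q <= k ->
  exists b c, 0 < b /\ 0 < c /\ n < a * b * c <= n + k /\ q * b + p * c = E /\
    0 <= p * c - q * b /\ 2 * a * (p * c - q * b) < k.
Proof.
  intros Hn Hk Ha Hp Hq HE Hpq H1 H2 H3.
  apply rel_prime_sym in Hpq. apply rel_prime_bezout in Hpq. destruct Hpq as [u v Huv].
  (* The Bezout relation [u q + v p = 1] gives the particular solution [b = u E], [c = v E], whose
     difference is [D0]. *)
  set (D0 := p * (v * E) - q * (u * E)). set (m := 2 * p * q) in *.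
  assert (Hpq : 0 < p * q) by (apply Z.mul_pos_pos; auto).
  assert (Hpqn : 0 < p * q * n) by (apply Z.mul_pos_pos; auto).
  assert (Hm : 0 < m) by (unfold m; lia).
  pose proof (Z.mod_pos_bound D0 m Hm) as HD1. pose proof (Z.div_mod D0 m ltac:(lia)) as HD0.
  set (D1 := D0 mod m) in *. set (l0 := D0 / m) in *.
  set (W := a * E ^ 2 - 4 * p * q * n) in *.
  assert (HW : a * m ^ 2 < W) by (unfold W; lia).
  assert (HW0 : 0 < W).
  { apply Z.le_lt_trans with (a * m ^ 2); auto. apply Z.mul_nonneg_nonneg; [lia|].
    apply Z.pow_nonneg; lia. }
  (* The crossing starts at the residue [D1 < 2pq], which is admissible because [a (2pq)^2 < W]. *)
  destruct (nat_crossing (fun i => a * (D1 + Z.of_nat i * m) ^ 2 < W) (Z.to_nat W)) as [i [Hi1 Hi2]].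
  { replace (D1 + Z.of_nat 0 * m) with D1 by (simpl Z.of_nat; ring).
    apply Z.le_lt_trans with (a * m ^ 2); auto. apply Z.mul_le_mono_nonneg_l; [lia|].
    apply Z.pow_le_mono_l; lia. }
  { rewrite Z2Nat.id by lia. intros H.
    assert (HX : W <= D1 + W * m) by (clear - HD1 HW0 Hm; nia).
    pose proof (le_mul_sq a (D1 + W * m)). lia. }
  set (l := l0 - Z.of_nat i).
  assert (Hi0 : 0 <= Z.of_nat i * m) by (apply Z.mul_nonneg_nonneg; lia).
  remember (D1 + Z.of_nat i * m) as D eqn:ED.
  assert (HDl : D = D0 - m * l) by (rewrite ED; unfold l; rewrite HD0; ring).
  replace (D1 + Z.of_nat (S i) * m) with (D + m) in Hi2 by (rewrite ED; lia).
  assert (HD : 0 <= D) by lia.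
  set (b := u * E + p * l). set (c := v * E - q * l).
  assert (Hbc : q * b + p * c = E).
  { unfold b, c. transitivity ((u * q + v * p) * E); [ring|]. rewrite Huv. ring. }
  assert (HDbc : p * c - q * b = D) by (rewrite HDl; unfold b, c, D0, m; ring).
  clearbody b c. clear ED HDl.
  assert (Hq2 : 2 * (q * b) = E - D) by lia. assert (Hp2 : 2 * (p * c) = E + D) by lia.
  assert (HDE : D < E).
  { apply sq_lt_inv; [lia|]. apply (Z.mul_lt_mono_pos_l a); auto. lia. }
  assert (Hb : 0 < b) by (apply (pos_of_mul_pos q); lia).
  assert (Hc : 0 < c) by (apply (pos_of_mul_pos p); lia).
  assert (HaD : 2 * a * D < k).
  { apply sq_lt_inv; [lia|]. replace ((2 * a * D) ^ 2) with (4 * a * (a * D ^ 2)) by ring.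
    apply Z.lt_le_trans with (4 * a * W); [apply Z.mul_lt_mono_pos_l; lia|lia]. }
  assert (Habc : 4 * (p * q) * (a * b * c) = a * E ^ 2 - a * D ^ 2).
  { transitivity (a * ((2 * (q * b)) * (2 * (p * c)))); [ring|]. rewrite Hq2, Hp2. ring. }
  exists b, c. rewrite HDbc. repeat split; auto.
  - apply (Z.mul_lt_mono_pos_l (4 * (p * q))); [lia|]. rewrite Habc. unfold W in Hi1. lia.
  - apply (Z.mul_le_mono_pos_l _ _ (4 * (p * q))); [lia|]. rewrite Habc.
    assert (HWu : W <= a * (D + m) ^ 2) by lia.
    assert (Hid : a * (D + m) ^ 2 - a * D ^ 2 = 4 * (p * q) * (a * D + a * p * q)) by (unfold m; ring).
    assert (Hk' : 4 * (p * q) * (a * D + a * p * q) <= 4 * (p * q) * k)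
      by (apply Z.mul_le_mono_nonneg_l; lia).
    unfold W in HWu. lia.
Qed.

End Lattice.

(** * Sizes of the factors, and recovery of the ratio from them *)

Open Scope Z_scope.

Lemma mul_le_compat (a b c d : Z) : 0 <= a -> 0 <= b -> a <= c -> b <= d -> a * b <= c * d.
Proof. intros. apply Z.mul_le_mono_nonneg; auto. Qed.

Lemma pow_step (w : Z) (i j : nat) (c d : Z) : 1 <= w -> (i < j)%nat -> 0 <= c -> c <= d * w ->
  c * w ^ Z.of_nat i <= d * w ^ Z.of_nat j.
Proof.
  intros Hw Hij Hc H.
  replace (Z.of_nat j) with (1 + (Z.of_nat (j - i - 1) + Z.of_nat i)) by lia.
  rewrite !Z.pow_add_r by lia. rewrite Z.pow_1_r.
  rewrite !Z.mul_assoc. apply Z.mul_le_mono_nonneg_r; [lia|].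
  apply Z.le_trans with (d * w * 1); [lia|]. apply Z.mul_le_mono_nonneg_l; lia.
Qed.

Section Size.
Variables w n a p q v s : Z.
Hypothesis Hw : 1000 <= w.
Hypothesis Hn : w ^ 23 <= n <= 2 * w ^ 23.
Hypothesis Ha : w ^ 5 < a <= 2 * w ^ 5.
Hypothesis Hp : 0 < p <= w ^ 2.
Hypothesis Hq : 0 < q <= w ^ 2.
Hypothesis Hp' : w ^ 2 < 16 * p.
Hypothesis Hq' : w ^ 2 < 16 * q.
Hypothesis Hv : 0 <= v /\ 256 * (v + 1) <= w.
Hypothesis Hs0 : 0 <= s.
Hypothesis Hs1 : a * s ^ 2 <= 4 * p * q * n + a * (2 * p * q) ^ 2.
Hypothesis Hs2 : 4 * p * q * n + a * (2 * p * q) ^ 2 < a * (s + 1) ^ 2.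

Lemma size_pq : 0 < p * q <= w ^ 4.
Proof.
  split; [apply Z.mul_pos_pos; lia|]. replace (w ^ 4) with (w ^ 2 * w ^ 2) by ring.
  apply mul_le_compat; lia.
Qed.

(** Here [4pqn / a] is at most [8 w^22], and [9 w^22] leaves room for the correction
    [(2pq)^2 <= 4 w^8]. *)
Lemma size_s : s <= 3 * w ^ 11.
Proof.
  pose proof size_pq as Hpq.
  assert (H1 : p * q * n <= w ^ 4 * (2 * w ^ 23)) by (apply mul_le_compat; lia).
  assert (H2 : (p * q) * (p * q) <= w ^ 4 * w ^ 4) by (apply mul_le_compat; lia).
  assert (H0 : 0 < w ^ 5) by (apply Z.pow_pos_nonneg; lia).
  assert (H22 : 0 < w ^ 22) by (apply Z.pow_pos_nonneg; lia).
  assert (H8 : 0 < w ^ 8) by (apply Z.pow_pos_nonneg; lia).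
  assert (H3 : w ^ 8 * 5 <= w ^ 22).
  { pose proof (pow_step w 8 22 5 1). simpl Z.of_nat in *. lia. }
  destruct (Z.le_gt_cases s (3 * w ^ 11)) as [|Hs]; auto. exfalso.
  assert (H4 : (3 * w ^ 11) ^ 2 <= s ^ 2) by (apply Z.pow_le_mono_l; lia).
  replace ((3 * w ^ 11) ^ 2) with (9 * w ^ 22) in H4 by ring.
  assert (H5 : w ^ 5 * (s ^ 2 - 4 * w ^ 8) < a * (s ^ 2 - 4 * w ^ 8)) by (apply Z.mul_lt_mono_pos_r; lia).
  assert (H6 : w ^ 5 * (9 * w ^ 22 - 4 * w ^ 8) <= w ^ 5 * (s ^ 2 - 4 * w ^ 8)) by (apply Z.mul_le_mono_nonneg_l; lia).
  assert (H7 : a * ((p * q) * (p * q)) <= a * (w ^ 4 * w ^ 4)) by (apply Z.mul_le_mono_nonneg_l; lia).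
  assert (H9 : w ^ 5 * (w ^ 22 - 4 * w ^ 8) > 0) by (apply Z.lt_gt, Z.mul_pos_pos; lia).
  replace (w ^ 4 * (2 * w ^ 23)) with (2 * (w ^ 5 * w ^ 22)) in H1 by ring.
  replace (w ^ 4 * w ^ 4) with (w ^ 8) in H7 by ring.
  replace (4 * p * q * n) with (4 * (p * q * n)) in Hs1 by ring.
  replace (a * (2 * p * q) ^ 2) with (4 * (a * ((p * q) * (p * q)))) in Hs1 by ring.
  lia.
Qed.

(** Balancedness gives [4pqn / a >= w^22 / 128], and [128 < 12^2]. *)
Lemma size_E_lower : w ^ 11 <= 12 * (s + 1).
Proof.
  destruct (Z.le_gt_cases (w ^ 11) (12 * (s + 1))) as [|Hs]; auto. exfalso.
  assert (H4 : (12 * (s + 1)) ^ 2 <= (w ^ 11) ^ 2) by (apply Z.pow_le_mono_l; lia).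
  replace ((12 * (s + 1)) ^ 2) with (144 * (s + 1) ^ 2) in H4 by ring.
  replace ((w ^ 11) ^ 2) with (w ^ 22) in H4 by ring.
  assert (H1 : w ^ 2 * w ^ 2 <= (16 * p) * (16 * q)) by (apply mul_le_compat; lia).
  assert (H2 : (w ^ 2 * w ^ 2) * w ^ 23 <= ((16 * p) * (16 * q)) * n).
  { apply mul_le_compat; try lia. }
  assert (H3 : a * (144 * (s + 1) ^ 2) <= (2 * w ^ 5) * w ^ 22).
  { apply mul_le_compat; try lia. }
  assert (0 <= a * (2 * p * q) ^ 2).
  { apply Z.mul_nonneg_nonneg; [lia|]. apply Z.pow_nonneg. apply Z.mul_nonneg_nonneg; lia. }
  replace ((w ^ 2 * w ^ 2) * w ^ 23) with (w ^ 5 * w ^ 22) in H2 by ring.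
  lia.
Qed.

(** The excess over [4pqn] is at most [a] times [4 p^2 q^2 + 2 s (v + 1) + (v + 1)^2]. The middle
    term dominates, and with [s <= 3 w^11] the restriction [256 (v + 1) <= w] keeps the whole
    bracket below [w^12 / 16]. *)
Lemma size_window : 4 * a * (a * (s + 1 + v) ^ 2 - 4 * p * q * n) <= (w ^ 11) ^ 2.
Proof.
  pose proof size_pq as Hpq. pose proof size_s as Hs.
  assert (H5 : 0 < w ^ 5) by (apply Z.pow_pos_nonneg; lia).
  assert (H22 : 0 < w ^ 22) by (apply Z.pow_pos_nonneg; lia).
  assert (H11 : 0 < w ^ 11) by (apply Z.pow_pos_nonneg; lia).
  assert (Haa : a * a <= (2 * w ^ 5) * (2 * w ^ 5)) by (apply mul_le_compat; lia).
  assert (Haa0 : 0 <= a * a) by (apply Z.mul_nonneg_nonneg; lia).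
  assert (E1 : a * (s + 1 + v) ^ 2 - 4 * p * q * n
     <= a * (4 * ((p * q) * (p * q)) + 2 * (s * (v + 1)) + (v + 1) * (v + 1))).
  { replace (a * (s + 1 + v) ^ 2) with (a * s ^ 2 + a * (2 * (s * (v + 1)) + (v + 1) * (v + 1))) by ring.
    replace (a * (2 * p * q) ^ 2) with (a * (4 * ((p * q) * (p * q)))) in Hs1 by ring. lia. }
  assert (E2 : (p * q) * (p * q) <= w ^ 4 * w ^ 4) by (apply mul_le_compat; lia).
  assert (E3 : s * (256 * (v + 1)) <= (3 * w ^ 11) * w) by (apply mul_le_compat; lia).
  assert (E4 : (256 * (v + 1)) * (256 * (v + 1)) <= w * w) by (apply mul_le_compat; lia).
  assert (E5 : 256 * w ^ 8 <= 1 * w ^ 12) by (apply (pow_step w 8 12 256 1); lia).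
  assert (E6 : 64 * w ^ 2 <= 1 * w ^ 12) by (apply (pow_step w 2 12 64 1); lia).
  assert (E7 : 16 * (4 * ((p * q) * (p * q)) + 2 * (s * (v + 1)) + (v + 1) * (v + 1)) <= w ^ 12).
  { replace (w ^ 4 * w ^ 4) with (w ^ 8) in E2 by ring.
    replace (3 * w ^ 11 * w) with (3 * w ^ 12) in E3 by ring.
    replace (w * w) with (w ^ 2) in E4 by ring. lia. }
  set (T := 4 * ((p * q) * (p * q)) + 2 * (s * (v + 1)) + (v + 1) * (v + 1)) in *.
  assert (HT : 0 <= T).
  { assert (0 <= (p * q) * (p * q)) by (apply Z.mul_nonneg_nonneg; lia).
    assert (0 <= s * (v + 1)) by (apply Z.mul_nonneg_nonneg; lia).
    assert (0 <= (v + 1) * (v + 1)) by (apply Z.mul_nonneg_nonneg; lia). unfold T; lia. }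
  apply Z.le_trans with (4 * a * (a * T)); [apply Z.mul_le_mono_nonneg_l; lia|].
  assert (E8 : (a * a) * (16 * T) <= ((2 * w ^ 5) * (2 * w ^ 5)) * w ^ 12) by (apply mul_le_compat; lia).
  replace ((w ^ 11) ^ 2) with (w ^ 5 * w ^ 5 * w ^ 12) by ring. lia.
Qed.

Lemma size_step : 2 * a * p * q <= w ^ 11.
Proof.
  pose proof size_pq as Hpq.
  assert (a * (p * q) <= (2 * w ^ 5) * w ^ 4) by (apply mul_le_compat; lia).
  assert (4 * w ^ 9 <= 1 * w ^ 11) by (apply (pow_step w 9 11 4 1); lia).
  replace (2 * w ^ 5 * w ^ 4) with (2 * w ^ 9) in H by ring. lia.
Qed.

(** The difference [D] is tiny compared with [E], so [q b] and [p c] are both close to [E / 2]. The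
    upper bounds give smoothness; the lower bound on [b] and the bound on [D] make the ratio
    recoverable. *)
Lemma size_factors (b c : Z) : 0 < b -> 0 < c ->
  q * b + p * c = s + 1 + v -> 0 <= p * c - q * b -> 2 * a * (p * c - q * b) < w ^ 11 ->
  b <= 32 * w ^ 9 /\ c <= 32 * w ^ 9 /\ w ^ 8 <= b /\ 2 * (p * c - q * b) <= w ^ 6.
Proof.
  intros Hb Hc HE HD HaD. pose proof size_s as Hs. pose proof size_E_lower as HEl.
  assert (H6 : 2 * (p * c - q * b) <= w ^ 6).
  { destruct (Z.le_gt_cases (2 * (p * c - q * b)) (w ^ 6)) as [|H]; auto. exfalso.
    assert (w ^ 5 * w ^ 6 <= a * (2 * (p * c - q * b))).
    { assert (0 < w ^ 5) by (apply Z.pow_pos_nonneg; lia).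
      assert (0 < w ^ 6) by (apply Z.pow_pos_nonneg; lia). apply mul_le_compat; lia. }
    replace (w ^ 5 * w ^ 6) with (w ^ 11) in H0 by ring. lia. }
  assert (P1 : 8 * w ^ 6 <= 1 * w ^ 11) by (apply (pow_step w 6 11 8 1); lia).
  assert (P2 : 8 * w ^ 1 <= 1 * w ^ 11) by (apply (pow_step w 1 11 8 1); lia).
  rewrite Z.pow_1_r in P2.
  assert (H2 : 0 < w ^ 2) by (apply Z.pow_pos_nonneg; lia).
  assert (Hbb : w ^ 2 * b <= (16 * q) * b) by (apply Z.mul_le_mono_nonneg_r; lia).
  assert (Hcc : w ^ 2 * c <= (16 * p) * c) by (apply Z.mul_le_mono_nonneg_r; lia).
  repeat split; auto.
  - apply (Z.mul_le_mono_pos_l _ _ (w ^ 2)); auto.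
    replace (w ^ 2 * (32 * w ^ 9)) with (32 * w ^ 11) by ring. lia.
  - apply (Z.mul_le_mono_pos_l _ _ (w ^ 2)); auto.
    replace (w ^ 2 * (32 * w ^ 9)) with (32 * w ^ 11) by ring. lia.
  - assert (Hqb : q * b <= w ^ 2 * b) by (apply Z.mul_le_mono_nonneg_r; lia).
    apply (Z.mul_le_mono_pos_l _ _ (w ^ 2)); auto.
    replace (w ^ 2 * w ^ 8) with (w ^ 10) by ring.
    assert (P3 : 48 * w ^ 10 <= 1 * w ^ 11) by (apply (pow_step w 10 11 48 1); lia).
    assert (P4 : 1 * w ^ 6 <= 1 * w ^ 10) by (apply (pow_step w 6 10 1 1); lia). lia.
Qed.

End Size.

(** Both [p/q] and [p'/q'] approximate [b/c]. The integer [p' q - p q'] times [b] equals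
    [p D' - p' D], which is at most [w^8 / 2] in absolute value, hence smaller than [b]. So the
    integer vanishes, and two fractions in lowest terms coincide. *)
Lemma factors_determine_ratio (w p q p' q' b c : Z) :
  1 <= w -> 0 < b -> w ^ 8 <= b ->
  0 < p <= w ^ 2 -> 0 < p' <= w ^ 2 -> 0 < q -> 0 < q' ->
  rel_prime p q -> rel_prime p' q' ->
  0 <= p * c - q * b -> 2 * (p * c - q * b) <= w ^ 6 ->
  0 <= p' * c - q' * b -> 2 * (p' * c - q' * b) <= w ^ 6 ->
  p = p' /\ q = q'.
Proof.
  intros Hw Hb Hbw Hp Hp' Hq Hq' R R' H1 H2 H3 H4.
  set (D := p * c - q * b) in *. set (D' := p' * c - q' * b) in *.
  assert (E : b * (p' * q - p * q') = p * D' - p' * D) by (unfold D, D'; ring).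
  assert (U1 : p * (2 * D') <= w ^ 2 * w ^ 6) by (apply mul_le_compat; lia).
  assert (U2 : p' * (2 * D) <= w ^ 2 * w ^ 6) by (apply mul_le_compat; lia).
  replace (w ^ 2 * w ^ 6) with (w ^ 8) in * by ring.
  assert (Ex : p' * q - p * q' = 0).
  { set (x := p' * q - p * q') in *. clearbody x.
    destruct (Z.lt_trichotomy x 0) as [Hx|[Hx|Hx]]; auto; exfalso.
    - assert (b * x <= b * -1) by (apply Z.mul_le_mono_nonneg_l; lia). lia.
    - assert (b * 1 <= b * x) by (apply Z.mul_le_mono_nonneg_l; lia). lia. }
  assert (Hpp : p = p').
  { apply Z.divide_antisym_nonneg; try lia.
    - apply Gauss with q; [exists q'; lia|auto].
    - apply Gauss with q'; [exists q; lia|auto]. }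
  split; auto. subst p'. assert (p * q = p * q') by lia.
  apply Z.mul_cancel_l in H; lia.
Qed.

(** * Intervals shorter than the square root *)

Open Scope nat_scope.

Lemma rel_prime_of_gcd (p q : nat) : Nat.gcd p q = 1 -> rel_prime (Z.of_nat p) (Z.of_nat q).
Proof.
  intros H. constructor; try apply Z.divide_1_l.
  intros x Hx Hy. rewrite <- Z.divide_abs_l, <- Zabs2Nat.id_abs in *.
  change 1%Z with (Z.of_nat 1). rewrite <- H. rewrite <- divide_Z in *.
  now apply Nat.gcd_greatest.
Qed.

(* The least [E] with [4pqn + 4ap^2q^2 < a E^2]. *)
Definition start_E (n a p q : nat) : nat :=
  S (Nat.sqrt ((4 * p * q * n + a * (2 * p * q) ^ 2) / a)).

Definition good_factors (w n a p q v b c : nat) : Prop :=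
  1 <= b /\ 1 <= c /\ n < a * b * c <= n + w ^ 11 /\ q * b + p * c = start_E n a p q + v /\
  q * b <= p * c /\ 2 * (p * c - q * b) <= w ^ 6 /\ w ^ 8 <= b /\
  b <= 32 * w ^ 9 /\ c <= 32 * w ^ 9.

Lemma exists_factors (w n a p q v : nat) :
  1000 <= w -> w ^ 23 <= n <= 2 * w ^ 23 -> w ^ 5 < a <= 2 * w ^ 5 ->
  In (p, q) (balanced_pairs (w ^ 2)) -> v < w / 256 ->
  exists b c, good_factors w n a p q v b c.
Proof.
  intros Hw Hn Ha Hpq Hv. apply in_balanced_pairs in Hpq.
  destruct Hpq as [Hg [Hp [Hq [Hp' Hq']]]].
  assert (Hv' : 256 * (v + 1) <= w).
  { pose proof (Nat.Div0.mul_div_le w 256). lia. }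
  unfold good_factors, start_E.
  set (X := 4 * p * q * n + a * (2 * p * q) ^ 2).
  assert (Ha0 : a <> 0) by lia.
  pose proof (Nat.sqrt_spec (X / a) ltac:(lia)) as [S1 S2].
  set (s := Nat.sqrt (X / a)) in *.
  assert (S3 : a * (s * s) <= X).
  { eapply Nat.le_trans; [apply Nat.mul_le_mono_l, S1|]. apply Nat.Div0.mul_div_le. }
  assert (S4 : X < a * (S s * S s)).
  { eapply Nat.lt_le_trans; [apply (Nat.mul_succ_div_gt X a Ha0)|]. apply Nat.mul_le_mono_l. lia. }
  clearbody s. unfold X in *. clear X S1 S2.
  assert (Zw : (1000 <= Z.of_nat w)%Z) by lia.
  assert (Zpow : forall k, Z.of_nat (w ^ k) = (Z.of_nat w ^ Z.of_nat k)%Z) by (intros; apply Nat2Z.inj_pow).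
  assert (Zn : (Z.of_nat w ^ 23 <= Z.of_nat n <= 2 * Z.of_nat w ^ 23)%Z).
  { change 23%Z with (Z.of_nat 23). rewrite <- Zpow. lia. }
  assert (Za : (Z.of_nat w ^ 5 < Z.of_nat a <= 2 * Z.of_nat w ^ 5)%Z).
  { change 5%Z with (Z.of_nat 5). rewrite <- Zpow. lia. }
  assert (Z2 : (Z.of_nat (w ^ 2) = Z.of_nat w ^ 2)%Z) by apply Zpow.
  assert (Zs1 : (Z.of_nat a * Z.of_nat s ^ 2 <= 4 * Z.of_nat p * Z.of_nat q * Z.of_nat n
      + Z.of_nat a * (2 * Z.of_nat p * Z.of_nat q) ^ 2)%Z).
  { rewrite !Z.pow_2_r. rewrite Nat.pow_2_r in S3. lia. }
  assert (Zs2 : (4 * Z.of_nat p * Z.of_nat q * Z.of_nat n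
      + Z.of_nat a * (2 * Z.of_nat p * Z.of_nat q) ^ 2 < Z.of_nat a * (Z.of_nat s + 1) ^ 2)%Z).
  { rewrite !Z.pow_2_r. rewrite Nat.pow_2_r in S4. lia. }
  assert (P1 : (0 < Z.of_nat p <= Z.of_nat w ^ 2)%Z) by lia.
  assert (P2 : (0 < Z.of_nat q <= Z.of_nat w ^ 2)%Z) by lia.
  assert (P3 : (Z.of_nat w ^ 2 < 16 * Z.of_nat p)%Z) by lia.
  assert (P4 : (Z.of_nat w ^ 2 < 16 * Z.of_nat q)%Z) by lia.
  assert (P5 : (0 <= Z.of_nat v /\ 256 * (Z.of_nat v + 1) <= Z.of_nat w)%Z) by lia.
  assert (P6 : (0 <= Z.of_nat s)%Z) by lia.
  assert (P0 : (0 < Z.of_nat w ^ 5)%Z) by (apply Z.pow_pos_nonneg; lia).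
  assert (P01 : (0 < Z.of_nat w ^ 11)%Z) by (apply Z.pow_pos_nonneg; lia).
  assert (P02 : (0 < Z.of_nat w ^ 23)%Z) by (apply Z.pow_pos_nonneg; lia).
  pose proof (rel_prime_of_gcd _ _ Hg) as Hr.
  destruct (lattice_point (Z.of_nat n) (Z.of_nat w ^ 11) (Z.of_nat a) (Z.of_nat p) (Z.of_nat q)
    (Z.of_nat s + 1 + Z.of_nat v)) as [b [c [B1 [B2 [B3 [B4 [B5 B6]]]]]]];
    [clear - Zn P02; lia|auto|clear - Za P0; lia|clear - P1; lia|clear - P2; lia
    |clear - P5 P6; lia|auto| | | |].
  - eapply Z.lt_le_trans; [exact Zs2|]. apply Z.mul_le_mono_nonneg_l; [clear; lia|].
    apply Z.pow_le_mono_l; clear - P5 P6; lia.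
  - eapply size_window; eauto.
  - eapply size_step; eauto.
  - destruct (size_factors (Z.of_nat w) (Z.of_nat n) (Z.of_nat a) (Z.of_nat p) (Z.of_nat q)
      (Z.of_nat v) (Z.of_nat s) Zw Zn Za P1 P2 P3 P4 P5 P6 Zs1 Zs2 b c) as [F1 [F2 [F3 F4]]]; auto.
    exists (Z.to_nat b), (Z.to_nat c).
    assert (Q6 : (Z.of_nat (w ^ 6) = Z.of_nat w ^ 6)%Z) by apply Zpow.
    assert (Q8 : (Z.of_nat (w ^ 8) = Z.of_nat w ^ 8)%Z) by apply Zpow.
    assert (Q9 : (Z.of_nat (w ^ 9) = Z.of_nat w ^ 9)%Z) by apply Zpow.
    assert (Q11 : (Z.of_nat (w ^ 11) = Z.of_nat w ^ 11)%Z) by apply Zpow.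
    assert (Eb : Z.of_nat (Z.to_nat b) = b) by lia. assert (Ec : Z.of_nat (Z.to_nat c) = c) by lia.
    set (b' := Z.to_nat b) in *. set (c' := Z.to_nat c) in *. clearbody b' c'. subst b c.
    set (w6 := w ^ 6) in *. set (w8 := w ^ 8) in *. set (w9 := w ^ 9) in *. set (w11 := w ^ 11) in *.
    rewrite <- Q6 in F4. rewrite <- Q8 in F3. rewrite <- Q9 in F1, F2. rewrite <- Q11 in B3.
    clear - B1 B2 B3 B4 B5 F1 F2 F3 F4.
    repeat split; lia.
Qed.

Definition choice2 (P : nat -> nat -> Prop) : nat * nat :=
  epsilon (inhabits (0, 0)) (fun x => P (fst x) (snd x)).

Lemma choice2_spec (P : nat -> nat -> Prop) :
  (exists b c, P b c) -> P (fst (choice2 P)) (snd (choice2 P)).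
Proof.
  intros [b [c H]]. unfold choice2.
  apply (epsilon_spec (inhabits (0,0)) (fun x => P (fst x) (snd x))). exists (b, c). auto.
Qed.

Lemma good_factors_inj (w n a p q v p' q' v' b c : nat) :
  1 <= w ->
  In (p, q) (balanced_pairs (w ^ 2)) -> In (p', q') (balanced_pairs (w ^ 2)) ->
  good_factors w n a p q v b c -> good_factors w n a p' q' v' b c ->
  p = p' /\ q = q' /\ v = v'.
Proof.
  intros Hw H1 H2 G1 G2. apply in_balanced_pairs in H1, H2.
  destruct G1 as [G11 [G12 [G13 [G14 [G15 [G16 [G17 _]]]]]]].
  destruct G2 as [_ [_ [_ [G24 [G25 [G26 _]]]]]].
  assert (E6 : (Z.of_nat (w ^ 6) = Z.of_nat w ^ 6)%Z) by apply Nat2Z.inj_pow.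
  assert (E8 : (Z.of_nat (w ^ 8) = Z.of_nat w ^ 8)%Z) by apply Nat2Z.inj_pow.
  assert (E2 : (Z.of_nat (w ^ 2) = Z.of_nat w ^ 2)%Z) by apply Nat2Z.inj_pow.
  set (w6 := w ^ 6) in *. set (w8 := w ^ 8) in *. set (w2 := w ^ 2) in *. clearbody w6 w8 w2.
  destruct (factors_determine_ratio (Z.of_nat w) (Z.of_nat p) (Z.of_nat q) (Z.of_nat p')
    (Z.of_nat q') (Z.of_nat b) (Z.of_nat c)); try lia; try (apply rel_prime_of_gcd; tauto).
  assert (p = p') by lia. assert (q = q') by lia. subst. repeat split; auto. lia.
Qed.

(** The map [(a, p, q, v)] to [(abc, a, b)] is injective, and a given product has at most [d * d]
    pairs of divisors [(a, b)]. The factor 8 is the loss from balanced coprime pairs; 512 comes from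
    rounding down [w / 256]. *)
Lemma smooth_count (w n d : nat) :
  1000 <= w -> w ^ 23 <= n <= 2 * w ^ 23 ->
  (forall m, n < m <= n + w ^ 11 -> length (divs m) <= d) ->
  w ^ 10 <= 8 * (512 * (length (filter (fun m => holdsb (smooth (32 * w ^ 9) m)) (seq (S n) (w ^ 11))) * (d * d))).
Proof.
  intros Hw Hn Hd. set (S := filter _ _).
  set (T := list_prod (seq (w ^ 5 + 1) (w ^ 5)) (list_prod (balanced_pairs (w ^ 2)) (seq 0 (w / 256)))).
  set (F := fun t : nat * ((nat * nat) * nat) =>
    let '(a, ((p, q), v)) := t in choice2 (good_factors w n a p q v)).
  assert (HF : forall a p q v, In (a, ((p, q), v)) T ->
    In (p, q) (balanced_pairs (w ^ 2)) /\ w ^ 5 < a <= 2 * w ^ 5 /\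
    good_factors w n a p q v (fst (F (a, ((p, q), v)))) (snd (F (a, ((p, q), v))))).
  { intros a p q v H. unfold T in H. rewrite !in_prod_iff, !in_seq in H.
    split; [tauto|]. split; [lia|]. unfold F. apply choice2_spec.
    apply exists_factors; try tauto; lia. }
  set (L := flat_map (fun m => map (pair m) (list_prod (divs m) (divs m))) S).
  assert (HL : length L <= length S * (d * d)).
  { apply flat_map_length_le. intros m Hm. unfold S in Hm. apply filter_In in Hm.
    destruct Hm as [Hm _]. apply in_seq in Hm.
    rewrite length_map, length_prod. apply Nat.mul_le_mono; apply Hd; lia. }
  assert (HTL : length T <= length L).
  { apply (inj_length (fun t => let a := fst t in let b := fst (F t) in let c := snd (F t) in
       (a * b * c, (a, b)))).
    - repeat apply NoDup_list_prod; try apply seq_NoDup. apply NoDup_balanced_pairs.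
    - intros [a [[p q] v]] [a' [[p' q'] v']] H H'.
      apply HF in H, H'. destruct H as [H1 [H2 H3]]. destruct H' as [H1' [H2' H3']].
      intros E. cbn [fst] in E.
      set (b := fst (F (a, (p, q, v)))) in *. set (c := snd (F (a, (p, q, v)))) in *.
      set (b' := fst (F (a', (p', q', v')))) in *. set (c' := snd (F (a', (p', q', v')))) in *.
      clearbody b c b' c'. injection E as E1 E2 E3. subst a' b'.
      assert (1 <= b) by (destruct H3; auto).
      assert (c = c').
      { rewrite <- !Nat.mul_assoc in E1.
        apply Nat.mul_cancel_l in E1; [|lia]. apply Nat.mul_cancel_l in E1; lia. }
      subst c'. destruct (good_factors_inj w n a p q v p' q' v' b c) as [-> [-> ->]]; auto. lia.
    - intros [a [[p q] v]] H. apply HF in H. destruct H as [H1 [H2 H3]]. cbn [fst].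
      set (b := fst (F (a, (p, q, v)))) in *. set (c := snd (F (a, (p, q, v)))) in *. clearbody b c.
      destruct H3 as [B1 [B2 [B3 [_ [_ [_ [_ [B8 B9]]]]]]]].
      assert (Hm : 1 <= a * b * c) by lia.
      apply in_flat_map. exists (a * b * c). split.
      + apply filter_In. split; [apply in_seq; lia|]. apply holdsb_true.
        assert (w ^ 5 <= w ^ 9) by (apply Nat.pow_le_mono_r; lia).
        apply smooth_mul; [apply smooth_mul|]; apply smooth_le; lia.
      + apply in_map. apply in_prod; apply in_divs; auto.
        * exists (b * c). lia. * exists (a * c). lia. }
  unfold T in HTL. rewrite !length_prod, !length_seq in HTL.
  pose proof (balanced_pairs_length (w ^ 2)) as HB.
  set (B := length (balanced_pairs (w ^ 2))) in *. clearbody B.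
  assert (HV : w <= 512 * (w / 256)).
  { pose proof (Nat.mul_succ_div_gt w 256 ltac:(lia)). lia. }
  set (V := w / 256) in *. clearbody V.
  assert (H1 : w ^ 10 <= w ^ 5 * ((8 * B) * (512 * V))).
  { replace (w ^ 10) with (w ^ 5 * ((w ^ 2 * w ^ 2) * w)) by (simpl; ring).
    apply Nat.mul_le_mono_l. apply Nat.mul_le_mono; auto. }
  assert (Hac : forall e f u B V, u * ((e * B) * (f * V)) = e * (f * (u * (B * V)))) by (intros; ring).
  rewrite Hac in H1. eapply Nat.le_trans; [exact H1|]. do 2 apply Nat.mul_le_mono_l.
  eapply Nat.le_trans; [exact HTL|exact HL].
Qed.

Lemma no_prime_rep_w11 : exists w0, forall w n, w0 <= w -> w ^ 23 <= n <= 2 * w ^ 23 ->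
  ~ prime_rep n (w ^ 11).
Proof.
  (* As [92 = 4 * 23] and the integers concerned are at most [3 w^23], the fourth power of the
     divisor count is [O(w)]. Then [d * d] is of order at most [w^(1/2)], too small for
     [w^10 << w^9 d^2]. *)
  destruct (divisor_bound 92) as [C HC].
  (* The factors 8 and 512 come from [smooth_count], and 32 from the smoothness bound [32 w^9]. *)
  remember (8 * (512 * 32)) as K eqn:EK.
  exists (1000 + (K * K) * (3 * C + 1)). intros w n Hw Hn Hrep.
  assert (Hpos : forall j, 1 <= w ^ j) by (intros; apply pow_ge_1; lia).
  set (N := 3 * C * w ^ 23).
  destruct (nat_crossing (fun i => i ^ 92 <= N) (S N)) as [d [Hd1 Hd2]].
  { rewrite Nat.pow_0_l; lia. }
  { assert (S N ^ 1 <= S N ^ 92) by (apply Nat.pow_le_mono_r; lia). rewrite Nat.pow_1_r in H. lia. }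
  assert (Hdiv : forall m, n < m <= n + w ^ 11 -> length (divs m) <= d).
  { intros m Hm. destruct (le_lt_dec (length (divs m)) d) as [|H]; auto. exfalso. apply Hd2.
    eapply Nat.le_trans; [apply Nat.pow_le_mono_l; exact H|].
    eapply Nat.le_trans; [apply HC; lia|]. unfold N.
    assert (w ^ 11 <= w ^ 23) by (apply Nat.pow_le_mono_r; lia).
    replace (3 * C * w ^ 23) with (C * (3 * w ^ 23)) by ring. apply Nat.mul_le_mono_l. lia. }
  pose proof (smooth_count w n d ltac:(lia) Hn Hdiv) as H.
  set (L := filter _ _) in H.
  assert (HL : length L <= 32 * w ^ 9).
  { apply (hall_smooth n (w ^ 11)); auto.
    - apply NoDup_filter, seq_NoDup.
    - intros m Hm. apply filter_In in Hm. destruct Hm as [Hm1 Hm2].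
      apply in_seq in Hm1. rewrite holdsb_true in Hm2. split; [lia|exact Hm2]. }
  assert (Hac : forall e f g u v, e * (f * (g * u * v)) = u * ((e * (f * g)) * v)) by (intros; ring).
  assert (H1 : w ^ 10 <= w ^ 9 * (K * (d * d))).
  { eapply Nat.le_trans; [exact H|]. rewrite EK, <- Hac. clear - HL.
    do 2 apply Nat.mul_le_mono_l. apply Nat.mul_le_mono_r. exact HL. }
  rewrite (Nat.pow_succ_r' w 9), (Nat.mul_comm w) in H1.
  apply Nat.mul_le_mono_pos_l in H1; [|apply Hpos].
  assert (Hd4 : d ^ 4 <= (3 * C + 1) * w).
  { apply (Nat.pow_le_mono_l_iff _ _ 23); [lia|]. rewrite <- Nat.pow_mul_r.
    change (4 * 23) with 92. eapply Nat.le_trans; [exact Hd1|]. unfold N.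
    rewrite Nat.pow_mul_l. apply Nat.mul_le_mono_r.
    apply Nat.le_trans with ((3 * C + 1) ^ 1); [rewrite Nat.pow_1_r; lia|].
    apply Nat.pow_le_mono_r; lia. }
  assert (H2 : w * w <= w * ((K * K) * (3 * C + 1))).
  { apply Nat.le_trans with ((K * (d * d)) * (K * (d * d))); [apply Nat.mul_le_mono; auto|].
    replace ((K * (d * d)) * (K * (d * d))) with ((K * K) * d ^ 4) by (simpl; ring).
    replace (w * ((K * K) * (3 * C + 1))) with ((K * K) * ((3 * C + 1) * w)) by ring.
    apply Nat.mul_le_mono_l; auto. }
  apply Nat.mul_le_mono_pos_l in H2; lia.
Qed.

Lemma exists_root (D x : nat) : 1 <= D -> exists w, w ^ D <= x < S w ^ D.
Proof.
  intros HD. destruct (nat_crossing (fun i => i ^ D <= x) (S x)) as [w [H1 H2]].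
  - rewrite Nat.pow_0_l; lia.
  - assert (S x ^ 1 <= S x ^ D) by (apply Nat.pow_le_mono_r; lia). rewrite Nat.pow_1_r in H. lia.
  - exists w. lia.
Qed.

(** A division-free form of [(1 + 1/w)^j <= 1 / (1 - j/w)]; each step uses
    [(w + 1)(w - j - 1) <= w (w - j)]. *)
Lemma pow_succ_bound (w D j : nat) : j <= D -> 1 <= w -> S w ^ j * (w - j) <= w ^ j * w.
Proof.
  intros Hj Hw. induction j as [|j IH]; simpl; [lia|].
  specialize (IH ltac:(lia)). destruct (le_lt_dec w (S j)) as [H|H]; [nia|].
  assert (E : S w * (w - S j) <= w * (w - j)) by nia.
  replace ((S w ^ j + w * S w ^ j) * (w - S j)) with (S w ^ j * (S w * (w - S j))) by ring.
  eapply Nat.le_trans; [apply Nat.mul_le_mono_l; exact E|].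
  replace (S w ^ j * (w * (w - j))) with (w * (S w ^ j * (w - j))) by ring.
  replace (w * w ^ j * w) with (w * (w ^ j * w)) by ring. apply Nat.mul_le_mono_l; auto.
Qed.

Lemma grimm_below_sqrt : exists N, forall n, (N <= n)%nat ->
  (INR (g n) < Rpower (INR n) (11 / 23))%R.
Proof.
  destruct no_prime_rep_w11 as [w0 Hw0].
  (* From [w >= 46 = 2 * 23] it follows that [(w + 1)^23 <= 2 w^23], so every [n] between
     consecutive 23rd powers is covered. *)
  exists ((w0 + 46) ^ 23). intros n Hn.
  destruct (exists_root 23 n ltac:(lia)) as [w [H1 H2]].
  assert (Hw : w0 + 46 <= w).
  { destruct (le_lt_dec (w0 + 46) w) as [|H]; auto. exfalso.
    assert (S w ^ 23 <= (w0 + 46) ^ 23) by (apply Nat.pow_le_mono_l; lia). lia. }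
  assert (H3 : S w ^ 23 <= 2 * w ^ 23).
  { pose proof (pow_succ_bound w 23 23 ltac:(lia) ltac:(lia)) as H3.
    set (A := S w ^ 23) in *. set (B := w ^ 23) in *. clearbody A B.
    assert (A * w <= 2 * (A * (w - 23))) by nia. nia. }
  assert (Hp : ~ prime_rep n (w ^ 11)) by (apply Hw0; lia).
  assert (Hn1 : 1 <= n) by (pose proof (pow_ge_1 (w0 + 46) 23 ltac:(lia)); lia).
  destruct (g_spec n (w ^ 11) Hn1 Hp) as [_ Hg].
  apply Rlt_le_trans with (INR (w ^ 11)); [apply lt_INR; auto|].
  assert (Hw1 : (0 < INR w)%R) by (apply lt_0_INR; lia).
  apply Rle_trans with (Rpower (INR (w ^ 23)) (11 / 23)).
  - rewrite !pow_INR, <- !Rpower_pow by auto. rewrite Rpower_mult.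
    right. f_equal. simpl INR. field.
  - apply Rle_Rpower_l; [lra|]. split; [apply lt_0_INR|apply le_INR; auto].
    apply pow_ge_1. lia.
Qed.

(** * Exponential sums *)

Open Scope R_scope.

Lemma Rabs_le_inv (x b : R) : Rabs x <= b -> - b <= x <= b.
Proof. unfold Rabs. destruct (Rcase_abs x); lra. Qed.

Lemma le_IZR_INR (k : Z) (n : nat) : (k <= Z.of_nat n)%Z -> IZR k <= INR n.
Proof. intros H. rewrite INR_IZR_INZ. now apply IZR_le. Qed.

Lemma INR_le_scal (n m : nat) (k : Z) : (Z.of_nat n <= k * Z.of_nat m)%Z -> INR n <= IZR k * INR m.
Proof. intros H. rewrite !INR_IZR_INZ, <- mult_IZR. now apply IZR_le. Qed.

Lemma div_le (a b c : R) : 0 < b -> a <= c * b -> a / b <= c.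
Proof.
  intros Hb H. apply (Rmult_le_reg_r b); auto. unfold Rdiv. rewrite Rmult_assoc, Rinv_l; lra.
Qed.

Lemma le_div (a b c : R) : 0 < b -> c * b <= a -> c <= a / b.
Proof.
  intros Hb H. apply (Rmult_le_reg_r b); auto. unfold Rdiv. rewrite Rmult_assoc, Rinv_l; lra.
Qed.

Definition lsum {A : Type} (l : list A) (f : A -> R) : R := fold_right (fun x s => f x + s) 0 l.

Lemma lsum_ext {A : Type} (l : list A) (f g : A -> R) :
  (forall x, In x l -> f x = g x) -> lsum l f = lsum l g.
Proof.
  induction l as [|a l IH]; simpl; intros H; auto. rewrite (H a), IH; auto.
Qed.

Lemma lsum_app {A : Type} (l l' : list A) (f : A -> R) : lsum (l ++ l') f = lsum l f + lsum l' f.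
Proof. induction l as [|a l IH]; simpl; [lra|rewrite IH; lra]. Qed.

Lemma lsum_plus {A : Type} (l : list A) (f g : A -> R) :
  lsum l (fun x => f x + g x) = lsum l f + lsum l g.
Proof. induction l as [|a l IH]; simpl; [lra|rewrite IH; lra]. Qed.

Lemma lsum_minus {A : Type} (l : list A) (f g : A -> R) :
  lsum l (fun x => f x - g x) = lsum l f - lsum l g.
Proof. induction l as [|a l IH]; simpl; [lra|rewrite IH; lra]. Qed.

Lemma lsum_scal {A : Type} (l : list A) (c : R) (f : A -> R) :
  lsum l (fun x => c * f x) = c * lsum l f.
Proof. induction l as [|a l IH]; simpl; [lra|rewrite IH; lra]. Qed.

Lemma lsum_scal_r {A : Type} (l : list A) (c : R) (f : A -> R) :
  lsum l (fun x => f x * c) = lsum l f * c.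
Proof. induction l as [|a l IH]; simpl; [lra|rewrite IH; lra]. Qed.

Lemma lsum_const {A : Type} (l : list A) (c : R) : lsum l (fun _ => c) = INR (length l) * c.
Proof.
  induction l as [|a l IH]; cbn [lsum fold_right length]; [simpl; lra|].
  rewrite S_INR. fold (lsum l (fun _ => c)). rewrite IH. lra.
Qed.

Lemma lsum_le {A : Type} (l : list A) (f g : A -> R) :
  (forall x, In x l -> f x <= g x) -> lsum l f <= lsum l g.
Proof.
  induction l as [|a l IH]; simpl; intros H; [lra|].
  apply Rplus_le_compat; auto.
Qed.

Lemma lsum_nonneg {A : Type} (l : list A) (f : A -> R) :
  (forall x, In x l -> 0 <= f x) -> 0 <= lsum l f.
Proof.
  intros H. replace 0 with (lsum l (fun _ => 0)); [apply lsum_le; auto|].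
  rewrite lsum_const. lra.
Qed.

Lemma lsum_le_const {A : Type} (l : list A) (f : A -> R) (c : R) :
  (forall x, In x l -> f x <= c) -> lsum l f <= INR (length l) * c.
Proof. intros H. rewrite <- lsum_const. apply lsum_le; auto. Qed.

Lemma lsum_ge_const {A : Type} (l : list A) (f : A -> R) (c : R) :
  (forall x, In x l -> c <= f x) -> INR (length l) * c <= lsum l f.
Proof. intros H. rewrite <- lsum_const. apply lsum_le; auto. Qed.

Lemma lsum_abs {A : Type} (l : list A) (f : A -> R) : Rabs (lsum l f) <= lsum l (fun x => Rabs (f x)).
Proof.
  induction l as [|a l IH]; simpl; [rewrite Rabs_R0; lra|].
  eapply Rle_trans; [apply Rabs_triang|]. lra.
Qed.

Lemma lsum_swap {A B : Type} (l : list A) (l' : list B) (f : A -> B -> R) :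
  lsum l (fun x => lsum l' (f x)) = lsum l' (fun y => lsum l (fun x => f x y)).
Proof.
  induction l as [|a l IH]; simpl.
  - rewrite lsum_const. lra.
  - rewrite IH, <- lsum_plus. auto.
Qed.

Lemma lsum_map {A B : Type} (h : A -> B) (l : list A) (f : B -> R) :
  lsum (map h l) f = lsum l (fun x => f (h x)).
Proof. induction l as [|a l IH]; simpl; auto. now rewrite IH. Qed.

Lemma lsum_list_prod {A B : Type} (l : list A) (l' : list B) (f : A * B -> R) :
  lsum (list_prod l l') f = lsum l (fun x => lsum l' (fun y => f (x, y))).
Proof.
  induction l as [|a l IH]; simpl; auto. rewrite lsum_app, lsum_map, IH. auto.
Qed.

Lemma lsum_mul {A B : Type} (l : list A) (l' : list B) (f : A -> R) (g : B -> R) :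
  lsum l f * lsum l' g = lsum l (fun x => lsum l' (fun y => f x * g y)).
Proof.
  rewrite <- lsum_scal_r. apply lsum_ext. intros x _. now rewrite lsum_scal.
Qed.

Lemma lsum_incl {A : Type} (l l' : list A) (f : A -> R) :
  NoDup l -> incl l l' -> (forall x, In x l' -> 0 <= f x) -> lsum l f <= lsum l' f.
Proof.
  intros Hl. revert l'. induction Hl as [|a l Ha Hl IH]; intros l' Hi Hf.
  - apply lsum_nonneg; auto.
  - destruct (in_split a l') as [u [v ->]]; [apply Hi; simpl; auto|].
    assert (H : lsum l f <= lsum (u ++ v) f).
    { apply IH.
      - intros x Hx. specialize (Hi x (or_intror Hx)). rewrite in_app_iff in *. simpl in Hi.
        destruct Hi as [|[->|]]; auto. contradiction.
      - intros x Hx. apply Hf. rewrite in_app_iff in *. simpl. tauto. }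
    rewrite lsum_app in *. simpl. lra.
Qed.

Lemma lsum_cauchy {A : Type} (l : list A) (f : A -> R) :
  (lsum l f) ^ 2 <= INR (length l) * lsum l (fun x => f x ^ 2).
Proof.
  destruct (Nat.eq_dec (length l) 0) as [H0|H0].
  { apply length_zero_iff_nil in H0. subst. simpl. lra. }
  set (n := INR (length l)). set (s := lsum l f). set (q := lsum l (fun x => f x ^ 2)).
  assert (Hn : 0 < n) by (apply lt_0_INR; lia).
  assert (H : 0 <= lsum l (fun x => (n * f x - s) ^ 2)) by (apply lsum_nonneg; intros; apply pow2_ge_0).
  replace (lsum l (fun x => (n * f x - s) ^ 2)) with (n * (n * q - s ^ 2)) in H.
  - apply Rnot_lt_le. intros H'. assert (n * (n * q - s ^ 2) < 0) by nra. lra.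
  - rewrite (lsum_ext l _ (fun x => n ^ 2 * f x ^ 2 + (- (2 * n * s) * f x + s ^ 2))).
    + rewrite !lsum_plus, !lsum_scal, lsum_const. fold n s q. ring.
    + intros x _. ring.
Qed.

(* The squared modulus of the sum of [e^(i phi x)] over [x] in [l]. *)
Definition nrm2 {A : Type} (l : list A) (phi : A -> R) : R :=
  (lsum l (fun x => cos (phi x))) ^ 2 + (lsum l (fun x => sin (phi x))) ^ 2.

Lemma nrm2_ext {A : Type} (l : list A) (f g : A -> R) :
  (forall x, In x l -> f x = g x) -> nrm2 l f = nrm2 l g.
Proof. intros H. unfold nrm2. f_equal; f_equal; apply lsum_ext; intros; rewrite H; auto. Qed.

Lemma nrm2_double {A : Type} (l : list A) (phi : A -> R) :
  nrm2 l phi = lsum l (fun x => lsum l (fun y => cos (phi x - phi y))).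
Proof.
  unfold nrm2. simpl. rewrite !Rmult_1_r, !lsum_mul, <- lsum_plus.
  apply lsum_ext. intros x _. rewrite <- lsum_plus. apply lsum_ext. intros y _.
  now rewrite cos_minus.
Qed.

Lemma nrm2_nonneg {A : Type} (l : list A) (phi : A -> R) : 0 <= nrm2 l phi.
Proof. unfold nrm2. pose proof (pow2_ge_0 (lsum l (fun x => cos (phi x)))).
  pose proof (pow2_ge_0 (lsum l (fun x => sin (phi x)))). lra. Qed.

Lemma nrm2_opp {A : Type} (l : list A) (phi : A -> R) : nrm2 l (fun x => - phi x) = nrm2 l phi.
Proof.
  rewrite !nrm2_double. apply lsum_ext. intros x _. apply lsum_ext. intros y _.
  rewrite <- cos_neg. f_equal. ring.
Qed.

Lemma nrm2_le {A : Type} (l : list A) (phi : A -> R) : nrm2 l phi <= INR (length l) ^ 2.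
Proof.
  rewrite nrm2_double. simpl. rewrite Rmult_1_r.
  apply lsum_le_const. intros x _. rewrite <- (Rmult_1_r (INR (length l))).
  apply lsum_le_const. intros y _. apply COS_bound.
Qed.

Lemma nrm2_mul {A B : Type} (l : list A) (l' : list B) (f : A -> R) (g : B -> R) :
  nrm2 (list_prod l l') (fun x => f (fst x) + g (snd x)) = nrm2 l f * nrm2 l' g.
Proof.
  unfold nrm2. rewrite !lsum_list_prod. cbn [fst snd].
  set (C := lsum l (fun x => cos (f x))). set (S := lsum l (fun x => sin (f x))).
  set (C' := lsum l' (fun x => cos (g x))). set (S' := lsum l' (fun x => sin (g x))).
  replace (lsum l (fun x => lsum l' (fun y => cos (f x + g y)))) with (C * C' - S * S').
  2:{ unfold C, C', S, S'. rewrite !lsum_mul, <- lsum_minus. apply lsum_ext. intros x _.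
      rewrite <- lsum_minus. apply lsum_ext. intros y _. now rewrite cos_plus. }
  replace (lsum l (fun x => lsum l' (fun y => sin (f x + g y)))) with (S * C' + C * S').
  2:{ unfold C, C', S, S'. rewrite !lsum_mul, <- lsum_plus. apply lsum_ext. intros x _.
      rewrite <- lsum_plus. apply lsum_ext. intros y _. now rewrite sin_plus. }
  ring.
Qed.

Lemma lsum_seq_S (L : nat) (f : nat -> R) : lsum (seq 0 (S L)) f = lsum (seq 0 L) f + f L.
Proof. rewrite seq_S, lsum_app. simpl. lra. Qed.

Lemma lsum_seq_shift (a L : nat) (f : nat -> R) :
  lsum (seq a L) f = lsum (seq 0 L) (fun i => f (a + i)%nat).
Proof.
  induction L as [|L IH]; auto.
  rewrite lsum_seq_S, <- IH, seq_S, lsum_app. simpl. lra.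
Qed.

Lemma lsum_single (N a : nat) (c : R) : 0 <= c ->
  lsum (seq 0 N) (fun i => if Nat.eq_dec i a then c else 0) <= c.
Proof.
  intros Hc.
  assert (H0 : forall n, (n <= a)%nat -> lsum (seq 0 n) (fun i => if Nat.eq_dec i a then c else 0) = 0).
  { induction n as [|n IH]; intros Hn; auto. rewrite lsum_seq_S, IH by lia.
    destruct (Nat.eq_dec n a); [lia|lra]. }
  induction N as [|N IH]; [simpl; lra|]. rewrite lsum_seq_S.
  destruct (Nat.eq_dec N a) as [->|]; [rewrite H0 by lia; lra|lra].
Qed.

(** Summation by parts keeping the last boundary term. The remainder is [- kap 0 * v 0] minus the
    sum of [(kap (S i) - kap i) * v (S i)], whose weights add up to [kap L]. *)
Lemma abel_monotone (L : nat) (kap v : nat -> R) :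
  0 <= kap 0%nat -> (forall i, (i < L)%nat -> kap i <= kap (S i)) ->
  (forall i, Rabs (v i) <= 1) ->
  Rabs (lsum (seq 0 (S L)) (fun i => kap i * (v (S i) - v i)) - kap L * v (S L)) <= kap L.
Proof.
  intros H0 Hk Hv. induction L as [|L IH].
  - simpl. replace (_ + 0 - _) with (- (kap 0%nat * v 0%nat)) by ring.
    rewrite Rabs_Ropp, Rabs_mult, (Rabs_right (kap 0%nat)) by lra.
    specialize (Hv 0%nat). nra.
  - rewrite lsum_seq_S. specialize (IH ltac:(intros; apply Hk; lia)).
    pose proof (Hk L ltac:(lia)) as HL. specialize (Hv (S L)).
    set (Sm := lsum (seq 0 (S L)) _) in *.
    replace (Sm + kap (S L) * (v (S (S L)) - v (S L)) - kap (S L) * v (S (S L)))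
      with ((Sm - kap L * v (S L)) - (kap (S L) - kap L) * v (S L)) by ring.
    eapply Rle_trans; [apply Rabs_triang|]. rewrite Rabs_Ropp, Rabs_mult, (Rabs_right (kap (S L) - kap L)) by lra.
    nra.
Qed.

Lemma sin_ge_mul_cos (h : R) : 0 < h <= 1 -> h * cos h <= sin h.
Proof.
  intros Hh. pose proof PI2_3_2 as Hpi.
  destruct (MVT_cor2 sin cos 0 h) as [c [H1 H2]]; [lra|intros; apply derivable_pt_lim_sin|].
  rewrite sin_0 in H1. assert (cos h <= cos c) by (apply cos_decr_1; lra). nra.
Qed.

(** Summing [c i + c (S i)] counts every term twice except at the two ends, so the previous bound
    applies to twice the sum. *)
Lemma abel_trapezoid (L : nat) (kap c v : nat -> R) :
  0 <= kap 0%nat -> (forall i, (i < L)%nat -> kap i <= kap (S i)) ->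
  (forall i, Rabs (c i) <= 1) -> (forall i, Rabs (v i) <= 1) ->
  (forall i, (i <= L)%nat -> c i + c (S i) = kap i * (v (S i) - v i)) ->
  Rabs (lsum (seq 0 (S L)) c) <= kap L + 1.
Proof.
  intros H0 Hk Hc Hv Heq. pose proof (abel_monotone L kap v H0 Hk Hv) as HA.
  rewrite <- (lsum_ext _ (fun i => c i + c (S i))) in HA by (intros i Hi; apply in_seq in Hi; apply Heq; lia).
  rewrite lsum_plus in HA.
  assert (H : lsum (seq 0 (S L)) (fun i => c (S i)) = lsum (seq 0 (S L)) c - c 0%nat + c (S L)).
  { clear. induction L as [|L IH]; [simpl; lra|]. rewrite lsum_seq_S, IH, !lsum_seq_S. lra. }
  rewrite H in HA.
  pose proof (Rabs_le_inv _ _ (Hc 0%nat)). pose proof (Rabs_le_inv _ _ (Hc (S L))).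
  pose proof (Rabs_le_inv _ _ (Hv (S L))).
  apply Rabs_le_inv in HA. apply Rabs_le. split; nra.
Qed.

(* [cos a + cos b = cot ((b - a) / 2) (sin b - sin a)], then Abel summation against the monotone
   cotangents. *)
Lemma kuzmin_landau (L : nat) (psi : nat -> R) (lam : R) :
  0 < lam ->
  (forall i, (i <= L)%nat -> lam <= psi (S i) - psi i <= 1) ->
  (forall i, (i < L)%nat -> psi (S (S i)) - psi (S i) <= psi (S i) - psi i) ->
  nrm2 (seq 0 (S L)) psi <= 2 * (2 / lam + 1) ^ 2.
Proof.
  intros Hlam Hth Hmono.
  pose proof PI2_3_2 as Hpi.
  set (h := fun i => (psi (S i) - psi i) / 2).
  set (kap := fun i => cos (h i) / sin (h i)).
  set (m := fun i => (psi i + psi (S i)) / 2).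
  assert (Hmid : forall i, psi i = m i - h i /\ psi (S i) = m i + h i) by (intros; unfold m, h; lra).
  assert (Hh : forall i, (i <= L)%nat -> 0 < h i <= 1 / 2) by (intros i Hi; specialize (Hth i Hi); unfold h; lra).
  assert (Hs : forall i, (i <= L)%nat -> 0 < sin (h i)).
  { intros i Hi. specialize (Hh i Hi). apply sin_gt_0; lra. }
  assert (Hc : forall i, (i <= L)%nat -> 0 < cos (h i)).
  { intros i Hi. specialize (Hh i Hi). apply cos_gt_0; lra. }
  assert (Hk0 : 0 <= kap 0%nat).
  { unfold kap. apply Rmult_le_pos; [left; apply Hc; lia|].
    left. apply Rinv_0_lt_compat, Hs; lia. }
  assert (Hk : forall i, (i < L)%nat -> kap i <= kap (S i)).
  { intros i Hi. unfold kap. pose proof (Hs i ltac:(lia)). pose proof (Hs (S i) ltac:(lia)).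
    apply (Rmult_le_reg_r (sin (h i) * sin (h (S i)))); [apply Rmult_lt_0_compat; auto|].
    replace (cos (h i) / sin (h i) * (sin (h i) * sin (h (S i)))) with (sin (h (S i)) * cos (h i)) by (field; lra).
    replace (cos (h (S i)) / sin (h (S i)) * (sin (h i) * sin (h (S i)))) with (cos (h (S i)) * sin (h i)) by (field; lra).
    assert (H1 : 0 <= sin (h i - h (S i))).
    { specialize (Hmono i Hi). pose proof (Hh i ltac:(lia)). pose proof (Hh (S i) ltac:(lia)).
      apply sin_ge_0; unfold h in *; lra. }
    rewrite sin_minus in H1. lra. }
  assert (HkL : kap L <= 2 / lam).
  { unfold kap. pose proof (Hh L ltac:(lia)) as H1. pose proof (Hs L ltac:(lia)) as H2.
    pose proof (sin_ge_mul_cos (h L) ltac:(lra)) as H3. pose proof (Hth L ltac:(lia)) as H4.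
    apply (Rmult_le_reg_r (sin (h L))); auto.
    replace (cos (h L) / sin (h L) * sin (h L)) with (cos (h L)) by (field; lra).
    assert (H5 : lam / 2 <= h L) by (unfold h; lra).
    apply (Rmult_le_reg_l (lam / 2)); [lra|].
    replace (lam / 2 * (2 / lam * sin (h L))) with (sin (h L)) by (field; lra). nra. }
  assert (Hc' : Rabs (lsum (seq 0 (S L)) (fun i => cos (psi i))) <= 2 / lam + 1).
  { eapply Rle_trans; [apply (abel_trapezoid L kap _ (fun i => sin (psi i)) Hk0 Hk)|lra].
    - intros i; apply Rabs_le, COS_bound.
    - intros i; apply Rabs_le, SIN_bound.
    - intros i Hi. pose proof (Hs i Hi). destruct (Hmid i) as [-> ->].
      rewrite sin_plus, sin_minus, cos_plus, cos_minus. unfold kap. field. lra. }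
  assert (Hs' : Rabs (lsum (seq 0 (S L)) (fun i => sin (psi i))) <= 2 / lam + 1).
  { eapply Rle_trans; [apply (abel_trapezoid L kap _ (fun i => - cos (psi i)) Hk0 Hk)|lra].
    - intros i; apply Rabs_le, SIN_bound.
    - intros i; rewrite Rabs_Ropp; apply Rabs_le, COS_bound.
    - intros i Hi. pose proof (Hs i Hi). destruct (Hmid i) as [-> ->].
      rewrite sin_plus, sin_minus, cos_plus, cos_minus. unfold kap. field. lra. }
  unfold nrm2.
  assert (Sq : forall x b, Rabs x <= b -> x ^ 2 <= b ^ 2).
  { intros x b H. apply Rabs_le_inv in H. nra. }
  apply Sq in Hc', Hs'. lra.
Qed.

(** * Van der Corput differencing *)

Lemma lsum_shift_bound (L d : nat) (a : nat -> R) :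
  (forall i, Rabs (a i) <= 1) ->
  Rabs (lsum (seq 0 L) a - lsum (seq 0 L) (fun i => a (i + d)%nat)) <= 2 * INR d.
Proof.
  intros Ha. induction d as [|d IH].
  - rewrite (lsum_ext _ (fun i => a (i + 0)%nat) a); [|intros; f_equal; lia].
    rewrite Rminus_diag, Rabs_R0. simpl; lra.
  - rewrite S_INR.
    assert (E : lsum (seq 0 L) (fun i => a (i + S d)%nat)
      = lsum (seq 0 L) (fun i => a (i + d)%nat) - a d + a (L + d)%nat).
    { clear. induction L as [|L IH]; [simpl; lra|]. rewrite !lsum_seq_S, IH.
      replace (L + S d)%nat with (S L + d)%nat by lia. lra. }
    rewrite E. pose proof (Rabs_le_inv _ _ (Ha d)). pose proof (Rabs_le_inv _ _ (Ha (L + d)%nat)).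
    apply Rabs_le_inv in IH. apply Rabs_le. lra.
Qed.

(** Replacing the sum by its average over the shifts [s * B] costs at most [2 S B] at the ends.
    Cauchy-Schwarz in [i] then moves the square onto the short sums over [s]. *)
Lemma shifted_average (L S B : nat) (a : nat -> R) :
  (0 < S)%nat -> (forall i, Rabs (a i) <= 1) ->
  (lsum (seq 0 L) a) ^ 2 <=
    2 * (/ INR S ^ 2 * (INR L * lsum (seq 0 L) (fun i => (lsum (seq 0 S) (fun s => a (i + s * B)%nat)) ^ 2)))
    + 8 * (INR S * INR B) ^ 2.
Proof.
  intros HS Ha. set (C0 := lsum (seq 0 L) a).
  set (P := lsum (seq 0 L) (fun i => lsum (seq 0 S) (fun s => a (i + s * B)%nat))).
  assert (HS0 : 0 < INR S) by (apply lt_0_INR; auto).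
  assert (HP : P ^ 2 <= INR L * lsum (seq 0 L) (fun i => (lsum (seq 0 S) (fun s => a (i + s * B)%nat)) ^ 2)).
  { unfold P. pose proof (lsum_cauchy (seq 0 L) (fun i => lsum (seq 0 S) (fun s => a (i + s * B)%nat))) as H.
    rewrite length_seq in H. exact H. }
  assert (HD : Rabs (INR S * C0 - P) <= INR S * (2 * (INR S * INR B))).
  { unfold P. rewrite lsum_swap.
    replace (INR S * C0) with (lsum (seq 0 S) (fun _ => C0)) by (rewrite lsum_const, length_seq; auto).
    rewrite <- lsum_minus. eapply Rle_trans; [apply lsum_abs|].
    rewrite <- (length_seq S 0) at 2. apply lsum_le_const.
    intros s Hs. apply in_seq in Hs. eapply Rle_trans; [apply lsum_shift_bound; auto|].
    rewrite <- mult_INR. apply Rmult_le_compat_l; [lra|]. apply le_INR. nia. }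
  assert (HE : Rabs (C0 - P / INR S) <= 2 * (INR S * INR B)).
  { apply (Rmult_le_reg_l (INR S)); auto. replace (INR S * Rabs (C0 - P / INR S)) with (Rabs (INR S) * Rabs (C0 - P / INR S))
      by (rewrite (Rabs_right (INR S)) by lra; auto).
    rewrite <- Rabs_mult. replace (INR S * (C0 - P / INR S)) with (INR S * C0 - P) by (field; lra). exact HD. }
  apply Rabs_le_inv in HE.
  assert (H1 : C0 ^ 2 <= 2 * (P / INR S) ^ 2 + 2 * (2 * (INR S * INR B)) ^ 2).
  { set (u := P / INR S) in *. set (e := 2 * (INR S * INR B)) in *.
    clearbody u e C0. assert ((C0 - u) ^ 2 <= e ^ 2) by nra. pose proof (pow2_ge_0 (C0 - 2 * u)). nra. }
  replace ((P / INR S) ^ 2) with (/ INR S ^ 2 * P ^ 2) in H1 by (field; lra).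
  assert (0 < / INR S ^ 2) by (apply Rinv_0_lt_compat, pow_lt; auto).
  apply (Rmult_le_compat_l (/ INR S ^ 2)) in HP; lra.
Qed.

(* The shifts run over multiples of [B], so that every difference [h] lies in [[B, S B]]: this pins
   down the size of the derivatives of the differenced phase. *)
Lemma van_der_corput (f : R -> R) (x0 T : R) (L S B : nat) :
  (0 < S)%nat -> 0 <= T ->
  (forall s' s, (s' < s < S)%nat ->
     nrm2 (seq 0 L) (fun i => f (x0 + INR (s' * B) + INR i + INR ((s - s') * B))
                              - f (x0 + INR (s' * B) + INR i)) <= T ^ 2) ->
  nrm2 (seq 0 L) (fun i => f (x0 + INR i))
    <= 2 * (INR L ^ 2 / INR S + INR L * T) + 16 * (INR S * INR B) ^ 2.
Proof.
  intros HS HT H. assert (HS0 : 0 < INR S) by (apply lt_0_INR; auto).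
  unfold nrm2.
  pose proof (shifted_average L S B (fun i => cos (f (x0 + INR i))) HS
    ltac:(intros; apply Rabs_le, COS_bound)) as Hc.
  pose proof (shifted_average L S B (fun i => sin (f (x0 + INR i))) HS
    ltac:(intros; apply Rabs_le, SIN_bound)) as Hs.
  cbv beta in Hc, Hs.
  set (U := lsum (seq 0 L) (fun i => lsum (seq 0 S) _ ^ 2)) in Hc at 1.
  set (V := lsum (seq 0 L) (fun i => lsum (seq 0 S) _ ^ 2)) in Hs at 1.
  (* Opening the square over pairs of shifts, the [S] diagonal pairs contribute [L] each and every
     other pair at most [T]. *)
  assert (HUV : U + V <= INR S * INR L + INR S ^ 2 * T).
  { unfold U, V. rewrite <- lsum_plus.
    rewrite (lsum_ext _ _ (fun i => lsum (seq 0 S) (fun s => lsum (seq 0 S) (fun s' =>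
       cos (f (x0 + INR (i + s * B)) - f (x0 + INR (i + s' * B))))))).
    2:{ intros i _. apply (nrm2_double (seq 0 S) (fun s => f (x0 + INR (i + s * B)))). }
    rewrite lsum_swap.
    assert (Hin : forall s, In s (seq 0 S) ->
      lsum (seq 0 L) (fun i => lsum (seq 0 S) (fun s' =>
       cos (f (x0 + INR (i + s * B)) - f (x0 + INR (i + s' * B))))) <= INR L + INR S * T).
    { intros s Hs'. rewrite lsum_swap.
      assert (Hone : forall s', In s' (seq 0 S) ->
        lsum (seq 0 L) (fun i => cos (f (x0 + INR (i + s * B)) - f (x0 + INR (i + s' * B))))
        <= (if Nat.eq_dec s' s then INR L else 0) + T).
      { intros s' Hs''. apply in_seq in Hs', Hs''.
        assert (Hlt : forall u v, (u < v < S)%nat ->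
          lsum (seq 0 L) (fun i => cos (f (x0 + INR (i + v * B)) - f (x0 + INR (i + u * B)))) <= T).
        { intros u v Huv. specialize (H u v Huv). unfold nrm2 in H.
          set (X := lsum (seq 0 L) (fun i => cos _)) in H at 1.
          set (Y := lsum (seq 0 L) (fun i => sin _)) in H at 1.
          rewrite (lsum_ext _ _ (fun i => cos (f (x0 + INR (u * B) + INR i + INR ((v - u) * B))
                              - f (x0 + INR (u * B) + INR i)))).
          - fold X. pose proof (pow2_ge_0 Y). apply Rnot_lt_le. intros Hx.
            assert (T ^ 2 < X ^ 2) by nra. lra.
          - intros i _. f_equal. rewrite !plus_INR, !mult_INR, minus_INR by lia.
            f_equal; f_equal; ring. }
        destruct (Nat.eq_dec s' s) as [->|Hne].
        - assert (HL1 : lsum (seq 0 L) (fun i => cos (f (x0 + INR (i + s * B)) - f (x0 + INR (i + s * B))))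
             <= INR (length (seq 0 L)) * 1) by (apply lsum_le_const; intros; apply COS_bound).
          rewrite length_seq in HL1. lra.
        - destruct (lt_dec s' s) as [Hl|Hl].
          + pose proof (Hlt s' s ltac:(lia)). lra.
          + pose proof (Hlt s s' ltac:(lia)) as H1.
            rewrite (lsum_ext _ _ (fun i => cos (f (x0 + INR (i + s' * B)) - f (x0 + INR (i + s * B))))).
            * lra. * intros i _. rewrite <- cos_neg. f_equal. ring. }
      eapply Rle_trans; [apply lsum_le; exact Hone|].
      rewrite lsum_plus, lsum_const, length_seq.
      assert (lsum (seq 0 S) (fun s' => if Nat.eq_dec s' s then INR L else 0) <= INR L).
      { apply lsum_single, pos_INR. }
      lra. }
    eapply Rle_trans; [apply lsum_le_const; exact Hin|]. rewrite length_seq.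
    right. ring. }
  assert (HL : 0 <= INR L) by apply pos_INR.
  assert (Hi : 0 < / INR S ^ 2) by (apply Rinv_0_lt_compat, pow_lt; auto).
  apply Rle_trans with (2 * (/ INR S ^ 2 * (INR L * (U + V))) + 16 * (INR S * INR B) ^ 2); [lra|].
  apply Rplus_le_compat_r, Rmult_le_compat_l; [lra|].
  apply Rle_trans with (/ INR S ^ 2 * (INR L * (INR S * INR L + INR S ^ 2 * T))).
  - apply Rmult_le_compat_l; [lra|]. apply Rmult_le_compat_l; auto.
  - right. field. lra.
Qed.

(** * Iterated differences of the logarithm *)

Fixpoint iter_diff (hs : list R) (f : R -> R) (x : R) : R :=
  match hs with
  | [] => f x
  | h :: hs' => iter_diff hs' f (x + h) - iter_diff hs' f x
  end.

Definition list_prodR (hs : list R) : R := fold_right Rmult 1 hs.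

Lemma derivable_pt_lim_shift (f : R -> R) (h x l : R) :
  derivable_pt_lim f (x + h) l -> derivable_pt_lim (fun y => f (y + h)) x l.
Proof.
  intros H. replace l with (l * (1 + 0)) by ring.
  apply (derivable_pt_lim_comp (fun y => y + h) f); auto.
  apply (derivable_pt_lim_plus id (fun _ => h)).
  - apply derivable_pt_lim_id.
  - apply derivable_pt_lim_const.
Qed.

Section MeanValue.
Variable F : nat -> R -> R.
Hypothesis HF : forall k x, 0 < x -> derivable_pt_lim (F k) x (F (S k) x).

Lemma iter_diff_derivable (hs : list R) (k : nat) (x : R) :
  0 < x -> (forall h, In h hs -> 0 < h) ->
  derivable_pt_lim (iter_diff hs (F k)) x (iter_diff hs (F (S k)) x).
Proof.
  revert x. induction hs as [|h hs IH]; intros x Hx Hh; simpl; [apply HF; auto|].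
  assert (0 < h) by (apply Hh; simpl; auto).
  apply (derivable_pt_lim_minus (fun y => iter_diff hs (F k) (y + h)) (iter_diff hs (F k))).
  - apply derivable_pt_lim_shift. apply IH; [lra|intros; apply Hh; simpl; auto].
  - apply IH; auto. intros; apply Hh; simpl; auto.
Qed.

(** Differencing commutes with differentiation, so each mean value step trades one difference for
    its length [h] times one more derivative. Writing the derivatives as a sequence [F] lets the
    induction raise [k]. *)
Lemma iter_diff_mean_value (hs : list R) (k : nat) (x : R) :
  0 < x -> (forall h, In h hs -> 0 < h) ->
  exists xi, x <= xi <= x + lsum hs (fun h => h) /\
    iter_diff hs (F k) x = list_prodR hs * F (k + length hs)%nat xi.
Proof.
  revert k x. induction hs as [|h hs IH]; intros k x Hx Hh; simpl.
  - exists x. rewrite Nat.add_0_r. lra.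
  - assert (Hh0 : 0 < h) by (apply Hh; simpl; auto).
    assert (Hhs : forall h, In h hs -> 0 < h) by (intros; apply Hh; simpl; auto).
    destruct (MVT_cor2 (iter_diff hs (F k)) (iter_diff hs (F (S k))) x (x + h)) as [z [H1 H2]]; [lra| |].
    { intros c Hc. apply iter_diff_derivable; auto; lra. }
    destruct (IH (S k) z ltac:(lra) Hhs) as [xi [H3 H4]].
    exists xi. split; [lra|]. rewrite H1, H4.
    replace (k + S (length hs))%nat with (S k + length hs)%nat by lia. ring.
Qed.

End MeanValue.

(** The [k]-th derivative of [ln], indexed to serve as [F] in the mean value lemma. *)
Definition dlog (k : nat) (x : R) : R :=
  match k with
  | 0%nat => ln x
  | S j => (-1) ^ j * INR (fact j) / x ^ S j
  end.

Lemma dlog_derivable (k : nat) (x : R) : 0 < x -> derivable_pt_lim (dlog k) x (dlog (S k) x).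
Proof.
  intros Hx. destruct k as [|j].
  - simpl. replace (1 * 1 / (x * 1)) with (/ x) by (field; lra). apply derivable_pt_lim_ln; auto.
  - unfold dlog. set (c := (-1) ^ j * INR (fact j)).
    assert (Hp : x ^ S j <> 0) by (apply pow_nonzero; lra).
    pose proof (derivable_pt_lim_div (fun _ => c) (fun y => y ^ S j) x 0 (INR (S j) * x ^ j)
      (derivable_pt_lim_const c x) (derivable_pt_lim_pow x (S j)) Hp) as H.
    replace ((-1) ^ S j * INR (fact (S j)) / x ^ S (S j))
      with ((0 * x ^ S j - INR (S j) * x ^ j * c) / (x ^ S j)²); [exact H|].
    unfold c, Rsqr. rewrite fact_simpl, mult_INR.
    assert (Hj : x ^ j <> 0) by (apply pow_nonzero; lra). simpl pow. field. lra.
Qed.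

Lemma tlog_derivable (t : R) (k : nat) (x : R) : 0 < x ->
  derivable_pt_lim (fun y => t * dlog k y) x (t * dlog (S k) x).
Proof. intros Hx. apply (derivable_pt_lim_scal (dlog k)). apply dlog_derivable; auto. Qed.

Lemma rprod_bounds (hs : list R) (b c : R) : 0 < b -> (forall h, In h hs -> b <= h <= c) ->
  b ^ length hs <= list_prodR hs <= c ^ length hs.
Proof.
  intros Hb. induction hs as [|h hs IH]; simpl; intros H; [lra|].
  specialize (IH (fun x Hx => H x (or_intror Hx))). pose proof (H h (or_introl eq_refl)) as H1.
  assert (0 < b ^ length hs) by (apply pow_lt; auto). split; apply Rmult_le_compat; lra.
Qed.

Lemma sign_sq (q : nat) : (-1) ^ q * (-1) ^ q = 1.
Proof. rewrite <- Rpow_mult_distr. replace (-1 * -1) with 1 by ring. apply pow1. Qed.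

(** After [q] differencings the increments of the phase are [(-1)^q t q!] times the product of the
    shifts over [xi^(q+1)]. Once the sign is removed they are positive, at most 1 by the last
    hypothesis, and decreasing because one more difference brings the opposite sign. Kuzmin-Landau
    applies with their lower bound as [lam]. *)
Lemma last_level (L : nat) (t x0 b c m X : R) (hs : list R) :
  0 < t -> 1 <= b -> 0 < m -> m <= x0 ->
  x0 + INR L + 2 + lsum hs (fun h => h) <= X ->
  (forall h, In h hs -> b <= h <= c) ->
  let q := length hs in
  t * INR (fact q) * c ^ q <= m ^ S q ->
  nrm2 (seq 0 (S L)) (fun i => iter_diff hs (fun y => t * dlog 0 y) (x0 + INR i))
    <= 2 * (2 / (t * INR (fact q) * b ^ q / X ^ S q) + 1) ^ 2.
Proof.
  intros Ht Hb Hm Hx HX Hh q Hq.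
  assert (Hbc : hs = [] \/ b <= c).
  { destruct hs as [|h]; auto. right. specialize (Hh h (or_introl eq_refl)). lra. }
  assert (Hsum : 0 <= lsum hs (fun h => h)).
  { apply lsum_nonneg. intros h Hi. specialize (Hh h Hi). lra. }
  set (f := iter_diff hs (fun y => t * dlog 0 y)).
  assert (HXm : m <= X) by (pose proof (pos_INR L); lra).
  assert (HXp : 0 < X ^ S q) by (apply pow_lt; lra).
  assert (Hf : 0 < INR (fact q)) by (apply lt_0_INR, lt_O_fact).
  assert (HS : forall x, f (x + 1) - f x = iter_diff (1 :: hs) (fun y => t * dlog 0 y) x) by reflexivity.
  assert (HI : forall i, x0 + INR (S i) = (x0 + INR i) + 1) by (intros; rewrite S_INR; ring).
  assert (Hs1 : forall i, (i <= L)%nat ->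
    t * INR (fact q) * b ^ q / X ^ S q <= (-1) ^ q * (f (x0 + INR (S i)) - f (x0 + INR i)) <= 1).
  { intros i Hi. apply le_INR in Hi. pose proof (pos_INR i) as Hi0. rewrite HI, HS.
    destruct (iter_diff_mean_value (fun k y => t * dlog k y) (tlog_derivable t) (1 :: hs) 0 (x0 + INR i)) as [xi [H1 H2]].
    { lra. } { intros h [<-|Hin]; [lra|]. specialize (Hh h Hin). lra. }
    simpl iter_diff in H2 |- *. rewrite H2. simpl Nat.add. cbn [list_prodR fold_right length dlog]. fold (list_prodR hs). fold q.
    pose proof (rprod_bounds hs b c ltac:(lra) Hh) as HP. fold q in HP.
    cbn [lsum fold_right] in H1. fold (lsum hs (fun h => h)) in H1.
    assert (Hxi : 0 < xi ^ S q) by (apply pow_lt; lra).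
    assert (H3 : m ^ S q <= xi ^ S q) by (apply pow_incr; lra).
    assert (H4 : xi ^ S q <= X ^ S q) by (apply pow_incr; lra).
    replace ((-1) ^ q * (1 * list_prodR hs * (t * ((-1) ^ q * INR (fact q) / xi ^ S q))))
      with ((-1) ^ q * (-1) ^ q * (t * INR (fact q) * list_prodR hs / xi ^ S q)) by (field; lra).
    rewrite sign_sq, Rmult_1_l.
    assert (Htf : 0 < t * INR (fact q)) by (apply Rmult_lt_0_compat; auto).
    assert (Hbq : 0 < b ^ q) by (apply pow_lt; lra).
    split.
    - apply Rmult_le_compat.
      + apply Rmult_le_pos; lra.
      + left; apply Rinv_0_lt_compat; lra.
      + apply Rmult_le_compat_l; lra.
      + apply Rinv_le_contravar; auto.
    - apply (Rmult_le_reg_r (xi ^ S q)); auto.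
      replace (t * INR (fact q) * list_prodR hs / xi ^ S q * xi ^ S q) with (t * INR (fact q) * list_prodR hs) by (field; lra).
      assert (t * INR (fact q) * list_prodR hs <= t * INR (fact q) * c ^ q) by (apply Rmult_le_compat_l; lra).
      lra. }
  rewrite (nrm2_ext _ _ (fun i => (-1) ^ q * ((-1) ^ q * f (x0 + INR i)))).
  2:{ intros i _. rewrite <- Rmult_assoc, sign_sq. unfold f. ring. }
  assert (Hsg : nrm2 (seq 0 (S L)) (fun i => (-1) ^ q * ((-1) ^ q * f (x0 + INR i)))
     = nrm2 (seq 0 (S L)) (fun i => (-1) ^ q * f (x0 + INR i))).
  { assert (Hpm : (-1) ^ q = 1 \/ (-1) ^ q = -1).
    { clear. induction q as [|q [IH|IH]]; simpl; [auto|right|left]; rewrite IH; ring. }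
    destruct Hpm as [E|E].
    - apply nrm2_ext. intros i _. rewrite E. ring.
    - rewrite <- (nrm2_opp _ (fun i => (-1) ^ q * f (x0 + INR i))).
      apply nrm2_ext. intros i _. rewrite E. ring. }
  rewrite Hsg. apply kuzmin_landau.
  - apply Rdiv_lt_0_compat; auto. apply Rmult_lt_0_compat; [apply Rmult_lt_0_compat; auto|apply pow_lt; lra].
  - intros i Hi. specialize (Hs1 i Hi). lra.
  - intros i Hi. pose proof (le_INR (S i) L ltac:(lia)) as Hi'. pose proof (pos_INR i) as Hi0.
    rewrite S_INR in Hi'.
    assert (E : (-1) ^ q * f (x0 + INR (S (S i))) - (-1) ^ q * f (x0 + INR (S i))
       - ((-1) ^ q * f (x0 + INR (S i)) - (-1) ^ q * f (x0 + INR i))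
       = (-1) ^ q * iter_diff (1 :: 1 :: hs) (fun y => t * dlog 0 y) (x0 + INR i)).
    { rewrite (HI (S i)), (HI i). cbn [iter_diff]. unfold f. ring. }
    destruct (iter_diff_mean_value (fun k y => t * dlog k y) (tlog_derivable t) (1 :: 1 :: hs) 0 (x0 + INR i)) as [xi [H1 H2]].
    { lra. } { intros h [<-|[<-|Hin]]; [lra|lra|]. specialize (Hh h Hin). lra. }
    rewrite H2 in E. simpl Nat.add in E. cbn [list_prodR fold_right length dlog] in E. fold (list_prodR hs) in E. fold q in E.
    pose proof (rprod_bounds hs b c ltac:(lra) Hh) as HP. fold q in HP.
    assert (Hbq : 0 < b ^ q) by (apply pow_lt; lra).
    assert (Hxi : 0 < xi ^ S (S q)) by (apply pow_lt; lra).
    replace ((-1) ^ q * (1 * (1 * list_prodR hs) * (t * ((-1) ^ S q * INR (fact (S q)) / xi ^ S (S q)))))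
      with (- ((-1) ^ q * (-1) ^ q * (t * INR (fact (S q)) * list_prodR hs / xi ^ S (S q)))) in E
      by (simpl pow; field; repeat split; try lra; apply pow_nonzero; lra).
    rewrite sign_sq, Rmult_1_l in E.
    assert (0 < INR (fact (S q))) by (apply lt_0_INR, lt_O_fact).
    assert (0 < t * INR (fact (S q)) * list_prodR hs / xi ^ S (S q)).
    { apply Rdiv_lt_0_compat; auto. apply Rmult_lt_0_compat; [apply Rmult_lt_0_compat; auto|lra]. }
    lra.
Qed.

Section Levels.
Variables w be E q : nat.
Variable t : R.
Let W := INR w.
Let M := (w ^ (2 * be))%nat.
Let L := (9 * M)%nat.
Hypothesis Hbe : ((q + 2) * E + 10 <= be)%nat.
Hypothesis HE : (2 ^ S q <= E)%nat.
Hypothesis Hw20 : (20 <= w)%nat.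
Hypothesis Hwf : (fact q <= w)%nat.
Hypothesis Hwq : (2 * q + 3 <= w)%nat.
Hypothesis Hw11 : 4 * 11 ^ S q <= W.
Hypothesis Ht1 : W ^ (q * be + E + 1) <= t.
Hypothesis Ht2 : t <= W ^ (S q * be + E + 1).

Let HW : 20 <= W.
Proof. unfold W. apply le_IZR_INR; lia. Qed.

Let HbeE : (q * E + 2 * E + 10 <= be)%nat.
Proof. lia. Qed.

Let HqE : (0 <= q * E)%nat.
Proof. lia. Qed.

Let HWpos : forall k, 0 < W ^ k.
Proof. intros k. apply pow_lt. lra. Qed.

Let HWmono : forall i j, (i <= j)%nat -> W ^ i <= W ^ j.
Proof. intros. apply Rle_pow; auto. lra. Qed.

Let HM : INR M = W ^ (2 * be).
Proof. unfold M, W. apply pow_INR. Qed.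

Let HL : INR L = 9 * W ^ (2 * be).
Proof. unfold L. rewrite mult_INR, HM. simpl; lra. Qed.

Let Ht0 : 0 < t.
Proof. pose proof (HWpos (q * be + E + 1)). lra. Qed.

(** The induction goes back from the fully differenced sum, and undoing one differencing essentially
    takes the square root of the saving: [W^(2e+1)] becomes [W^e]. A saving [W] at depth 0 therefore
    requires [W^(2^(q+1) - 1)] at depth [q], whence [2^(q+1) <= E]. The window for [t] is the one in
    which [t h^q / M^(q+1)] lies between about [W^(E+1) / M] and 1 for the shifts [h] used. *)
Lemma level_bound (d : nat) : forall (hs : list R) (x0 : R), (length hs + d = q)%nat ->
  (forall h, In h hs -> W ^ be <= h <= W ^ (be + E)) ->
  W ^ (2 * be) <= x0 <= W ^ (2 * be) + 1 + INR (length hs) * W ^ (be + E) ->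
  nrm2 (seq 0 L) (fun i => iter_diff hs (fun y => t * dlog 0 y) (x0 + INR i))
    <= (INR L / W ^ (2 ^ S (length hs) - 1)) ^ 2.
Proof.
  induction d as [|d IH]; intros hs x0 Hd Hh Hx.
  - assert (Hlen : length hs = q) by lia. rewrite Hlen in Hx |- *.
    assert (HM1 : (1 <= M)%nat) by (apply pow_ge_1; lia).
    pose proof (last_level (L - 1) t x0 (W ^ be) (W ^ (be + E)) (W ^ (2 * be)) (11 * W ^ (2 * be)) hs) as H.
    replace (S (L - 1)) with L in H by lia.
    rewrite Hlen in H.
    (* The shifts together stay below [M = W^(2 be)], so the phase is only evaluated on
       [[M, 11 M]]. *)
    assert (Hsmall : INR (2 * q + 3) * W ^ (be + E) <= W ^ (2 * be)).
    { apply Rle_trans with (W ^ 1 * W ^ (be + E)).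
      - apply Rmult_le_compat_r; [left; auto|]. rewrite pow_1. apply le_INR; auto.
      - rewrite <- pow_add. apply HWmono. clear - HbeE HqE. lia. }
    rewrite plus_INR, mult_INR in Hsmall. simpl (INR 2) in Hsmall. simpl (INR 3) in Hsmall.
    assert (HbE : 1 <= W ^ (be + E)) by (apply pow_R1_Rle; lra).
    eapply Rle_trans; [apply H|]; clear H; auto.
    + apply pow_R1_Rle; lra.
    + lra.
    + rewrite minus_INR, HL by (unfold L; lia).
      assert (lsum hs (fun h => h) <= INR (length hs) * W ^ (be + E))
        by (apply lsum_le_const; intros h Hi; apply Hh; auto).
      rewrite Hlen in H. simpl (INR 1). lra.
    + apply Rle_trans with (W ^ (S q * be + E + 1) * W ^ 1 * (W ^ (be + E)) ^ q).
      * apply Rmult_le_compat_r; [left; apply pow_lt; auto|].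
        apply Rmult_le_compat; [lra|apply pos_INR|auto|]. rewrite pow_1. apply le_INR; auto.
      * rewrite <- !pow_mult, <- !pow_add. apply HWmono. clear - HbeE HqE. lia.
    + set (lam := t * INR (fact q) * (W ^ be) ^ q / (11 * W ^ (2 * be)) ^ S q).
      assert (Hfq : 1 <= INR (fact q)).
      { replace 1 with (INR 1) by reflexivity. apply le_INR. pose proof (lt_O_fact q). lia. }
      assert (Hden : 0 < t * INR (fact q) * (W ^ be) ^ q).
      { apply Rmult_lt_0_compat; [apply Rmult_lt_0_compat; lra|apply pow_lt; auto]. }
      assert (H11 : 0 < 11 ^ S q) by (apply pow_lt; lra).
      assert (Hlam : 2 / lam * W ^ E <= 2 * 11 ^ S q / W * W ^ (2 * be)).
      { replace (2 / lam * W ^ E) with (2 * ((11 * W ^ (2 * be)) ^ S q * W ^ E) / (t * INR (fact q) * (W ^ be) ^ q)).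
        2:{ unfold lam. pose proof (HWpos (2 * be)) as Hp2.
            assert (HA : (11 * W ^ (2 * be)) ^ S q <> 0) by (apply pow_nonzero; lra).
            assert (HB : (W ^ be) ^ q <> 0) by (apply pow_nonzero, Rgt_not_eq, HWpos).
            set (A := (11 * W ^ (2 * be)) ^ S q) in *. set (B := (W ^ be) ^ q) in *.
            clearbody A B. field. lra. }
        apply div_le; auto.
        apply Rle_trans with (2 * 11 ^ S q * / W * W ^ (2 * be) * (W ^ (q * be + E + 1) * 1 * (W ^ be) ^ q)).
        - right. rewrite Rpow_mult_distr, <- !pow_mult.
          replace (W ^ (2 * be * S q)) with (W ^ (2 * be) * W ^ (q * be) * W ^ (be * q)).
          2:{ rewrite <- !pow_add. f_equal. lia. }
          rewrite !pow_add, pow_1. field. lra.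
        - apply Rmult_le_compat_l.
          + apply Rmult_le_pos; [|left; auto]. apply Rle_mult_inv_pos; lra.
          + apply Rmult_le_compat_r; [left; apply pow_lt; auto|].
            apply Rmult_le_compat; [left; auto|lra|auto|auto]. }
      assert (Hlam0 : 0 < 2 / lam).
      { apply Rdiv_lt_0_compat; [lra|]. unfold lam. apply Rdiv_lt_0_compat; auto.
        apply pow_lt. pose proof (HWpos (2 * be)). lra. }
      apply Rle_trans with ((2 * (2 / lam + 1)) ^ 2); [nra|].
      apply pow_incr. split; [lra|].
      assert (HWe : W ^ (2 ^ S q - 1) <= W ^ E) by (apply HWmono; lia).
      apply (Rmult_le_reg_r (W ^ (2 ^ S q - 1))); auto.
      unfold Rdiv at 2. rewrite (Rmult_assoc (INR L)), Rinv_l, Rmult_1_r by (apply Rgt_not_eq, HWpos).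
      rewrite HL.
      apply Rle_trans with (2 * (2 / lam + 1) * W ^ E).
      { apply Rmult_le_compat_l; [lra|auto]. }
      assert (Hq1 : 2 * 11 ^ S q / W * W ^ (2 * be) <= 1 / 2 * W ^ (2 * be)).
      { apply Rmult_le_compat_r; [left; auto|].
        apply div_le; lra. }
      assert (Hq2 : W ^ E <= W ^ (2 * be)) by (apply HWmono; clear - HbeE HqE; lia).
      replace (2 * (2 / lam + 1) * W ^ E) with (2 * (2 / lam * W ^ E) + 2 * W ^ E) by ring. lra.
  - set (j := length hs) in *.
    set (T := INR L / W ^ (2 ^ S (S j) - 1)).
    (* The extra 1 in the exponent is a spare factor [W >= 20], which pays for the constants
       [2 + 2 + 16] of the differencing inequality. *)
    assert (Hpw : (2 * (2 ^ S j - 1) + 1 = 2 ^ S (S j) - 1)%nat).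
    { rewrite (Nat.pow_succ_r' 2 (S j)). pose proof (pow_ge_1 2 (S j)). lia. }
    assert (HEj : (2 ^ S (S j) - 1 <= E)%nat).
    { assert (2 ^ S (S j) <= 2 ^ S q)%nat by (apply Nat.pow_le_mono_r; lia). lia. }
    assert (HLp : 0 < INR L) by (rewrite HL; pose proof (HWpos (2 * be)); lra).
    eapply Rle_trans; [apply (van_der_corput (iter_diff hs (fun y => t * dlog 0 y)) x0 T L (w ^ E) (w ^ be))|].
    + apply pow_ge_1. lia.
    + unfold T. apply Rmult_le_pos; [lra|]. left. apply Rinv_0_lt_compat; auto.
    + intros s' s Hs.
      pose proof (IH (INR ((s - s') * w ^ be) :: hs) (x0 + INR (s' * w ^ be))) as H.
      cbn [length] in H. fold j in H. fold T in H. cbn [iter_diff] in H. apply H; clear H; [lia| |].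
      * intros h [<-|Hin]; [|apply Hh; auto]. rewrite mult_INR, pow_INR. fold W.
        split.
        -- rewrite <- (Rmult_1_l (W ^ be)) at 1. apply Rmult_le_compat_r; [left; auto|].
           apply le_IZR_INR; lia.
        -- rewrite pow_add, Rmult_comm. apply Rmult_le_compat_l; [left; auto|].
           unfold W. rewrite <- pow_INR. apply le_INR. lia.
      * rewrite mult_INR, pow_INR, S_INR. fold W.
        assert (INR s' * W ^ be <= W ^ (be + E)).
        { rewrite pow_add, Rmult_comm. apply Rmult_le_compat_l; [left; auto|].
          unfold W. rewrite <- pow_INR. apply le_INR. lia. }
        assert (0 <= INR s' * W ^ be) by (apply Rmult_le_pos; [apply pos_INR|left; auto]).
        lra.
    + unfold T. rewrite !pow_INR. fold W.
      rewrite <- Hpw. set (e := (2 ^ S j - 1)%nat) in *.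
      assert (HeE : W ^ (2 * e + 1) <= W ^ E) by (apply HWmono; lia).
      assert (He : W ^ (2 * e + 1) = W * (W ^ e) ^ 2).
      { rewrite <- pow_mult, Nat.add_comm, pow_add, pow_1, Nat.mul_comm. auto. }
      assert (H1 : INR L ^ 2 / W ^ E <= INR L ^ 2 / W ^ (2 * e + 1)).
      { apply Rmult_le_compat_l; [apply pow2_ge_0|]. apply Rinv_le_contravar; auto. }
      assert (H2 : (W ^ E * W ^ be) ^ 2 <= INR L ^ 2 / W ^ (2 * e + 1)).
      { apply le_div; auto.
        apply Rle_trans with ((W ^ E * W ^ be) ^ 2 * W ^ E).
        - apply Rmult_le_compat_l; [apply pow2_ge_0|auto].
        - rewrite HL, Rpow_mult_distr, <- !pow_mult, <- !pow_add, Rpow_mult_distr, <- pow_mult.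
          assert (W ^ ((E + be) * 2 + E) <= W ^ (2 * be * 2)) by (apply HWmono; clear - HbeE HqE; lia).
          pose proof (HWpos (2 * be * 2)). replace ((E * 2 + be * 2 + E))%nat with ((E + be) * 2 + E)%nat by lia. lra. }
      replace (INR L * (INR L / W ^ (2 * e + 1))) with (INR L ^ 2 / W ^ (2 * e + 1)) by (field; apply Rgt_not_eq, HWpos).
      set (X := INR L ^ 2 / W ^ (2 * e + 1)) in *.
      assert (HX : 20 * X <= (INR L / W ^ e) ^ 2).
      { unfold X. rewrite He. pose proof (HWpos e) as Hp.
        replace ((INR L / W ^ e) ^ 2) with (W * (INR L ^ 2 / (W * (W ^ e) ^ 2))) by (field; lra).
        apply Rmult_le_compat_r; auto. apply Rmult_le_pos; [apply pow2_ge_0|].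
        left; apply Rinv_0_lt_compat. apply Rmult_lt_0_compat; [lra|]. apply pow_lt; auto. }
      lra.
Qed.

End Levels.

(** [E] and [be] depend only on the maximal number [Q] of differencings, so a single length [M]
    serves all [t]. Only the number [q] of differencings actually made adapts to the size of [t]. *)
Lemma log_exponential_sum (Q : nat) : exists w0, forall w, (w0 <= w)%nat ->
  let E := (2 ^ S Q)%nat in let be := ((Q + 2) * E + 10)%nat in
  let M := (w ^ (2 * be))%nat in
  forall t : R, INR w ^ (E + 1) <= t <= INR w ^ (Q * be) ->
  nrm2 (seq 0 (9 * M)) (fun i => t * ln (INR M + 1 + INR i)) <= (INR (9 * M) / INR w) ^ 2.
Proof.
  destruct (INR_unbounded (4 * 11 ^ S Q)) as [w1 Hw1].
  exists (20 + w1 + fact Q + 2 * Q + 3)%nat. intros w Hw E be M t [Ht1 Ht2].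
  assert (HW : 20 <= INR w). { apply le_IZR_INR; lia. }
  assert (HM : INR M = INR w ^ (2 * be)) by apply pow_INR.
  destruct (nat_crossing (fun q => INR w ^ (q * be + E + 1) <= t) Q) as [q [H1 H2]].
  { simpl. auto. }
  { apply Rlt_not_le. eapply Rle_lt_trans; [exact Ht2|]. apply Rlt_pow; [lra|lia]. }
  assert (Hq : (q < Q)%nat).
  { destruct (lt_dec q Q) as [|H]; auto. exfalso.
    assert (INR w ^ (Q * be) < INR w ^ (q * be + E + 1)) by (apply Rlt_pow; [lra|nia]). lra. }
  assert (HE : (2 ^ S q <= E)%nat) by (apply Nat.pow_le_mono_r; lia).
  assert (E1 : ((q + 2) * E <= (Q + 2) * E)%nat) by (apply Nat.mul_le_mono_r; lia).
  assert (E2 : (fact q <= fact Q)%nat) by (apply fact_le; lia).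
  assert (E3 : 4 * 11 ^ S q <= INR w).
  { assert (11 ^ S q <= 11 ^ S Q) by (apply Rle_pow; [lra|lia]).
    assert (INR w1 <= INR w) by (apply le_INR; lia). lra. }
  pose proof (level_bound w be E q t ltac:(lia) HE ltac:(lia) ltac:(lia) ltac:(lia) E3 H1
    ltac:(apply Rnot_le_lt in H2; lra) q [] (INR M + 1) ltac:(simpl; lia)) as H.
  simpl length in H. simpl (2 ^ 1 - 1)%nat in H. rewrite pow_1 in H. cbn [iter_diff dlog] in H.
  apply H.
  - intros h [].
  - rewrite <- HM. simpl. lra.
Qed.

(** * A localising kernel with few frequencies *)

Lemma lsum_reverse (D : nat) (f : nat -> R) :
  lsum (seq 0 D) (fun i => f (D - i)%nat) = lsum (seq 1 D) f.
Proof.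
  rewrite (lsum_seq_shift 1). induction D as [|D IH]; [reflexivity|].
  rewrite (lsum_seq_S D (fun i => f (1 + i)%nat)), <- IH, <- cons_seq. cbn [lsum fold_right].
  fold (lsum (seq 1 D) (fun i => f (S D - i)%nat)). rewrite (lsum_seq_shift 1).
  rewrite (lsum_ext _ (fun i => f (S D - (1 + i))%nat) (fun i => f (D - i)%nat)) by auto.
  simpl. lra.
Qed.

Lemma lsum_seq_trunc (A B : nat) (f : nat -> R) :
  (A <= B)%nat -> (forall i, (A <= i)%nat -> f i = 0) -> lsum (seq 0 B) f = lsum (seq 0 A) f.
Proof.
  intros HAB Hf. replace B with (A + (B - A))%nat by lia. rewrite seq_app, lsum_app.
  rewrite (lsum_ext (seq (0 + A) (B - A)) f (fun _ => 0)).
  - rewrite lsum_const. lra.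
  - intros i Hi. apply in_seq in Hi. apply Hf. lia.
Qed.

Lemma lsum_triangle (D : nat) (f : nat -> nat -> R) :
  lsum (seq 0 D) (fun j => lsum (seq 0 j) (fun i => f i (j - i)%nat))
  = lsum (seq 1 (D - 1)) (fun d => lsum (seq 0 (D - d)) (fun i => f i d)).
Proof.
  induction D as [|D IH]; [reflexivity|].
  rewrite lsum_seq_S, IH. replace (S D - 1)%nat with D by lia.
  rewrite (lsum_ext (seq 1 D) _ (fun d => lsum (seq 0 (D - d)) (fun i => f i d) + f (D - d)%nat d)).
  2:{ intros d Hd. apply in_seq in Hd. replace (S D - d)%nat with (S (D - d)) by lia. apply (lsum_seq_S (D - d) (fun i => f i d)). }
  rewrite lsum_plus. f_equal.
  - destruct D as [|D]; [reflexivity|]. replace (S D - 1)%nat with D by lia.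
    rewrite seq_S, lsum_app. cbn [lsum fold_right]. replace (S D - (1 + D))%nat with 0%nat by lia.
    simpl. unfold lsum. lra.
  - rewrite <- (lsum_reverse D (fun d => f (D - d)%nat d)). apply lsum_ext.
    intros i Hi. apply in_seq in Hi. f_equal. lia.
Qed.

Definition wnrm2 (b : nat -> R) (N : nat) (u : R) : R :=
  (lsum (seq 0 N) (fun i => b i * cos (INR i * u))) ^ 2
  + (lsum (seq 0 N) (fun i => b i * sin (INR i * u))) ^ 2.

Definition corr (b : nat -> R) (N d : nat) : R := lsum (seq 0 N) (fun i => b i * b (i + d)%nat).

Lemma wnrm2_nonneg (b : nat -> R) (N : nat) (u : R) : 0 <= wnrm2 b N u.
Proof. unfold wnrm2. apply Rplus_le_le_0_compat; apply pow2_ge_0. Qed.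

(** The Fourier coefficients of the squared modulus are the autocorrelations. The free bound [D]
    lets kernels of different lengths be expanded over the same frequencies. *)
Lemma wnrm2_expand (b : nat -> R) (N D : nat) (u : R) :
  (forall i, (N <= i)%nat -> b i = 0) -> (N <= D)%nat ->
  wnrm2 b N u = corr b N 0 + 2 * lsum (seq 1 (D - 1)) (fun d => corr b N d * cos (INR d * u)).
Proof.
  intros Hb HD.
  assert (E1 : wnrm2 b N u = wnrm2 b D u).
  { unfold wnrm2. rewrite !(lsum_seq_trunc N D); auto; intros i Hi; rewrite Hb; auto; lra. }
  rewrite E1.
  assert (E2 : forall D, wnrm2 b D u = lsum (seq 0 D) (fun i => b i * b i)
    + 2 * lsum (seq 0 D) (fun j => lsum (seq 0 j) (fun i => b i * b (i + (j - i))%nat * cos (INR (j - i) * u)))).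
  { clear. intros D. induction D as [|D IH]; [unfold wnrm2; simpl; lra|].
    rewrite !lsum_seq_S. unfold wnrm2 in *. rewrite !lsum_seq_S.
    rewrite (lsum_ext (seq 0 D) (fun i => b i * b (i + (D - i))%nat * cos (INR (D - i) * u))
      (fun i => (b D * cos (INR D * u)) * (b i * cos (INR i * u)) + (b D * sin (INR D * u)) * (b i * sin (INR i * u)))).
    - rewrite lsum_plus, !lsum_scal. pose proof (sin2_cos2 (INR D * u)) as H. unfold Rsqr in H.
      set (X := lsum (seq 0 D) (fun i => b i * cos (INR i * u))) in *.
      set (Y := lsum (seq 0 D) (fun i => b i * sin (INR i * u))) in *.
      set (c := cos (INR D * u)) in *. set (s := sin (INR D * u)) in *.
      replace ((X + b D * c) ^ 2 + (Y + b D * s) ^ 2) with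
        (X ^ 2 + Y ^ 2 + b D * b D * (s * s + c * c) + 2 * (b D * c * X + b D * s * Y)) by ring.
      rewrite H, IH. ring.
    - intros i Hi. apply in_seq in Hi. replace (i + (D - i))%nat with D by lia.
      rewrite minus_INR, Rmult_minus_distr_r, cos_minus by lia. ring. }
  rewrite E2, (lsum_triangle D (fun i d => b i * b (i + d)%nat * cos (INR d * u))).
  f_equal.
  - unfold corr. rewrite (lsum_seq_trunc N D); auto.
    + apply lsum_ext. intros i _. now rewrite Nat.add_0_r.
    + intros i Hi. rewrite Hb; auto; lra.
  - f_equal. apply lsum_ext. intros d Hd. apply in_seq in Hd. rewrite lsum_scal_r. f_equal.
    unfold corr. rewrite <- (lsum_seq_trunc N D); auto.
    + symmetry. apply lsum_seq_trunc; [lia|]. intros i Hi. rewrite (Hb (i + d)%nat) by lia. lra.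
    + intros i Hi. rewrite Hb; auto; lra.
Qed.

Lemma corr_le (b : nat -> R) (N d : nat) : (forall i, (N <= i)%nat -> b i = 0) ->
  Rabs (corr b N d) <= corr b N 0.
Proof.
  intros Hb. unfold corr. eapply Rle_trans; [apply lsum_abs|].
  apply Rle_trans with (lsum (seq 0 N) (fun i => / 2 * (b i * b i) + / 2 * (b (d + i)%nat * b (d + i)%nat))).
  - apply lsum_le. intros i _. rewrite Nat.add_comm. apply Rabs_le.
    pose proof (pow2_ge_0 (b i + b (d + i)%nat)). pose proof (pow2_ge_0 (b i - b (d + i)%nat)). lra.
  - rewrite lsum_plus, !lsum_scal.
    rewrite (lsum_ext (seq 0 N) (fun i => b i * b (i + 0)%nat) (fun i => b i * b i))
      by (intros; now rewrite Nat.add_0_r).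
    assert (H : lsum (seq 0 N) (fun i => b (d + i)%nat * b (d + i)%nat) <= lsum (seq 0 N) (fun i => b i * b i)).
    { rewrite <- (lsum_seq_shift d N (fun i => b i * b i)).
      rewrite <- (lsum_seq_trunc N (d + N) (fun i => b i * b i)); [|lia|intros i Hi; rewrite Hb; auto; lra].
      apply lsum_incl; [apply seq_NoDup| |].
      - intros i Hi. apply in_seq in Hi. apply in_seq. lia.
      - intros i _. nra. }
    lra.
Qed.

(** Increasing the lag by one changes the correlation by at most the supremum times the total
    variation. *)
Lemma corr_lipschitz (b : nat -> R) (N d : nat) (B V : R) :
  (forall i, (N <= i)%nat -> b i = 0) -> (forall i, Rabs (b i) <= B) ->
  lsum (seq 0 N) (fun i => Rabs (b i - b (S i))) <= V ->
  Rabs (corr b N d - corr b N 0) <= INR d * (B * V).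
Proof.
  intros Hb HB HV.
  assert (HB0 : 0 <= B) by (eapply Rle_trans; [apply Rabs_pos|apply (HB 0%nat)]).
  induction d as [|d IH].
  - rewrite Rminus_diag, Rabs_R0. simpl. lra.
  - rewrite S_INR.
    assert (H : Rabs (corr b N (S d) - corr b N d) <= B * V).
    { unfold corr. rewrite <- lsum_minus. eapply Rle_trans; [apply lsum_abs|].
      apply Rle_trans with (lsum (seq 0 N) (fun i => B * Rabs (b (d + i)%nat - b (S (d + i))))).
      - apply lsum_le. intros i _. rewrite <- Rmult_minus_distr_l, Rabs_mult.
        replace (i + S d)%nat with (S (d + i)) by lia. replace (i + d)%nat with (d + i)%nat by lia.
        rewrite (Rabs_minus_sym (b (S (d + i)))).
        apply Rmult_le_compat_r; [apply Rabs_pos|apply HB].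
      - rewrite lsum_scal. apply Rmult_le_compat_l; auto. eapply Rle_trans; [|exact HV].
        rewrite <- (lsum_seq_shift d N (fun i => Rabs (b i - b (S i)))).
        rewrite <- (lsum_seq_trunc N (d + N)); [|lia|].
        + apply lsum_incl; [apply seq_NoDup| |].
          * intros i Hi. apply in_seq in Hi. apply in_seq. lia.
          * intros i _. apply Rabs_pos.
        + intros i Hi. rewrite !Hb by lia. rewrite Rminus_diag, Rabs_R0; auto. }
    replace (corr b N (S d) - corr b N 0) with ((corr b N (S d) - corr b N d) + (corr b N d - corr b N 0)) by ring.
    eapply Rle_trans; [apply Rabs_triang|]. lra.
Qed.

(** Differencing multiplies the transform by [e^(-iu) - 1]; the zeros at [0] and [N] remove the
    boundary terms. *)
Lemma wnrm2_difference (b : nat -> R) (N : nat) (u : R) :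
  b 0%nat = 0 -> b N = 0 ->
  wnrm2 (fun i => b (S i) - b i) N u = 2 * (1 - cos u) * wnrm2 b N u.
Proof.
  intros H0 HN. unfold wnrm2.
  set (X := lsum (seq 0 N) (fun i => b i * cos (INR i * u))).
  set (Y := lsum (seq 0 N) (fun i => b i * sin (INR i * u))).
  assert (Hsh : forall f : nat -> R, f 0%nat = 0 -> f N = 0 ->
    lsum (seq 0 N) (fun i => f (S i)) = lsum (seq 0 N) f).
  { intros f Hf0 HfN. pose proof (lsum_seq_S N f) as H1.
    rewrite <- cons_seq in H1. cbn [lsum fold_right] in H1.
    fold (lsum (seq 1 N) f) in H1. rewrite (lsum_seq_shift 1) in H1.
    rewrite (lsum_ext _ (fun i => f (S i)) (fun i => f (1 + i)%nat)) by auto. lra. }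
  assert (EX : lsum (seq 0 N) (fun i => (b (S i) - b i) * cos (INR i * u)) = (cos u - 1) * X + sin u * Y).
  { rewrite (lsum_ext _ _ (fun i => (cos u * (b (S i) * cos (INR (S i) * u))
      + sin u * (b (S i) * sin (INR (S i) * u))) - b i * cos (INR i * u))).
    - rewrite lsum_minus, lsum_plus, !lsum_scal.
      rewrite (Hsh (fun i => b i * cos (INR i * u))), (Hsh (fun i => b i * sin (INR i * u)));
        try (rewrite H0; lra); try (rewrite HN; lra). fold X Y. ring.
    - intros i _. replace (INR i * u) with (INR (S i) * u - u) by (rewrite S_INR; ring).
      rewrite cos_minus. ring. }
  assert (EY : lsum (seq 0 N) (fun i => (b (S i) - b i) * sin (INR i * u)) = (cos u - 1) * Y - sin u * X).
  { rewrite (lsum_ext _ _ (fun i => (cos u * (b (S i) * sin (INR (S i) * u))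
      - sin u * (b (S i) * cos (INR (S i) * u))) - b i * sin (INR i * u))).
    - rewrite !lsum_minus, !lsum_scal.
      rewrite (Hsh (fun i => b i * cos (INR i * u))), (Hsh (fun i => b i * sin (INR i * u)));
        try (rewrite H0; lra); try (rewrite HN; lra). fold X Y. ring.
    - intros i _. replace (INR i * u) with (INR (S i) * u - u) by (rewrite S_INR; ring).
      rewrite sin_minus. ring. }
  rewrite EX, EY. pose proof (sin2_cos2 u) as H. unfold Rsqr in H.
  replace (((cos u - 1) * X + sin u * Y) ^ 2 + ((cos u - 1) * Y - sin u * X) ^ 2)
    with ((sin u * sin u + cos u * cos u + 1 - 2 * cos u) * (X ^ 2 + Y ^ 2)) by ring.
  rewrite H. ring.
Qed.

Lemma one_minus_cos_ge (h : R) : Rabs h <= 1 -> h ^ 2 / 3 <= 1 - cos h.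
Proof.
  intros Hh.
  assert (Hpos : forall x, 0 <= x <= 1 -> x ^ 2 / 3 <= 1 - cos x).
  { intros x Hx. destruct (Req_dec x 0) as [->|Hx0]; [rewrite cos_0; lra|].
    replace (cos x) with (cos (2 * (x / 2))) by (f_equal; field). rewrite cos_2a_sin.
    pose proof (sin_ge_mul_cos (x / 2) ltac:(lra)) as H1.
    pose proof (sin2_cos2 (x / 2)) as H. unfold Rsqr in H.
    pose proof PI2_3_2. pose proof (sin_lt_x (x / 2) ltac:(lra)) as Hs.
    assert (Hs0 : 0 <= sin (x / 2)) by (apply sin_ge_0; lra).
    assert (Hc0 : 0 <= cos (x / 2)) by (apply cos_ge_0; lra).
    set (s := sin (x / 2)) in *. set (c := cos (x / 2)) in *.
    nra. }
  destruct (Rle_lt_dec 0 h) as [H0|H0].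
  - apply Hpos. rewrite Rabs_right in Hh; lra.
  - rewrite <- cos_neg. replace (h ^ 2) with ((- h) ^ 2) by ring. apply Hpos.
    rewrite Rabs_left in Hh; lra.
Qed.

(** The indicator of [[1, m]]; starting at 1 makes it vanish at 0, as [wnrm2_difference]
    requires. *)
Definition box (m i : nat) : R := if le_dec 1 i then if le_dec i m then 1 else 0 else 0.

Lemma box_zero (m i : nat) : (S m <= i)%nat -> box m i = 0.
Proof. intros H. unfold box. destruct (le_dec 1 i), (le_dec i m); try lra; lia. Qed.

Lemma box_bound (m i : nat) : 0 <= box m i <= 1.
Proof. unfold box. destruct (le_dec 1 i), (le_dec i m); lra. Qed.

Lemma box_variation (m : nat) :
  lsum (seq 0 (S m)) (fun i => Rabs (box m i - box m (S i))) <= 2.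
Proof.
  apply Rle_trans with (lsum (seq 0 (S m)) (fun i =>
    (if Nat.eq_dec i 0 then 1 else 0) + (if Nat.eq_dec i m then 1 else 0))).
  - apply lsum_le. intros i _. unfold box.
    destruct (le_dec 1 i), (le_dec i m), (le_dec 1 (S i)), (le_dec (S i) m), (Nat.eq_dec i 0), (Nat.eq_dec i m);
      try lia; unfold Rabs; destruct Rcase_abs; lra.
  - rewrite lsum_plus. pose proof (lsum_single (S m) 0 1 ltac:(lra)).
    pose proof (lsum_single (S m) m 1 ltac:(lra)). lra.
Qed.

Lemma corr_box_0 (m : nat) : corr (box m) (S m) 0 = INR m.
Proof.
  unfold corr. rewrite <- cons_seq. cbn [lsum fold_right].
  fold (lsum (seq 1 m) (fun i => box m i * box m (i + 0)%nat)).
  rewrite (lsum_ext (seq 1 m) _ (fun _ => 1)).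
  - rewrite lsum_const, length_seq. unfold box at 1. destruct (le_dec 1 0); [lia|]. lra.
  - intros i Hi. apply in_seq in Hi. rewrite Nat.add_0_r. unfold box.
    destruct (le_dec 1 i), (le_dec i m); try lra; lia.
Qed.

Lemma corr_box_lipschitz (m d : nat) : Rabs (corr (box m) (S m) d - INR m) <= 2 * INR d.
Proof.
  rewrite <- (corr_box_0 m). rewrite (Rmult_comm 2), <- (Rmult_1_l 2).
  apply corr_lipschitz.
  - intros i Hi. apply box_zero; auto.
  - intros i. pose proof (box_bound m i). apply Rabs_le; lra.
  - apply box_variation.
Qed.

Lemma corr_box_nonneg (m d : nat) : 0 <= corr (box m) (S m) d.
Proof.
  apply lsum_nonneg. intros i _. pose proof (box_bound m i). pose proof (box_bound m (i + d)).
  apply Rmult_le_pos; lra.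
Qed.

(* Up to a phase, [box m] gives the geometric sum, which times [1 - e^(iu)] is bounded by [2]. *)
Lemma wnrm2_box_decay (m : nat) (u : R) : 0 < Rabs u <= 1 -> wnrm2 (box m) (S m) u <= 6 / u ^ 2.
Proof.
  intros Hu. pose proof (one_minus_cos_ge u ltac:(lra)) as Hc.
  assert (Hu2 : 0 < u ^ 2).
  { assert (u <> 0) by (intros ->; rewrite Rabs_R0 in Hu; lra). apply Rsqr_pos_lt in H. unfold Rsqr in H. simpl; lra. }
  pose proof (wnrm2_difference (box m) (S m) u) as H.
  assert (Hb0 : box m 0 = 0) by (unfold box; destruct (le_dec 1 0); [lia|auto]).
  specialize (H Hb0 (box_zero m (S m) (le_n _))).
  assert (H4 : wnrm2 (fun i => box m (S i) - box m i) (S m) u <= 4).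
  { assert (Hf : forall f : nat -> R,
       lsum (seq 0 (S m)) (fun i => (box m (S i) - box m i) * f i) = if Nat.eq_dec m 0 then 0 else f 0%nat - f m).
    { intros f. destruct (Nat.eq_dec m 0) as [->|Hm].
      - simpl. unfold box; simpl. destruct (le_dec 1 1), (le_dec 1 0); try lia; lra.
      - rewrite lsum_seq_S. destruct m as [|m']; [lia|]. rewrite <- cons_seq. cbn [lsum fold_right].
        fold (lsum (seq 1 m') (fun i => (box (S m') (S i) - box (S m') i) * f i)).
        rewrite (lsum_ext (seq 1 m') _ (fun _ => 0)).
        + rewrite lsum_const. unfold box.
          destruct (le_dec 1 1), (le_dec 1 0), (le_dec 1 (S m')), (le_dec 1 (S (S m'))), (le_dec (S (S m')) (S m')), (le_dec (S m') (S m')); try lia; lra.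
        + intros i Hi. apply in_seq in Hi. unfold box.
          destruct (le_dec 1 i), (le_dec i (S m')), (le_dec 1 (S i)), (le_dec (S i) (S m')); try lia; lra. }
    unfold wnrm2. rewrite !Hf.
    destruct (Nat.eq_dec m 0); [simpl; lra|].
    set (x := INR m * u). simpl (INR 0). rewrite Rmult_0_l, cos_0, sin_0.
    pose proof (sin2_cos2 x) as Hsc. unfold Rsqr in Hsc. pose proof (COS_bound x).
    replace ((1 - cos x) ^ 2 + (0 - sin x) ^ 2) with (1 + (sin x * sin x + cos x * cos x) - 2 * cos x) by ring.
    lra. }
  apply le_div; auto. nra.
Qed.

Lemma wnrm2_box_le (m : nat) (u : R) : wnrm2 (box m) (S m) u <= INR m ^ 2.
Proof.
  rewrite (wnrm2_expand (box m) (S m) (S m)); [|apply box_zero|auto].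
  assert (E : INR m ^ 2 = wnrm2 (box m) (S m) 0).
  { unfold wnrm2. rewrite (lsum_ext _ (fun i => box m i * sin (INR i * 0)) (fun _ => 0)).
    - rewrite lsum_const, (lsum_ext _ (fun i => box m i * cos (INR i * 0)) (fun i => box m i * box m (i + 0)%nat)).
      + fold (corr (box m) (S m) 0). rewrite corr_box_0. simpl. ring.
      + intros i _. rewrite Rmult_0_r, cos_0, Nat.add_0_r. unfold box.
        destruct (le_dec 1 i), (le_dec i m); lra.
    - intros i _. rewrite Rmult_0_r, sin_0. lra. }
  rewrite E, (wnrm2_expand (box m) (S m) (S m) 0); [|apply box_zero|auto].
  apply Rplus_le_compat_l. apply Rmult_le_compat_l; [lra|].
  apply lsum_le. intros d _. apply Rmult_le_compat_l; [apply corr_box_nonneg|].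
  rewrite Rmult_0_r, cos_0. apply COS_bound.
Qed.

Lemma wnrm2_box_near_0 (m : nat) (u : R) : INR m * Rabs u <= 1 -> INR m ^ 2 / 4 <= wnrm2 (box m) (S m) u.
Proof.
  intros Hu. unfold wnrm2.
  assert (H : INR m / 2 <= lsum (seq 0 (S m)) (fun i => box m i * cos (INR i * u))).
  { rewrite <- (corr_box_0 m) at 1. unfold corr, Rdiv. rewrite <- lsum_scal_r. apply lsum_le.
    intros i _. rewrite Nat.add_0_r. unfold box. destruct (le_dec 1 i); [|lra]. destruct (le_dec i m); [|lra].
    assert (Hi : Rabs (INR i * u) <= 1).
    { rewrite Rabs_mult, (Rabs_right (INR i)) by (apply Rle_ge, pos_INR).
      eapply Rle_trans; [|exact Hu]. apply Rmult_le_compat_r; [apply Rabs_pos|apply le_INR; auto]. }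
    set (x := INR i * u) in *.
    assert (Hx : 1 / 2 <= cos x).
    { rewrite <- cos_PI3. replace (cos x) with (cos (Rabs x)).
      - pose proof PI2_3_2. pose proof (Rabs_pos x). apply cos_decr_1; lra.
      - unfold Rabs. destruct (Rcase_abs x); auto. apply cos_neg. }
    lra. }
  pose proof (pow2_ge_0 (lsum (seq 0 (S m)) (fun i => box m i * sin (INR i * u)))).
  pose proof (pos_INR m).
  assert ((INR m / 2) ^ 2 <= (lsum (seq 0 (S m)) (fun i => box m i * cos (INR i * u))) ^ 2) by (apply pow_incr; lra).
  lra.
Qed.

(** * A kernel of fixed sign away from zero, and its coarse companion *)

Section Kernel.
Variable n : nat.
Hypothesis Hn : (6 <= n)%nat.

Let HnR : 6 <= INR n.
Proof. apply le_IZR_INR; lia. Qed.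

(** A tent is used because its differences are [1] or [-1] on its support: their energy [2n] is
    small against the energy of the tent, at least [n^3 / 2]. Hence the mean of [kerK] is at least
    [6/n^2 * n^3/2 - n = 2n]. *)
Definition tent (i : nat) : R := INR (Nat.min i (2 * n - i)).
Definition step (i : nat) : R := tent (S i) - tent i.

Lemma tent_zero (i : nat) : (2 * n <= i)%nat -> tent i = 0.
Proof. intros H. unfold tent. replace (Nat.min i (2 * n - i)) with 0%nat by lia. auto. Qed.

Lemma step_eq (i : nat) : step i = if lt_dec i n then 1 else if lt_dec i (2 * n) then -1 else 0.
Proof.
  unfold step, tent. destruct (lt_dec i n); [|destruct (lt_dec i (2 * n))].
  - replace (Nat.min (S i) (2 * n - S i)) with (S i) by lia.
    replace (Nat.min i (2 * n - i)) with i by lia. rewrite S_INR; ring.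
  - replace (Nat.min (S i) (2 * n - S i)) with (2 * n - S i)%nat by lia.
    replace (Nat.min i (2 * n - i)) with (S (2 * n - S i)) by lia. rewrite S_INR; ring.
  - replace (Nat.min (S i) (2 * n - S i)) with 0%nat by lia.
    replace (Nat.min i (2 * n - i)) with 0%nat by lia. simpl; ring.
Qed.

Lemma step_zero (i : nat) : (2 * n <= i)%nat -> step i = 0.
Proof. intros Hi. rewrite step_eq. destruct (lt_dec i n); [lia|]. destruct (lt_dec i (2 * n)); [lia|auto]. Qed.

Lemma corr_tent_0 : INR n ^ 3 / 2 <= corr tent (2 * n) 0 <= INR n ^ 3.
Proof.
  assert (E : corr tent (2 * n) 0 = lsum (seq 0 n) (fun i => INR i ^ 2 + (INR n - INR i) ^ 2)).
  { unfold corr. replace (2 * n)%nat with (n + n)%nat by lia. rewrite seq_app, lsum_app, lsum_plus. f_equal.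
    - apply lsum_ext. intros i Hi. apply in_seq in Hi. rewrite Nat.add_0_r. unfold tent.
      replace (Nat.min i (2 * n - i)) with i by lia. ring.
    - rewrite lsum_seq_shift. apply lsum_ext. intros i Hi. apply in_seq in Hi.
      rewrite Nat.add_0_r. unfold tent.
      replace (Nat.min (0 + n + i) (2 * n - (0 + n + i))) with (n - i)%nat by lia.
      rewrite minus_INR by lia. ring. }
  rewrite E. split.
  - replace (INR n ^ 3 / 2) with (INR (length (seq 0 n)) * (INR n ^ 2 / 2)) by (rewrite length_seq; field).
    apply lsum_ge_const. intros i _. pose proof (pow2_ge_0 (INR n - 2 * INR i)). lra.
  - replace (INR n ^ 3) with (INR (length (seq 0 n)) * (INR n ^ 2)) by (rewrite length_seq; ring).
    apply lsum_le_const. intros i Hi. apply in_seq in Hi. pose proof (pos_INR i).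
    pose proof (lt_INR i n ltac:(lia)). nra.
Qed.

Lemma corr_step_0 : corr step (2 * n) 0 = 2 * INR n.
Proof.
  unfold corr. rewrite (lsum_ext _ _ (fun _ => 1)).
  - rewrite lsum_const, length_seq, mult_INR. simpl; lra.
  - intros i Hi. apply in_seq in Hi. rewrite Nat.add_0_r, step_eq.
    destruct (lt_dec i n); [lra|]. destruct (lt_dec i (2 * n)); [lra|lia].
Qed.

(** The Fourier coefficients of [kerK], as [1 - cos u] times the tent transform is half the
    transform of [step]. *)
Definition coefK (d : nat) : R := 6 / INR n ^ 2 * corr tent (2 * n) d - / 2 * corr step (2 * n) d.

(* Nonpositive for [6 / n <= |u| <= pi], while its mean value [coefK 0] is positive. *)
Definition kerK (u : R) : R := (6 / INR n ^ 2 - (1 - cos u)) * wnrm2 tent (2 * n) u.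

Lemma kerK_expand (u : R) :
  kerK u = coefK 0 + 2 * lsum (seq 1 (2 * n - 1)) (fun d => coefK d * cos (INR d * u)).
Proof.
  unfold kerK. pose proof (wnrm2_difference tent (2 * n) u) as H.
  rewrite (tent_zero (2 * n)) in H by lia.
  assert (H0 : tent 0 = 0) by (unfold tent; simpl; auto). specialize (H H0 eq_refl).
  fold step in H.
  change (fun i : nat => tent (S i) - tent i) with step in H.
  replace ((6 / INR n ^ 2 - (1 - cos u)) * wnrm2 tent (2 * n) u)
    with (6 / INR n ^ 2 * wnrm2 tent (2 * n) u - / 2 * wnrm2 step (2 * n) u) by (rewrite H; field; lra).
  rewrite (wnrm2_expand tent (2 * n) (2 * n)), (wnrm2_expand step (2 * n) (2 * n)); auto using tent_zero, step_zero.
  unfold coefK.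
  rewrite (lsum_ext _ (fun d => (6 / INR n ^ 2 * corr tent (2 * n) d - / 2 * corr step (2 * n) d) * cos (INR d * u))
    (fun d => 6 / INR n ^ 2 * (corr tent (2 * n) d * cos (INR d * u)) - / 2 * (corr step (2 * n) d * cos (INR d * u))))
    by (intros; ring).
  rewrite lsum_minus, !lsum_scal. ring.
Qed.

Lemma coefK_0 : 2 * INR n <= coefK 0 <= 5 * INR n.
Proof.
  unfold coefK. rewrite corr_step_0. pose proof corr_tent_0 as H.
  assert (H6 : 0 < 6 / INR n ^ 2) by (apply Rdiv_lt_0_compat; [lra|apply pow_lt; lra]).
  assert (E : 6 / INR n ^ 2 * INR n ^ 3 = 6 * INR n) by (field; lra).
  split.
  - apply Rle_trans with (6 / INR n ^ 2 * (INR n ^ 3 / 2) - / 2 * (2 * INR n)); [lra|].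
    apply Rplus_le_compat_r. apply Rmult_le_compat_l; lra.
  - apply Rle_trans with (6 / INR n ^ 2 * INR n ^ 3 - / 2 * (2 * INR n)); [|lra].
    apply Rplus_le_compat_r. apply Rmult_le_compat_l; lra.
Qed.

Lemma coefK_bound (d : nat) : Rabs (coefK d) <= 7 * INR n.
Proof.
  pose proof (corr_le tent (2 * n) d tent_zero) as H1. pose proof (corr_le step (2 * n) d step_zero) as H2.
  rewrite corr_step_0 in H2. pose proof corr_tent_0 as H.
  assert (H6 : 0 < 6 / INR n ^ 2) by (apply Rdiv_lt_0_compat; [lra|apply pow_lt; lra]).
  assert (E : 6 / INR n ^ 2 * INR n ^ 3 = 6 * INR n) by (field; lra).
  assert (H3 : 6 / INR n ^ 2 * Rabs (corr tent (2 * n) d) <= 6 / INR n ^ 2 * INR n ^ 3) by (apply Rmult_le_compat_l; lra).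
  unfold coefK. eapply Rle_trans; [apply Rabs_triang|].
  rewrite Rabs_Ropp, !Rabs_mult, (Rabs_right (6 / INR n ^ 2)), (Rabs_right (/ 2)) by lra. lra.
Qed.

Lemma coefK_lipschitz (d : nat) : Rabs (coefK d - coefK 0) <= 14 * INR d.
Proof.
  assert (H1 : Rabs (corr tent (2 * n) d - corr tent (2 * n) 0) <= INR d * (INR n * (2 * INR n))).
  { apply corr_lipschitz; [apply tent_zero| |].
    - intros i. unfold tent. rewrite Rabs_right by (apply Rle_ge, pos_INR). apply le_INR. lia.
    - replace (2 * INR n) with (INR (length (seq 0 (2 * n))) * 1) by (rewrite length_seq, mult_INR; simpl; ring).
      apply lsum_le_const. intros i _. rewrite Rabs_minus_sym. fold (step i). rewrite step_eq.
      destruct (lt_dec i n); [|destruct (lt_dec i (2 * n))]; unfold Rabs; destruct Rcase_abs; lra. }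
  assert (H2 : Rabs (corr step (2 * n) d - corr step (2 * n) 0) <= INR d * (1 * 3)).
  { apply corr_lipschitz; [apply step_zero| |].
    - intros i. rewrite step_eq.
      destruct (lt_dec i n); [|destruct (lt_dec i (2 * n))]; unfold Rabs; destruct Rcase_abs; lra.
    - apply Rle_trans with (lsum (seq 0 (2 * n)) (fun i =>
        (if Nat.eq_dec i (n - 1) then 2 else 0) + (if Nat.eq_dec i (2 * n - 1) then 1 else 0))).
      + apply lsum_le. intros i _. rewrite !step_eq.
        destruct (lt_dec i n), (lt_dec i (2 * n)), (lt_dec (S i) n), (lt_dec (S i) (2 * n)),
          (Nat.eq_dec i (n - 1)), (Nat.eq_dec i (2 * n - 1)); try lia; unfold Rabs; destruct Rcase_abs; lra.
      + rewrite lsum_plus. pose proof (lsum_single (2 * n) (n - 1) 2 ltac:(lra)).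
        pose proof (lsum_single (2 * n) (2 * n - 1) 1 ltac:(lra)). lra. }
  unfold coefK.
  replace (_ - _) with (6 / INR n ^ 2 * (corr tent (2 * n) d - corr tent (2 * n) 0)
    - / 2 * (corr step (2 * n) d - corr step (2 * n) 0)) by ring.
  assert (H6 : 0 < 6 / INR n ^ 2) by (apply Rdiv_lt_0_compat; [lra|apply pow_lt; lra]).
  eapply Rle_trans; [apply Rabs_triang|].
  rewrite Rabs_Ropp, !Rabs_mult, (Rabs_right (6 / INR n ^ 2)), (Rabs_right (/ 2)) by lra.
  assert (H3 : 6 / INR n ^ 2 * Rabs (corr tent (2 * n) d - corr tent (2 * n) 0) <= 12 * INR d).
  { apply Rle_trans with (6 / INR n ^ 2 * (INR d * (INR n * (2 * INR n)))); [apply Rmult_le_compat_l; lra|].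
    right. field. lra. }
  pose proof (pos_INR d). lra.
Qed.

Lemma kerK_nonpos (u : R) : 6 / INR n <= Rabs u <= PI -> kerK u <= 0.
Proof.
  intros Hu. unfold kerK. pose proof (wnrm2_nonneg tent (2 * n) u).
  assert (H0 : 0 < 6 / INR n) by (apply Rdiv_lt_0_compat; lra).
  assert (H1 : 6 / INR n <= 1).
  { apply div_le; lra. }
  pose proof (one_minus_cos_ge (6 / INR n)) as Hc. rewrite Rabs_right in Hc by lra. specialize (Hc H1).
  assert (Hcu : cos u <= cos (6 / INR n)).
  { replace (cos u) with (cos (Rabs u)).
    - pose proof PI2_3_2. apply cos_decr_1; lra.
    - unfold Rabs. destruct (Rcase_abs u); auto. apply cos_neg. }
  replace ((6 / INR n) ^ 2 / 3) with (2 * (6 / INR n ^ 2)) in Hc by (field; lra).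
  assert (H6 : 0 < 6 / INR n ^ 2) by (apply Rdiv_lt_0_compat; [lra|apply pow_lt; lra]).
  nra.
Qed.

Variable n0 : nat.
Hypothesis Hn0 : (1 <= n0)%nat /\ (7 * n0 <= n)%nat.

Let Hn0R : 1 <= INR n0 /\ 7 * INR n0 <= INR n.
Proof.
  split; [apply le_IZR_INR; lia|].
  replace 7 with (INR 7) by (simpl; lra). rewrite <- mult_INR. apply le_INR; lia.
Qed.

(** A Fejer kernel of width about [1 / n0], scaled to have the mean value of [kerK], so that the
    difference of the two has no constant term. *)
Definition ker0 (u : R) : R := coefK 0 / INR n0 * wnrm2 (box n0) (S n0) u.
Definition coefD (d : nat) : R := coefK d - coefK 0 / INR n0 * corr (box n0) (S n0) d.

Lemma kernel_difference (u : R) :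
  kerK u - ker0 u = 2 * lsum (seq 1 (2 * n - 1)) (fun d => coefD d * cos (INR d * u)).
Proof.
  rewrite kerK_expand. unfold ker0.
  rewrite (wnrm2_expand (box n0) (S n0) (2 * n)); [|apply box_zero|lia].
  rewrite corr_box_0. unfold coefD.
  rewrite (lsum_ext _ (fun d => (coefK d - coefK 0 / INR n0 * corr (box n0) (S n0) d) * cos (INR d * u))
    (fun d => coefK d * cos (INR d * u) - coefK 0 / INR n0 * (corr (box n0) (S n0) d * cos (INR d * u))))
    by (intros; ring).
  rewrite lsum_minus, lsum_scal. field. lra.
Qed.

(** At low frequencies both kernels have coefficients close to the common mean. This replaces the
    saving that the exponential sums fail to give there. *)
Lemma coefD_low (d : nat) : Rabs (coefD d) <= 3 * coefK 0 * INR d / INR n0.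
Proof.
  unfold coefD. pose proof coefK_0 as H0. pose proof (coefK_lipschitz d) as H1.
  pose proof (corr_box_lipschitz n0 d) as H2. pose proof (pos_INR d) as Hd.
  replace (coefK d - coefK 0 / INR n0 * corr (box n0) (S n0) d)
    with ((coefK d - coefK 0) - coefK 0 / INR n0 * (corr (box n0) (S n0) d - INR n0)) by (field; lra).
  assert (Hq : 14 <= coefK 0 / INR n0).
  { apply le_div; lra. }
  eapply Rle_trans; [apply Rabs_triang|]. rewrite Rabs_Ropp, Rabs_mult, (Rabs_right (coefK 0 / INR n0)) by lra.
  replace (3 * coefK 0 * INR d / INR n0) with (3 * (coefK 0 / INR n0) * INR d) by (field; lra).
  set (x := coefK 0 / INR n0) in *.
  assert (x * Rabs (corr (box n0) (S n0) d - INR n0) <= x * (2 * INR d)) by (apply Rmult_le_compat_l; lra).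
  assert (14 * INR d <= x * INR d) by (apply Rmult_le_compat_r; lra). lra.
Qed.

Lemma coefD_bound (d : nat) : Rabs (coefD d) <= 5 * coefK 0.
Proof.
  unfold coefD. pose proof coefK_0 as H0. pose proof (coefK_bound d) as H1.
  pose proof (corr_le (box n0) (S n0) d (fun i Hi => box_zero n0 i Hi)) as H2. rewrite corr_box_0 in H2.
  assert (Hq : 0 <= coefK 0 / INR n0).
  { apply Rle_mult_inv_pos; lra. }
  eapply Rle_trans; [apply Rabs_triang|]. rewrite Rabs_Ropp, Rabs_mult, (Rabs_right (coefK 0 / INR n0)) by lra.
  assert (coefK 0 / INR n0 * Rabs (corr (box n0) (S n0) d) <= coefK 0 / INR n0 * INR n0) by (apply Rmult_le_compat_l; lra).
  replace (coefK 0 / INR n0 * INR n0) with (coefK 0) in H by (field; lra). lra.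
Qed.

Lemma ker0_nonneg (u : R) : 0 <= ker0 u.
Proof.
  unfold ker0. pose proof coefK_0. apply Rmult_le_pos; [|apply wnrm2_nonneg].
  apply Rle_mult_inv_pos; lra.
Qed.

Lemma ker0_near_0 (u : R) : INR n0 * Rabs u <= 1 -> coefK 0 * INR n0 / 4 <= ker0 u.
Proof.
  intros Hu. unfold ker0. pose proof coefK_0. pose proof (wnrm2_box_near_0 n0 u Hu).
  replace (coefK 0 * INR n0 / 4) with (coefK 0 / INR n0 * (INR n0 ^ 2 / 4)) by (field; lra).
  apply Rmult_le_compat_l; auto. apply Rle_mult_inv_pos; lra.
Qed.

End Kernel.

(** * Mean values over a grid *)

(** Multiplication by [2 sin (pi m / N)] makes the sum telescope over a full period, and [0 < m < N]
    keeps this factor nonzero. *)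
Lemma grid_sum_zero (N m : nat) (c : R) : (0 < m < N)%nat ->
  lsum (seq 0 N) (fun l => cos (c + INR m * (2 * PI * INR l / INR N))) = 0.
Proof.
  intros Hm. assert (HN : 0 < INR N) by (apply lt_0_INR; lia).
  assert (Hm0 : 0 < INR m) by (apply lt_0_INR; lia). assert (HmN : INR m < INR N) by (apply lt_INR; lia).
  pose proof PI_RGT_0 as Hpi.
  set (a := PI * (INR m / INR N)).
  assert (Hr : 0 < INR m / INR N < 1).
  { split; [apply Rdiv_lt_0_compat; auto|]. apply (Rmult_lt_reg_r (INR N)); auto.
    unfold Rdiv. rewrite Rmult_assoc, Rinv_l; lra. }
  assert (Ha : 0 < sin a) by (apply sin_gt_0; unfold a; nra).
  assert (H : forall L, 2 * sin a * lsum (seq 0 L) (fun l => cos (c + INR m * (2 * PI * INR l / INR N)))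
    = sin (c + 2 * INR L * a - a) - sin (c - a)).
  { induction L as [|L IH]; [simpl; replace (c + 2 * 0 * a - a) with (c - a) by ring; ring|].
    rewrite lsum_seq_S, Rmult_plus_distr_l, IH, S_INR.
    replace (c + INR m * (2 * PI * INR L / INR N)) with (c + 2 * INR L * a) by (unfold a; field; lra).
    replace (c + 2 * (INR L + 1) * a - a) with (c + 2 * INR L * a + a) by ring.
    rewrite sin_plus, sin_minus. ring. }
  specialize (H N).
  replace (c + 2 * INR N * a - a) with (c - a + 2 * INR m * PI) in H by (unfold a; field; lra).
  rewrite sin_period in H. assert (Hz : 2 * sin a <> 0) by lra.
  apply (Rmult_eq_reg_l (2 * sin a)); auto. lra.
Qed.

Lemma grid_orthogonality (N j j' : nat) (a b u0 : R) : (1 <= j)%nat -> (1 <= j')%nat -> (j + j' < N)%nat ->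
  lsum (seq 0 N) (fun l => cos (a - INR j * (u0 + 2 * PI * INR l / INR N))
                          * cos (b - INR j' * (u0 + 2 * PI * INR l / INR N)))
  = if Nat.eq_dec j j' then INR N / 2 * cos (a - b) else 0.
Proof.
  intros Hj Hj' HN.
  set (u := fun l => 2 * PI * INR l / INR N).
  assert (Hsub : forall k k' e, (k < k' < N)%nat ->
    lsum (seq 0 N) (fun l => cos (e - (INR k - INR k') * (u0 + u l))) = 0).
  { intros k k' e Hk. rewrite <- (grid_sum_zero N (k' - k) (e + (INR k' - INR k) * u0)) by lia.
    apply lsum_ext. intros l _. f_equal. rewrite minus_INR by lia. unfold u. ring. }
  assert (Hadd : lsum (seq 0 N) (fun l => cos (a + b - (INR j + INR j') * (u0 + u l))) = 0).
  { rewrite <- (grid_sum_zero N (j + j') (- (a + b - (INR j + INR j') * u0))) by lia.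
    apply lsum_ext. intros l _. rewrite <- cos_neg. f_equal. rewrite plus_INR. unfold u. ring. }
  rewrite (lsum_ext _ _ (fun l => / 2 * cos (a - b - (INR j - INR j') * (u0 + u l))
     + / 2 * cos (a + b - (INR j + INR j') * (u0 + u l)))).
  2:{ intros l _. fold (u l).
      replace (a - b - (INR j - INR j') * (u0 + u l)) with ((a - INR j * (u0 + u l)) - (b - INR j' * (u0 + u l))) by ring.
      replace (a + b - (INR j + INR j') * (u0 + u l)) with ((a - INR j * (u0 + u l)) + (b - INR j' * (u0 + u l))) by ring.
      set (X := a - INR j * (u0 + u l)). set (Y := b - INR j' * (u0 + u l)). clearbody X Y.
      rewrite cos_minus, cos_plus. field. }
  rewrite lsum_plus, !lsum_scal, Hadd.
  destruct (Nat.eq_dec j j') as [->|Hne].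
  - rewrite (lsum_ext _ _ (fun _ => cos (a - b))) by (intros; f_equal; ring).
    rewrite lsum_const, length_seq. field.
  - destruct (lt_dec j j') as [H|H].
    + rewrite Hsub by lia. ring.
    + rewrite (lsum_ext _ _ (fun l => cos (- (a - b) - (INR j' - INR j) * (u0 + u l)))).
      * rewrite Hsub by lia. ring.
      * intros l _. rewrite <- cos_neg. f_equal. ring.
Qed.

Lemma lsum_diag (l : list nat) (a : nat) (f : nat -> R) : NoDup l -> In a l ->
  lsum l (fun y => if Nat.eq_dec a y then f y else 0) = f a.
Proof.
  induction 1 as [|b l Hb Hl IH]; simpl; [tauto|]. intros [->|Hin].
  - destruct (Nat.eq_dec a a); [|contradiction].
    rewrite (lsum_ext _ _ (fun _ => 0)).
    + fold (lsum l (fun _ : nat => 0)). rewrite lsum_const. lra.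
    + intros y Hy. destruct (Nat.eq_dec a y); auto. subst; contradiction.
  - destruct (Nat.eq_dec a b); [subst; contradiction|]. rewrite IH; auto. lra.
Qed.

(** The mean square over the grid is computed exactly: all frequencies are below [D], and
    [2 * D <= N] keeps sums of two of them below [N], so there is no aliasing. *)
Lemma grid_parseval {A : Type} (P : list A) (x : A -> R) (dj : nat -> R) (D N : nat) (u0 : R) :
  (2 * D <= N)%nat ->
  lsum (seq 0 N) (fun l => (2 * lsum (seq 1 (D - 1)) (fun j => dj j *
      lsum P (fun p => cos (INR j * (x p - (u0 + 2 * PI * INR l / INR N)))))) ^ 2)
  = 2 * INR N * lsum (seq 1 (D - 1)) (fun j => dj j ^ 2 * nrm2 P (fun p => INR j * x p)).
Proof.
  intros HD.
  set (F := fun j l => lsum P (fun p => cos (INR j * (x p - (u0 + 2 * PI * INR l / INR N))))).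
  assert (HF : forall j j', In j (seq 1 (D - 1)) -> In j' (seq 1 (D - 1)) ->
    lsum (seq 0 N) (fun l => F j l * F j' l)
     = if Nat.eq_dec j j' then INR N / 2 * nrm2 P (fun p => INR j * x p) else 0).
  { intros j j' Hj Hj'. apply in_seq in Hj, Hj'. unfold F.
    rewrite (lsum_ext _ _ (fun l => lsum P (fun p => lsum P (fun p' =>
      cos (INR j * x p - INR j * (u0 + 2 * PI * INR l / INR N)) * cos (INR j' * x p' - INR j' * (u0 + 2 * PI * INR l / INR N)))))).
    2:{ intros l _. rewrite lsum_mul. apply lsum_ext. intros p _. apply lsum_ext. intros p' _. f_equal; f_equal; ring. }
    rewrite lsum_swap.
    rewrite (lsum_ext P _ (fun p => lsum P (fun p' => if Nat.eq_dec j j' then INR N / 2 * cos (INR j * x p - INR j' * x p') else 0))).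
    2:{ intros p _. rewrite lsum_swap. apply lsum_ext. intros p' _. apply grid_orthogonality; lia. }
    destruct (Nat.eq_dec j j') as [<-|].
    - rewrite nrm2_double, <- lsum_scal. apply lsum_ext. intros p _. apply lsum_scal.
    - rewrite (lsum_ext P _ (fun _ => 0)); [rewrite lsum_const; lra|].
      intros p _. rewrite lsum_const. lra. }
  rewrite (lsum_ext _ _ (fun l => lsum (seq 1 (D - 1)) (fun j => lsum (seq 1 (D - 1)) (fun j' =>
     4 * (dj j * dj j') * (F j l * F j' l))))).
  2:{ intros l _.
      transitivity (4 * (lsum (seq 1 (D - 1)) (fun j => dj j * F j l) * lsum (seq 1 (D - 1)) (fun j => dj j * F j l)));
        [unfold F; ring|].
      rewrite lsum_mul, <- lsum_scal. apply lsum_ext. intros j _. rewrite <- lsum_scal. apply lsum_ext. intros; ring. }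
  rewrite lsum_swap, <- lsum_scal. apply lsum_ext. intros j Hj. rewrite lsum_swap.
  rewrite (lsum_ext _ _ (fun j' => if Nat.eq_dec j j' then 4 * (dj j * dj j') * (INR N / 2 * nrm2 P (fun p => INR j * x p)) else 0)).
  - rewrite (lsum_diag _ j (fun j' => 4 * (dj j * dj j') * (INR N / 2 * nrm2 P (fun p => INR j * x p)))); auto.
    + field. + apply seq_NoDup.
  - intros j' Hj'. rewrite lsum_scal, HF by auto. destruct (Nat.eq_dec j j'); auto. ring.
Qed.

(** * The large sieve at logarithms of integers *)

Lemma sum_inverse_squares (N a : nat) :
  lsum (seq 0 N) (fun i => if Nat.eq_dec i a then 0 else / (INR i - INR a) ^ 2) <= 4.
Proof.
  assert (Ht : forall k, 0 < k -> 1 <= k -> / k ^ 2 <= 2 / k - 2 / (k + 1)).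
  { intros k Hk Hk1. replace (2 / k - 2 / (k + 1)) with (2 / (k * (k + 1))) by (field; lra).
    apply (Rmult_le_reg_r (k ^ 2 * (k + 1))); [apply Rmult_lt_0_compat; [apply pow_lt|]; lra|].
    replace (/ k ^ 2 * (k ^ 2 * (k + 1))) with (k + 1) by (field; lra).
    replace (2 / (k * (k + 1)) * (k ^ 2 * (k + 1))) with (2 * k) by (field; lra). lra. }
  assert (H1 : forall n, (n <= a)%nat ->
    lsum (seq 0 n) (fun i => if Nat.eq_dec i a then 0 else / (INR i - INR a) ^ 2) <= 2 / (INR a - INR n + 1)).
  { induction n as [|n IH]; intros Hn.
    - simpl. pose proof (pos_INR a). apply Rmult_le_pos; [lra|]. left. apply Rinv_0_lt_compat. lra.
    - rewrite lsum_seq_S. specialize (IH ltac:(lia)). destruct (Nat.eq_dec n a); [lia|].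
      pose proof (le_INR (S n) a Hn) as Hna. rewrite S_INR in *.
      specialize (Ht (INR a - INR n) ltac:(lra) ltac:(lra)).
      replace ((INR n - INR a) ^ 2) with ((INR a - INR n) ^ 2) by ring.
      replace (INR a - (INR n + 1) + 1) with (INR a - INR n) by ring. lra. }
  assert (H2 : forall n,
    lsum (seq 0 (S a + n)) (fun i => if Nat.eq_dec i a then 0 else / (INR i - INR a) ^ 2) <= 4 - 2 / (INR n + 1)).
  { induction n as [|n IH].
    - rewrite Nat.add_0_r, lsum_seq_S. destruct (Nat.eq_dec a a); [|contradiction].
      specialize (H1 a (le_n _)). replace (INR a - INR a + 1) with 1 in H1 by ring. simpl (INR 0). lra.
    - replace (S a + S n)%nat with (S (S a + n)) by lia. rewrite lsum_seq_S.
      destruct (Nat.eq_dec (S a + n) a); [lia|].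
      replace (INR (S a + n) - INR a) with (INR n + 1) by (rewrite plus_INR, S_INR; ring).
      pose proof (pos_INR n). specialize (Ht (INR n + 1) ltac:(lra) ltac:(lra)). rewrite S_INR. lra. }
  destruct (le_lt_dec N a) as [H|H].
  - specialize (H1 N H). apply le_INR in H. eapply Rle_trans; [exact H1|].
    apply div_le; lra.
  - replace N with (S a + (N - S a))%nat by lia. eapply Rle_trans; [apply H2|].
    pose proof (pos_INR (N - S a)).
    assert (0 < 2 / (INR (N - S a) + 1)) by (apply Rdiv_lt_0_compat; lra). lra.
Qed.

(** The lower bound is the spacing needed by the large sieve; the upper bound 1 puts the differences
    in the range of the decay estimate for [box]. *)
Lemma ln_gap (Z g g' : nat) : (Z < g <= 2 * Z)%nat -> (Z < g' <= 2 * Z)%nat -> g <> g' ->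
  Rabs (INR g - INR g') / (2 * INR Z) <= Rabs (ln (INR g) - ln (INR g')) <= 1.
Proof.
  assert (Hw : forall a b, (Z < a < b)%nat -> (b <= 2 * Z)%nat ->
    (INR b - INR a) / (2 * INR Z) <= ln (INR b) - ln (INR a) <= 1).
  { intros a b Hab Hb. assert (HZ : 0 < INR Z) by (apply lt_0_INR; lia).
    assert (Ha : INR Z < INR a) by (apply lt_INR; lia). assert (Hab' : INR a < INR b) by (apply lt_INR; lia).
    assert (Hb' : INR b <= 2 * INR Z) by (apply INR_le_scal; lia).
    assert (E1 : ln (INR b) - ln (INR a) = - ln (INR a / INR b)).
    { unfold Rdiv. rewrite ln_mult, ln_Rinv; try lra. apply Rinv_0_lt_compat; lra. }
    assert (E2 : ln (INR b) - ln (INR a) = ln (INR b / INR a)).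
    { unfold Rdiv. rewrite ln_mult, ln_Rinv; try lra. apply Rinv_0_lt_compat; lra. }
    assert (Hln : forall y, 0 < y -> ln y <= y - 1).
    { intros y Hy. pose proof (exp_ineq1_le (ln y)) as H. rewrite exp_ln in H by auto. lra. }
    split.
    - rewrite E1. pose proof (Hln (INR a / INR b) ltac:(apply Rdiv_lt_0_compat; lra)) as H.
      assert ((INR b - INR a) / (2 * INR Z) <= (INR b - INR a) / INR b).
      { apply Rmult_le_compat_l; [lra|]. apply Rinv_le_contravar; lra. }
      replace (INR a / INR b - 1) with (- ((INR b - INR a) / INR b)) in H by (field; lra). lra.
    - rewrite E2. pose proof (Hln (INR b / INR a) ltac:(apply Rdiv_lt_0_compat; lra)) as H.
      assert (INR b / INR a <= 2).
      { apply div_le; lra. }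
      lra. }
  intros Hg Hg' Hne. assert (HZ : 0 < INR Z) by (apply lt_0_INR; lia).
  destruct (lt_dec g g') as [H|H].
  - specialize (Hw g g' ltac:(lia) ltac:(lia)). rewrite (Rabs_minus_sym (INR g)), (Rabs_minus_sym (ln (INR g))).
    pose proof (lt_INR g g' H). assert (0 <= (INR g' - INR g) / (2 * INR Z)) by (apply Rle_mult_inv_pos; lra).
    rewrite !Rabs_right by lra. exact Hw.
  - specialize (Hw g' g ltac:(lia) ltac:(lia)). pose proof (lt_INR g' g ltac:(lia)).
    assert (0 <= (INR g - INR g') / (2 * INR Z)) by (apply Rle_mult_inv_pos; lra).
    rewrite !Rabs_right by lra. exact Hw.
Qed.

(** Frequencies below [2Z] are majorised by a Fejer kernel of length [8Z], whose coefficients there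
    are at least [4Z]. Summed over pairs, one [g] contributes at most [64 Z^2] from the diagonal and
    [24 * 4 Z^2] from the spaced differences, [160 Z^2] in all; dividing by [8Z] gives 20. *)
Lemma large_sieve (Z : nat) (G : list nat) : (1 <= Z)%nat -> NoDup G ->
  (forall g, In g G -> (Z < g <= 2 * Z)%nat) ->
  lsum (seq 1 (2 * Z - 1)) (fun j => nrm2 G (fun g => INR j * ln (INR g))) <= 20 * INR Z * INR (length G).
Proof.
  intros HZ HG Hin. assert (HZR : 1 <= INR Z) by (apply le_IZR_INR; lia).
  set (m := (8 * Z)%nat). set (V := fun u => wnrm2 (box m) (S m) u).
  assert (HmR : INR m = 8 * INR Z) by (unfold m; rewrite mult_INR; simpl; lra).
  assert (Hrow : forall g, In g G -> lsum G (fun g' => V (ln (INR g) - ln (INR g'))) <= 160 * INR Z ^ 2).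
  { intros g Hg. pose proof (Hin g Hg) as Hgr.
    apply Rle_trans with (lsum G (fun g' => (if Nat.eq_dec g' g then 64 * INR Z ^ 2 else 0)
       + 24 * INR Z ^ 2 * (if Nat.eq_dec g' g then 0 else / (INR g' - INR g) ^ 2))).
    - apply lsum_le. intros g' Hg'. destruct (Nat.eq_dec g' g) as [->|Hne].
      + unfold V. pose proof (wnrm2_box_le m (ln (INR g) - ln (INR g))) as H. rewrite HmR in H. lra.
      + destruct (ln_gap Z g g' Hgr (Hin g' Hg') ltac:(auto)) as [H1 H2].
        set (u := ln (INR g) - ln (INR g')) in *.
        assert (Hd : 0 < Rabs (INR g - INR g')).
        { apply Rabs_pos_lt. intros H. apply Hne. apply INR_eq. lra. }
        assert (Hu0 : 0 < Rabs (INR g - INR g') / (2 * INR Z)) by (apply Rdiv_lt_0_compat; lra).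
        unfold V. pose proof (wnrm2_box_decay m u ltac:(lra)) as H3.
        assert (H4 : (Rabs (INR g - INR g') / (2 * INR Z)) ^ 2 <= u ^ 2).
        { rewrite <- (pow2_abs u). apply pow_incr; lra. }
        assert (H5 : 6 / u ^ 2 <= 6 / (Rabs (INR g - INR g') / (2 * INR Z)) ^ 2).
        { apply Rmult_le_compat_l; [lra|]. apply Rinv_le_contravar; auto. apply pow_lt; auto. }
        replace (6 / (Rabs (INR g - INR g') / (2 * INR Z)) ^ 2) with (24 * INR Z ^ 2 * / (Rabs (INR g - INR g')) ^ 2) in H5 by (field; lra).
        rewrite pow2_abs in H5. replace ((INR g - INR g') ^ 2) with ((INR g' - INR g) ^ 2) in H5 by ring. lra.
    - apply Rle_trans with (lsum (seq 0 (S (2 * Z))) (fun g' => (if Nat.eq_dec g' g then 64 * INR Z ^ 2 else 0)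
       + 24 * INR Z ^ 2 * (if Nat.eq_dec g' g then 0 else / (INR g' - INR g) ^ 2))).
      + apply lsum_incl; auto.
        * intros x Hx. apply Hin in Hx. apply in_seq. lia.
        * intros x _. destruct (Nat.eq_dec x g); [nra|].
          assert (0 < / (INR x - INR g) ^ 2).
          { apply Rinv_0_lt_compat. assert (INR x - INR g <> 0) by (intros H; apply n; apply INR_eq; lra).
            apply Rsqr_pos_lt in H. unfold Rsqr in H. simpl; lra. }
          assert (0 < INR Z ^ 2) by (apply pow_lt; lra). nra.
      + rewrite lsum_plus, lsum_scal.
        pose proof (lsum_single (S (2 * Z)) g (64 * INR Z ^ 2) ltac:(nra)).
        pose proof (sum_inverse_squares (S (2 * Z)) g).
        assert (0 < INR Z ^ 2) by (apply pow_lt; lra). nra. }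
  assert (Htot : lsum G (fun g => lsum G (fun g' => V (ln (INR g) - ln (INR g')))) <= INR (length G) * (160 * INR Z ^ 2))
    by (apply lsum_le_const; exact Hrow).
  assert (Hexp : lsum G (fun g => lsum G (fun g' => V (ln (INR g) - ln (INR g'))))
    = INR m * INR (length G) ^ 2 + 2 * lsum (seq 1 m) (fun d => corr (box m) (S m) d * nrm2 G (fun g => INR d * ln (INR g)))).
  { rewrite (lsum_ext G _ (fun g => lsum G (fun g' => INR m + 2 * lsum (seq 1 m) (fun d => corr (box m) (S m) d * cos (INR d * (ln (INR g) - ln (INR g'))))))).
    2:{ intros g _. apply lsum_ext. intros g' _. unfold V.
        rewrite (wnrm2_expand (box m) (S m) (S m)); [|apply box_zero|auto].
        rewrite corr_box_0. replace (S m - 1)%nat with m by lia. auto. }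
    rewrite (lsum_ext G _ (fun g => INR (length G) * INR m + 2 * lsum (seq 1 m) (fun d => corr (box m) (S m) d * lsum G (fun g' => cos (INR d * (ln (INR g) - ln (INR g'))))))).
    2:{ intros g _. rewrite lsum_plus, lsum_const, lsum_scal, lsum_swap. do 2 f_equal.
        apply lsum_ext. intros d _. apply lsum_scal. }
    rewrite lsum_plus, lsum_const, lsum_scal, lsum_swap. f_equal; [ring|]. f_equal.
    apply lsum_ext. intros d _. rewrite lsum_scal. f_equal. rewrite nrm2_double.
    apply lsum_ext. intros g _. apply lsum_ext. intros g' _. f_equal. ring. }
  assert (Hlow : 4 * INR Z * lsum (seq 1 (2 * Z - 1)) (fun j => nrm2 G (fun g => INR j * ln (INR g)))
     <= lsum (seq 1 m) (fun d => corr (box m) (S m) d * nrm2 G (fun g => INR d * ln (INR g)))).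
  { rewrite <- lsum_scal.
    apply Rle_trans with (lsum (seq 1 (2 * Z - 1)) (fun d => corr (box m) (S m) d * nrm2 G (fun g => INR d * ln (INR g)))).
    - apply lsum_le. intros d Hd. apply in_seq in Hd. apply Rmult_le_compat_r; [apply nrm2_nonneg|].
      pose proof (corr_box_lipschitz m d) as H. apply Rabs_le_inv in H.
      assert (INR d <= 2 * INR Z) by (apply INR_le_scal; lia). lra.
    - apply lsum_incl; [apply seq_NoDup| |].
      + intros x Hx. apply in_seq in Hx. apply in_seq. unfold m. lia.
      + intros d _. apply Rmult_le_pos; [apply corr_box_nonneg|apply nrm2_nonneg]. }
  rewrite Hexp in Htot.
  apply (Rmult_le_reg_l (8 * INR Z)); [lra|]. nra.
Qed.

(** * Smooth numbers in almost all short intervals *)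

Open Scope nat_scope.

Definition nprod (t : list nat) : nat := fold_right Nat.mul 1 t.

Lemma divide_nprod (t : list nat) (x : nat) : In x t -> Nat.divide x (nprod t).
Proof.
  induction t as [|a t IH]; simpl; [tauto|]. intros [->|H].
  - apply Nat.divide_factor_l.
  - apply Nat.divide_mul_r; auto.
Qed.

Lemma nprod_bounds (t : list nat) (M a : nat) : (forall x, In x t -> M < x <= M + a) ->
  M ^ length t <= nprod t <= (M + a) ^ length t.
Proof.
  induction t as [|x t IH]; simpl; intros H; [lia|].
  specialize (IH (fun y Hy => H y (or_intror Hy))). specialize (H x (or_introl eq_refl)).
  split; apply Nat.mul_le_mono; lia.
Qed.

Lemma nprod_gt (t : list nat) (M a : nat) : 1 <= length t -> 1 <= M -> (forall x, In x t -> M < x <= M + a) ->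
  M ^ length t < nprod t.
Proof.
  intros Hl HM H. destruct t as [|x t]; simpl in *; [lia|].
  pose proof (nprod_bounds t M a (fun y Hy => H y (or_intror Hy))) as [H1 _].
  specialize (H x (or_introl eq_refl)). pose proof (pow_ge_1 M (length t) HM). nia.
Qed.

Lemma nprod_smooth (t : list nat) (y : nat) : (forall x, In x t -> 1 <= x <= y) -> smooth y (nprod t).
Proof.
  induction t as [|x t IH]; simpl; intros H.
  - intros p Hp Hd. apply Nat.divide_1_r in Hd. apply nprime_ge2 in Hp. lia.
  - apply smooth_mul; [apply smooth_le, H; auto|apply IH; auto].
Qed.

Lemma pow_sum_bound (M a r j : nat) : j <= r -> 2 * r * a <= M -> (M + a) ^ j * (M - j * a) <= M ^ j * M.
Proof.
  intros Hj Hr. induction j as [|j IH]; [simpl; lia|].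
  specialize (IH ltac:(lia)). rewrite !Nat.pow_succ_r'.
  assert (Hja : S j * a <= r * a) by (apply Nat.mul_le_mono_r; lia).
  assert (E : (M + a) * (M - S j * a) <= M * (M - j * a)).
  { assert (S j * a = j * a + a) by lia. set (x := j * a) in *. rewrite H.
    assert (x + a <= M) by lia. destruct (Nat.le_exists_sub (x + a) M H0) as [y [-> _]].
    replace (y + (x + a) - (x + a)) with y by lia. replace (y + (x + a) - x) with (y + a) by lia. nia. }
  apply Nat.le_trans with ((M + a) ^ j * (M * (M - j * a))).
  - rewrite (Nat.mul_comm (M + a)), <- Nat.mul_assoc. apply Nat.mul_le_mono_l; auto.
  - replace ((M + a) ^ j * (M * (M - j * a))) with (M * ((M + a) ^ j * (M - j * a))) by ring.
    replace (M * M ^ j * M) with (M * (M ^ j * M)) by ring. apply Nat.mul_le_mono_l; auto.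
Qed.

(** Products of [r] integers from [(M, M + M/(2r)]] fall in [(Z, 2Z]] and are [2M]-smooth. There are
    about [(M / (4r))^r] tuples, and a product [g] arises from at most [d(g)^r] of them. *)
Lemma many_smooth_numbers (r mu : nat) : 1 <= r -> 1 <= mu -> exists w0, forall w, w0 <= w ->
  let M := w ^ mu in let Z := M ^ r in
  Z <= w * length (filter (fun g => holdsb (smooth (2 * M) g)) (seq (S Z) Z)).
Proof.
  intros Hr Hmu. destruct (divisor_bound (2 * r * (mu * r))) as [C HC].
  exists (4 * r + (4 * r) ^ (2 * r) * (2 * C + 1)). intros w Hw M Z.
  set (G := filter _ _).
  assert (HM : w <= M).
  { unfold M. rewrite <- (Nat.pow_1_r w) at 1. apply Nat.pow_le_mono_r; lia. }
  assert (HZ : Z = w ^ (mu * r)) by (unfold Z, M; now rewrite Nat.pow_mul_r).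
  set (a := M / (2 * r)).
  assert (Ha1 : 2 * r * a <= M) by apply Nat.Div0.mul_div_le.
  assert (Ha2 : M <= 4 * r * a).
  { pose proof (Nat.mul_succ_div_gt M (2 * r) ltac:(lia)) as H. fold a in H. nia. }
  assert (Hup : (M + a) ^ r <= 2 * Z).
  { pose proof (pow_sum_bound M a r r (le_n _) Ha1) as H. fold Z in H.
    assert (M <= 2 * (M - r * a)) by lia.
    assert ((M + a) ^ r * M <= 2 * Z * M) by nia.
    apply Nat.mul_le_mono_pos_r in H1; lia. }
  set (N := C * (2 * Z)).
  destruct (nat_crossing (fun i => i ^ (2 * r * (mu * r)) <= N) (S N)) as [d [Hd1 Hd2]].
  { rewrite Nat.pow_0_l; lia. }
  { assert (S N ^ 1 <= S N ^ (2 * r * (mu * r))) by (apply Nat.pow_le_mono_r; lia).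
    rewrite Nat.pow_1_r in H. lia. }
  assert (Hdiv : forall g, 1 <= g <= 2 * Z -> length (divs g) <= d).
  { intros g Hg. destruct (le_lt_dec (length (divs g)) d) as [|H]; auto. exfalso. apply Hd2.
    eapply Nat.le_trans; [apply Nat.pow_le_mono_l; exact H|].
    eapply Nat.le_trans; [apply HC; lia|]. apply Nat.mul_le_mono_l. lia. }
  assert (Hd4 : d ^ (2 * r) <= (2 * C + 1) * w).
  { apply (Nat.pow_le_mono_l_iff _ _ (mu * r)); [nia|]. rewrite <- Nat.pow_mul_r.
    eapply Nat.le_trans; [exact Hd1|]. unfold N. rewrite HZ.
    rewrite Nat.pow_mul_l. replace (C * (2 * w ^ (mu * r))) with (2 * C * w ^ (mu * r)) by ring.
    apply Nat.mul_le_mono_r.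
    apply Nat.le_trans with ((2 * C + 1) ^ 1); [rewrite Nat.pow_1_r; lia|].
    apply Nat.pow_le_mono_r; nia. }
  assert (HT : a ^ r <= length G * d ^ r).
  { rewrite <- (length_seq a (S M)) at 1. rewrite <- lists_of_length.
    apply Nat.le_trans with (length (flat_map (fun g => lists_of r (divs g)) G)).
    - apply NoDup_incl_length; [apply lists_of_NoDup, seq_NoDup|].
      intros t Ht. apply in_lists_of in Ht. destruct Ht as [Hlen Hincl].
      assert (Hx : forall x, In x t -> M < x <= M + a).
      { intros x Hx. apply Hincl, in_seq in Hx. lia. }
      assert (Hg1 : Z < nprod t) by (unfold Z; rewrite <- Hlen; eapply nprod_gt; eauto; lia).
      assert (Hg2 : nprod t <= 2 * Z).
      { eapply Nat.le_trans; [apply (nprod_bounds t M a Hx)|]. rewrite Hlen; auto. }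
      apply in_flat_map. exists (nprod t). split.
      + apply filter_In. split; [apply in_seq; lia|]. apply holdsb_true. apply nprod_smooth.
        intros x Hx'. specialize (Hx x Hx').
        assert (a <= M) by nia. lia.
      + apply in_lists_of. split; auto. intros x Hx'. apply in_divs; [lia|]. now apply divide_nprod.
    - apply flat_map_length_le. intros g Hg. apply filter_In in Hg. destruct Hg as [Hg _].
      apply in_seq in Hg. rewrite lists_of_length. apply Nat.pow_le_mono_l, Hdiv. lia. }
  assert (H1 : Z <= (4 * r) ^ r * (length G * d ^ r)).
  { apply Nat.le_trans with ((4 * r * a) ^ r); [apply Nat.pow_le_mono_l; auto|].
    rewrite Nat.pow_mul_l. apply Nat.mul_le_mono_l; auto. }
  set (g := length G) in *.
  assert (H2 : Z * Z <= (w * g) * (w * g)).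
  { apply Nat.le_trans with (((4 * r) ^ r * (g * d ^ r)) * ((4 * r) ^ r * (g * d ^ r))); [apply Nat.mul_le_mono; auto|].
    replace (((4 * r) ^ r * (g * d ^ r)) * ((4 * r) ^ r * (g * d ^ r)))
      with ((g * g) * ((4 * r) ^ (2 * r) * d ^ (2 * r))).
    2:{ replace (2 * r) with (r + r) by lia. rewrite !Nat.pow_add_r. ring. }
    replace (w * g * (w * g)) with ((g * g) * (w * w)) by ring.
    apply Nat.mul_le_mono_l.
    apply Nat.le_trans with ((4 * r) ^ (2 * r) * ((2 * C + 1) * w)); [apply Nat.mul_le_mono_l; auto|].
    rewrite Nat.mul_assoc. apply Nat.mul_le_mono_r. lia. }
  destruct (le_lt_dec Z (w * g)) as [|H]; auto. exfalso.
  assert ((w * g) * (w * g) < Z * Z) by (apply Nat.mul_lt_mono; auto). lia.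
Qed.

Open Scope R_scope.

(** * Mean square of the difference between the two kernel sums *)

Lemma lsum_initial (K J : nat) (c : R) : 0 <= c ->
  lsum (seq 1 K) (fun j => if le_dec j J then c else 0) <= INR J * c.
Proof.
  intros Hc.
  assert (H : forall K, lsum (seq 1 K) (fun j => if le_dec j J then c else 0) <= INR (Nat.min K J) * c).
  { clear K. induction K as [|K IH]; [simpl; lra|]. rewrite seq_S, lsum_app. cbn [lsum fold_right].
    destruct (le_dec (1 + K) J) as [H|H].
    - replace (Nat.min (S K) J) with (S (Nat.min K J)) by lia. rewrite S_INR. lra.
    - replace (Nat.min (S K) J) with (Nat.min K J) by lia. lra. }
  eapply Rle_trans; [apply H|]. apply Rmult_le_compat_r; auto. apply le_INR. lia.
Qed.

Section Energy.
Variables w M Z J1 n0 : nat.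
Variable G : list nat.
Hypothesis Hw : (7 <= w)%nat.
Hypothesis HM : (1 <= M)%nat.
Hypothesis HJ1 : (1 <= J1)%nat.
Hypothesis Hn0 : n0 = (w * (J1 * J1))%nat.
Hypothesis Hn0Z : (7 * n0 <= Z)%nat.
Hypothesis HG : NoDup G.
Hypothesis HGZ : forall g, In g G -> (Z < g <= 2 * Z)%nat.
Hypothesis HGl : (Z <= w * length G)%nat.
Hypothesis Hes : forall j : nat, (J1 <= j < 2 * Z)%nat ->
  nrm2 (seq (S M) (9 * M)) (fun m => INR j * ln (INR m)) <= (INR (9 * M) / INR w) ^ 2.

Let P := list_prod (seq (S M) (9 * M)) G.
Definition xlog (p : nat * nat) : R := ln (INR (fst p)) + ln (INR (snd p)).

Let HwR : 7 <= INR w.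
Proof. apply le_IZR_INR; lia. Qed.

Let HMR : 1 <= INR M.
Proof. apply le_IZR_INR; lia. Qed.

Let HJR : 1 <= INR J1.
Proof. apply le_IZR_INR; lia. Qed.

Let Hn01 : (1 <= n0)%nat.
Proof. rewrite Hn0. assert (1 <= J1 * J1)%nat by nia. nia. Qed.

Let HZ6 : (6 <= Z)%nat.
Proof. lia. Qed.

Let Hn0R : INR n0 = INR w * INR J1 ^ 2.
Proof. rewrite Hn0, !mult_INR. ring. Qed.

Let Hcond : (1 <= n0)%nat /\ (7 * n0 <= Z)%nat.
Proof. auto. Qed.

(** For [j <= J1] the coefficients are at most [3 c0 / (w J1)], by the choice [n0 = w J1^2], and the
    trivial bound for the sums suffices. For larger [j] the hypothesis on [m] saves [w^2], and the
    large sieve costs [20 Z |G| <= 20 w |G|^2]. The two constants, 729 and 40500, fit under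
    50000. *)
Lemma energy_bound :
  lsum (seq 1 (2 * Z - 1)) (fun j => coefD Z n0 j ^ 2 * nrm2 P (fun p => INR j * xlog p))
   <= 50000 * (coefK Z 0 * INR M * INR (length G)) ^ 2 / INR w.
Proof.
  set (c0 := coefK Z 0). set (g := INR (length G)). set (W := INR w) in *.
  pose proof (coefK_0 Z HZ6) as Hc0. fold c0 in Hc0.
  assert (Hg : 0 <= g) by apply pos_INR.
  assert (HZg : INR Z <= W * g) by (unfold W, g; rewrite <- mult_INR; apply le_INR; auto).
  set (T1 := 729 * (c0 * INR M * g) ^ 2 / (W ^ 2 * INR J1 ^ 2)).
  set (T2 := 2025 * (c0 * INR M) ^ 2 / W ^ 2).
  assert (HJ2 : 0 < INR J1 ^ 2) by (apply pow_lt; lra).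
  assert (HW2 : 0 < W ^ 2) by (apply pow_lt; lra).
  assert (HT1 : 0 <= T1).
  { unfold T1. apply Rmult_le_pos; [apply Rmult_le_pos; [lra|apply pow2_ge_0]|].
    left. apply Rinv_0_lt_compat, Rmult_lt_0_compat; auto. }
  assert (HT2 : 0 <= T2).
  { unfold T2. apply Rmult_le_pos; [apply Rmult_le_pos; [lra|apply pow2_ge_0]|].
    left. apply Rinv_0_lt_compat; auto. }
  assert (HP : forall j : nat, nrm2 P (fun p => INR j * xlog p)
    = nrm2 (seq (S M) (9 * M)) (fun m => INR j * ln (INR m)) * nrm2 G (fun g => INR j * ln (INR g))).
  { intros j. unfold P. rewrite <- (nrm2_mul (seq (S M) (9 * M)) G).
    apply nrm2_ext. intros p _. unfold xlog. ring. }
  assert (Hterm : forall j, In j (seq 1 (2 * Z - 1)) ->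
    coefD Z n0 j ^ 2 * nrm2 P (fun p => INR j * xlog p)
     <= (if le_dec j J1 then T1 else 0) + T2 * nrm2 G (fun g => INR j * ln (INR g))).
  { intros j Hj. apply in_seq in Hj. rewrite HP.
    set (A := nrm2 (seq (S M) (9 * M)) _). set (B := nrm2 G _).
    assert (HA0 : 0 <= A) by apply nrm2_nonneg. assert (HB0 : 0 <= B) by apply nrm2_nonneg.
    assert (HB : B <= g ^ 2) by apply nrm2_le.
    assert (H9 : INR (9 * M) = 9 * INR M) by (rewrite mult_INR; simpl; ring).
    destruct (le_dec j J1) as [Hle|Hgt].
    - assert (HA : A <= (9 * INR M) ^ 2).
      { unfold A. pose proof (nrm2_le (seq (S M) (9 * M)) (fun m => INR j * ln (INR m))) as H.
        rewrite length_seq, H9 in H. exact H. }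
      assert (HD : coefD Z n0 j ^ 2 <= 9 * c0 ^ 2 / (W ^ 2 * INR J1 ^ 2)).
      { pose proof (coefD_low Z HZ6 n0 Hcond j) as H. fold c0 in H.
        assert (Hj1 : 3 * c0 * INR j / INR n0 <= 3 * c0 / (W * INR J1)).
        { rewrite Hn0R. apply Rle_trans with (3 * c0 * INR J1 / (W * INR J1 ^ 2)).
          - apply Rmult_le_compat_r; [left; apply Rinv_0_lt_compat, Rmult_lt_0_compat; lra|].
            apply Rmult_le_compat_l; [lra|apply le_INR; auto].
          - right. field. lra. }
        rewrite <- pow2_abs.
        replace (9 * c0 ^ 2 / (W ^ 2 * INR J1 ^ 2)) with ((3 * c0 / (W * INR J1)) ^ 2) by (field; lra).
        apply pow_incr. split; [apply Rabs_pos|lra]. }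
      assert (HAB : A * B <= (9 * INR M) ^ 2 * g ^ 2) by (apply Rmult_le_compat; auto).
      assert (0 <= T2 * B) by (apply Rmult_le_pos; auto).
      apply Rle_trans with (T1 + 0); [|lra].
      apply Rle_trans with ((9 * c0 ^ 2 / (W ^ 2 * INR J1 ^ 2)) * ((9 * INR M) ^ 2 * g ^ 2)).
      + apply Rmult_le_compat; auto; [apply pow2_ge_0|apply Rmult_le_pos; auto].
      + right. unfold T1. field. lra.
    - assert (HA : A <= (9 * INR M / W) ^ 2).
      { unfold A. rewrite <- H9. apply Hes. lia. }
      assert (HD : coefD Z n0 j ^ 2 <= 25 * c0 ^ 2).
      { pose proof (coefD_bound Z HZ6 n0 Hcond j) as H. fold c0 in H.
        rewrite <- pow2_abs. replace (25 * c0 ^ 2) with ((5 * c0) ^ 2) by ring.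
        apply pow_incr. split; [apply Rabs_pos|lra]. }
      rewrite Rplus_0_l. rewrite <- Rmult_assoc. apply Rmult_le_compat_r; auto.
      apply Rle_trans with (25 * c0 ^ 2 * (9 * INR M / W) ^ 2).
      + apply Rmult_le_compat; auto. apply pow2_ge_0.
      + right. unfold T2. field. lra. }
  eapply Rle_trans; [apply lsum_le; exact Hterm|].
  rewrite lsum_plus, lsum_scal.
  pose proof (lsum_initial (2 * Z - 1) J1 T1 HT1) as H1.
  pose proof (large_sieve Z G ltac:(lia) HG HGZ) as H2. fold g in H2.
  assert (H3 : T2 * lsum (seq 1 (2 * Z - 1)) (fun j => nrm2 G (fun g => INR j * ln (INR g)))
     <= 40500 * (c0 * INR M * g) ^ 2 / W).
  { eapply Rle_trans; [apply Rmult_le_compat_l; [auto|exact H2]|].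
    apply Rle_trans with (T2 * (20 * (W * g) * g)).
    - apply Rmult_le_compat_l; auto. apply Rmult_le_compat_r; auto. lra.
    - right. unfold T2. field. lra. }
  assert (H4 : INR J1 * T1 <= 729 * (c0 * INR M * g) ^ 2 / W).
  { unfold T1. set (X := (c0 * INR M * g) ^ 2). assert (0 <= X) by apply pow2_ge_0.
    replace (INR J1 * (729 * X / (W ^ 2 * INR J1 ^ 2))) with (729 * X / W * / (W * INR J1)) by (field; lra).
    rewrite <- (Rmult_1_r (729 * X / W)) at 2. apply Rmult_le_compat_l.
    - apply Rle_mult_inv_pos; lra.
    - rewrite <- Rinv_1. apply Rinv_le_contravar; nra. }
  assert (H5 : 0 <= (c0 * INR M * g) ^ 2 / W).
  { apply Rle_mult_inv_pos; [apply pow2_ge_0|lra]. }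
  replace (50000 * (c0 * INR M * g) ^ 2 / W) with (50000 * ((c0 * INR M * g) ^ 2 / W)) by (field; lra).
  replace (40500 * (c0 * INR M * g) ^ 2 / W) with (40500 * ((c0 * INR M * g) ^ 2 / W)) in H3 by (field; lra).
  replace (729 * (c0 * INR M * g) ^ 2 / W) with (729 * ((c0 * INR M * g) ^ 2 / W)) in H4 by (field; lra).
  lra.
Qed.

Let Hg0 : (1 <= length G)%nat.
Proof. destruct (length G); lia. Qed.

(* Logarithms are sampled modulo [2 pi], starting at [4MZ], the left end of the range of [n]. *)
Definition grid (l : nat) : R := ln (4 * INR M * INR Z) + 2 * PI * INR l / INR (64 * Z).

Definition grid_sum (k : R -> R) (l : nat) : R := lsum P (fun p => k (xlog p - grid l)).

(** Chebyshev's inequality: at each such point the two grid sums differ by at least a quarter of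
    [c0 M |G|], and Parseval bounds the mean square. The constant is [16 * 2 * 64 * 50000]. *)
Lemma bad_grid_points (B : list nat) : NoDup B ->
  (forall l, In l B -> (l < 64 * Z)%nat /\ grid_sum (kerK Z) l <= 0 /\
     coefK Z 0 * INR (length G) * INR M / 4 <= grid_sum (ker0 Z n0) l) ->
  INR (length B) * INR w <= 102400000 * INR Z.
Proof.
  intros HB Hl. pose proof (coefK_0 Z HZ6) as Hc0. set (c0 := coefK Z 0) in *.
  set (g := INR (length G)) in *.
  assert (Hg : 1 <= g) by (unfold g; apply le_IZR_INR; lia).
  assert (HZR : 6 <= INR Z) by (apply le_IZR_INR; lia).
  pose proof (grid_parseval P xlog (coefD Z n0) (2 * Z) (64 * Z) (ln (4 * INR M * INR Z)) ltac:(lia)) as HPar.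
  set (Phi := fun l => grid_sum (kerK Z) l - grid_sum (ker0 Z n0) l).
  assert (HPhi : forall l, 2 * lsum (seq 1 (2 * Z - 1)) (fun j => coefD Z n0 j *
      lsum P (fun p => cos (INR j * (xlog p - (ln (4 * INR M * INR Z) + 2 * PI * INR l / INR (64 * Z)))))) = Phi l).
  { intros l. unfold Phi, grid_sum. rewrite <- lsum_minus.
    rewrite (lsum_ext P _ (fun p => 2 * lsum (seq 1 (2 * Z - 1)) (fun d => coefD Z n0 d * cos (INR d * (xlog p - grid l))))).
    2:{ intros p _. apply kernel_difference; auto. }
    rewrite lsum_scal, lsum_swap. f_equal. apply lsum_ext. intros j _. symmetry. apply lsum_scal. }
  rewrite (lsum_ext _ _ (fun l => Phi l ^ 2)) in HPar by (intros l _; rewrite HPhi; auto).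
  pose proof energy_bound as HE. fold c0 g in HE.
  set (Y := c0 * INR M * g) in *.
  assert (HY : 0 < Y) by (unfold Y; apply Rmult_lt_0_compat; [apply Rmult_lt_0_compat|]; lra).
  assert (HB1 : INR (length B) * (Y / 4) ^ 2 <= lsum (seq 0 (64 * Z)) (fun l => Phi l ^ 2)).
  { apply Rle_trans with (lsum B (fun l => Phi l ^ 2)).
    - apply lsum_ge_const. intros l Hin. destruct (Hl l Hin) as [_ [H1 H2]].
      rewrite <- (pow2_abs (Phi l)). apply pow_incr. split; [lra|].
      assert (Phi l <= - (Y / 4)) by (unfold Phi, Y; lra). rewrite Rabs_left by lra. lra.
    - apply lsum_incl; auto; [|intros; apply pow2_ge_0].
      intros l Hin. apply in_seq. destruct (Hl l Hin). lia. }
  rewrite HPar in HB1.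
  assert (HN : INR (64 * Z) = 64 * INR Z) by (rewrite mult_INR; simpl; ring).
  rewrite HN in HB1.
  assert (HB2 : INR (length B) * (Y / 4) ^ 2 <= 2 * (64 * INR Z) * (50000 * Y ^ 2 / INR w)).
  { eapply Rle_trans; [exact HB1|]. apply Rmult_le_compat_l; [lra|exact HE]. }
  apply (Rmult_le_reg_r (Y ^ 2 / 16 / INR w)).
  - apply Rdiv_lt_0_compat; [|lra]. apply Rdiv_lt_0_compat; [apply pow_lt; auto|lra].
  - replace (INR (length B) * INR w * (Y ^ 2 / 16 / INR w)) with (INR (length B) * (Y / 4) ^ 2) by (field; lra).
    replace (102400000 * INR Z * (Y ^ 2 / 16 / INR w)) with (2 * (64 * INR Z) * (50000 * Y ^ 2 / INR w)) by (field; lra).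
    exact HB2.
Qed.

End Energy.

(** * From grid points to integers *)

Lemma ln_diff_bounds (a b : R) : 0 < a -> 0 < b -> (b - a) / b <= ln b - ln a <= (b - a) / a.
Proof.
  intros Ha Hb.
  assert (Hln : forall y, 0 < y -> ln y <= y - 1).
  { intros y Hy. pose proof (exp_ineq1_le (ln y)) as H. rewrite exp_ln in H by auto. lra. }
  assert (E : forall c d, 0 < c -> 0 < d -> ln d - ln c <= (d - c) / c).
  { intros c d Hc Hd. replace (ln d - ln c) with (ln (d / c)).
    - replace ((d - c) / c) with (d / c - 1) by (field; lra). apply Hln. apply Rdiv_lt_0_compat; auto.
    - unfold Rdiv. rewrite ln_mult, ln_Rinv; auto. apply Rinv_0_lt_compat; auto. }
  pose proof (E a b Ha Hb). pose proof (E b a Hb Ha).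
  replace ((a - b) / b) with (- ((b - a) / b)) in H0 by (field; lra). lra.
Qed.

(** Since [3 <= PI], logarithmic differences over the ranges in use stay in [[-PI, PI]], and
    sampling modulo [2 PI] causes no wraparound. *)
Lemma ln_le_ln_plus_3 (a b : R) : 0 < a -> 0 < b -> b <= 10 * a -> ln b - ln a <= 3.
Proof.
  intros Ha Hb H.
  assert (He : 10 <= exp 3).
  { pose proof (exp_ineq1_le (1 / 2)) as H1. replace 3 with (INR 6 * (1 / 2)) by (simpl; field).
    assert (E : exp (INR 6 * (1 / 2)) = exp (1 / 2) ^ 6).
    { simpl INR. replace ((1 + 1 + 1 + 1 + 1 + 1) * (1 / 2)) with (1/2 + (1/2 + (1/2 + (1/2 + (1/2 + 1/2))))) by field.
      rewrite !exp_plus. ring. }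
    rewrite E. apply Rle_trans with ((3 / 2) ^ 6); [lra|]. apply pow_incr; lra. }
  assert (ln b <= ln (exp 3 * a)) by (destruct (Rle_lt_or_eq_dec b (exp 3 * a)) as [Hl|He']; [nra|left; apply ln_increasing; auto|right; rewrite He'; auto]).
  rewrite ln_mult, ln_exp in H0; lra.
Qed.

Section Local.
Variables M Z n0 k : nat.
Variable G : list nat.
Hypothesis HM : (1 <= M)%nat.
Hypothesis Hn0 : (7 <= n0)%nat.
Hypothesis HMk : M = (n0 * k)%nat.
Hypothesis Hn0Z : (7 * n0 <= Z)%nat.
Hypothesis HZ : (1000 <= Z)%nat.
Hypothesis HGZ : forall g, In g G -> (Z < g <= 2 * Z)%nat.

Let HMR : 1 <= INR M.
Proof. apply le_IZR_INR; lia. Qed.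
Let HZR : 1000 <= INR Z.
Proof. apply le_IZR_INR; lia. Qed.
Let Hn0R : 7 <= INR n0.
Proof. apply le_IZR_INR; lia. Qed.
Let HMkR : INR M = INR n0 * INR k.
Proof. rewrite HMk. apply mult_INR. Qed.
Let HZ6 : (6 <= Z)%nat.
Proof. lia. Qed.
Let Hcond : (1 <= n0)%nat /\ (7 * n0 <= Z)%nat.
Proof. lia. Qed.
Let HMZ : 1000 * INR M <= INR M * INR Z.
Proof. nra. Qed.

Variable n l : nat.
Hypothesis Hn : 4 * INR M * INR Z <= INR n <= 9 * INR M * INR Z.
Let X := exp (grid M Z l).
Hypothesis HX : INR n + 80 * INR M < X <= INR n + 83 * INR M.

Let HX0 : 0 < X.
Proof. apply exp_pos. Qed.
Let HlnX : grid M Z l = ln X.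
Proof. unfold X. now rewrite ln_exp. Qed.

Let in_P (m g : nat) : In (m, g) (list_prod (seq (S M) (9 * M)) G) ->
  INR M < INR m <= 10 * INR M /\ INR Z < INR g <= 2 * INR Z.
Proof.
  intros H. apply in_prod_iff in H. destruct H as [H1 H2]. apply in_seq in H1. apply HGZ in H2.
  split; split; try (apply lt_INR; lia).
  - apply INR_le_scal; lia.
  - apply INR_le_scal; lia.
Qed.

(** The point [X] lies at least [80 M] above [n] and [117 M] below [n + 200 M]. As [n <= 9 M Z],
    products outside that window are at logarithmic distance at least [6 / Z] from [X], where each
    kernel value is nonpositive. *)
Lemma kernel_sum_nonpos :
  (forall m g, In (m, g) (list_prod (seq (S M) (9 * M)) G) -> ~ (n < m * g <= n + 200 * M)%nat) ->
  grid_sum M Z G (kerK Z) l <= 0.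
Proof.
  intros Hbad. unfold grid_sum.
  rewrite <- (Rmult_0_r (INR (length (list_prod (seq (S M) (9 * M)) G)))). apply lsum_le_const.
  intros [m g] Hp. specialize (Hbad m g Hp). destruct (in_P m g Hp) as [Hm Hg].
  apply kerK_nonpos; [auto|]. unfold xlog. cbn [fst snd].
  set (v := INR m * INR g).
  assert (Hv0 : INR M * INR Z <= v) by (unfold v; apply Rmult_le_compat; lra).
  assert (Hv1 : v <= 20 * (INR M * INR Z)).
  { apply Rle_trans with ((10 * INR M) * (2 * INR Z)); [unfold v; apply Rmult_le_compat; lra|lra]. }
  assert (Hvp : 0 < v) by lra.
  replace (ln (INR m) + ln (INR g)) with (ln v) by (unfold v; rewrite ln_mult; lra).
  rewrite HlnX.
  assert (H3 : 3 <= PI) by (pose proof PI2_3_2; lra).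
  assert (U1 : ln X - ln v <= 3) by (apply ln_le_ln_plus_3; lra).
  assert (U2 : ln v - ln X <= 3) by (apply ln_le_ln_plus_3; lra).
  split; [|apply Rabs_le; lra].
  assert (HR : (m * g <= n)%nat \/ (n + 200 * M <= m * g)%nat) by lia.
  destruct HR as [H|H]; apply le_INR in H; rewrite ?plus_INR, ?mult_INR in H; fold v in H.
  - destruct (ln_diff_bounds v X Hvp HX0) as [L _].
    assert (6 / INR Z <= (X - v) / X).
    { apply Rle_trans with ((80 * INR M) / X).
      - apply div_le; [lra|]. replace (80 * INR M / X * INR Z) with (80 * (INR M * INR Z) / X) by (field; lra).
        apply le_div; lra.
      - apply Rmult_le_compat_r; [left; apply Rinv_0_lt_compat; lra|lra]. }
    rewrite Rabs_minus_sym. eapply Rle_trans; [|apply Rle_abs]. lra.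
  - set (b := INR n + 200 * INR M).
    assert (Hb : b <= v) by (unfold b; rewrite (INR_IZR_INZ 200) in H; exact H).
    assert (Hbp : 0 < b) by (unfold b; lra).
    destruct (ln_diff_bounds X b HX0 Hbp) as [L _].
    assert (ln b <= ln v) by (destruct Hb as [Hb|Hb]; [left; apply ln_increasing; auto|rewrite Hb; lra]).
    assert (6 / INR Z <= (b - X) / b).
    { apply Rle_trans with ((117 * INR M) / b).
      - apply div_le; [lra|]. replace (117 * INR M / b * INR Z) with (117 * (INR M * INR Z) / b) by (field; lra).
        apply le_div; [lra|]. unfold b. lra.
      - apply Rmult_le_compat_r; [left; apply Rinv_0_lt_compat; lra|unfold b; lra]. }
    eapply Rle_trans; [|apply Rle_abs]. lra.
Qed.

(** For each [g], the [k = M / n0] consecutive integers [m] just above [X / g] have [ln (m g)]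
    within [1 / n0] of [ln X], and each contributes at least [c0 n0 / 4]. All other terms are
    nonnegative. *)
Lemma coarse_sum_large :
  coefK Z 0 * INR (length G) * INR M / 4 <= grid_sum M Z G (ker0 Z n0) l.
Proof.
  unfold grid_sum. rewrite lsum_list_prod, lsum_swap.
  replace (coefK Z 0 * INR (length G) * INR M / 4) with (INR (length G) * (INR k * (coefK Z 0 * INR n0 / 4)))
    by (rewrite HMkR; field).
  apply lsum_ge_const. intros g Hg.
  assert (HgR : INR Z < INR g <= 2 * INR Z).
  { apply HGZ in Hg. split; [apply lt_INR; lia|].
    apply INR_le_scal; lia. }
  set (y := X / INR g).
  assert (Hyg : y * INR g = X) by (unfold y; field; lra).
  assert (Hy1 : 2 * INR M <= y).
  { apply (Rmult_le_reg_r (INR g)); [lra|]. rewrite Hyg.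
    apply Rle_trans with (2 * INR M * (2 * INR Z)); [apply Rmult_le_compat_l; lra|lra]. }
  assert (Hy2 : y <= 91 / 10 * INR M).
  { apply (Rmult_le_reg_r (INR g)); [lra|]. rewrite Hyg.
    apply Rle_trans with (91 / 10 * INR M * INR Z); [lra|]. apply Rmult_le_compat_l; lra. }
  destruct (archimed y) as [A1 A2].
  set (a := Z.to_nat (up y)).
  assert (Ha : INR a = IZR (up y)).
  { unfold a. rewrite INR_IZR_INZ, Z2Nat.id; auto. apply le_IZR. lra. }
  assert (Hk7 : 7 * INR k <= INR M) by (rewrite HMkR; apply Rmult_le_compat_r; [apply pos_INR|lra]).
  assert (Hk1 : (1 <= k)%nat) by (destruct k; lia).
  assert (HaM : (S M <= a)%nat).
  { apply INR_lt. rewrite Ha. lra. }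
  assert (HaM2 : (a + k <= S M + 9 * M)%nat).
  { apply INR_le. rewrite !plus_INR, Ha, S_INR, mult_INR. replace (INR 9) with 9 by (simpl; lra).
    apply le_INR in Hk1. simpl (INR 1) in Hk1. lra. }
  apply Rle_trans with (lsum (seq a k) (fun m => ker0 Z n0 (xlog (m, g) - grid M Z l))).
  - rewrite <- (length_seq k a) at 1. apply lsum_ge_const. intros m Hm. apply in_seq in Hm.
    apply ker0_near_0; auto. rewrite HlnX. unfold xlog. cbn [fst snd].
    assert (Hm1 : INR a <= INR m) by (apply le_INR; lia).
    assert (Hm2 : INR m + 1 <= INR a + INR k) by (rewrite <- S_INR, <- plus_INR; apply le_INR; lia).
    rewrite <- Hyg, ln_mult by lra.
    replace (ln (INR m) + ln (INR g) - (ln y + ln (INR g))) with (ln (INR m) - ln y) by ring.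
    destruct (ln_diff_bounds y (INR m) ltac:(lra) ltac:(lra)) as [L1 L2].
    assert (0 <= (INR m - y) / INR m) by (apply Rle_mult_inv_pos; lra).
    rewrite Rabs_right by lra.
    apply Rle_trans with (INR n0 * (INR k / INR M)).
    + apply Rmult_le_compat_l; [lra|]. eapply Rle_trans; [exact L2|].
      apply Rle_trans with (INR k / y).
      * apply Rmult_le_compat_r; [left; apply Rinv_0_lt_compat; lra|lra].
      * apply Rmult_le_compat_l; [apply pos_INR|]. apply Rinv_le_contravar; lra.
    + right. replace (INR n0 * (INR k / INR M)) with ((INR n0 * INR k) / INR M) by (field; lra).
      rewrite <- HMkR. field. lra.
  - apply lsum_incl; [apply seq_NoDup| |].
    + intros m Hm. apply in_seq in Hm. apply in_seq. lia.
    + intros m _. apply ker0_nonneg; auto.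
Qed.

End Local.

(** With [64 Z] points the spacing is at most [1 / (8 Z)], which near [n] amounts to less than [3 M]
    after exponentiation. The range of [ln n] covers less than half a period, so [l < 64 Z]. *)
Lemma nearby_grid_point (M Z n : nat) : (1 <= M)%nat -> (1000 <= Z)%nat ->
  4 * INR M * INR Z <= INR n <= 9 * INR M * INR Z ->
  exists l, (l < 64 * Z)%nat /\ INR n + 80 * INR M < exp (grid M Z l) <= INR n + 83 * INR M.
Proof.
  intros HM HZ Hn.
  assert (HMR : 1 <= INR M) by (apply le_IZR_INR; lia).
  assert (HZR : 1000 <= INR Z) by (apply le_IZR_INR; lia).
  assert (HMZ : 1000 * INR M <= INR M * INR Z) by nra.
  assert (HN : INR (64 * Z) = 64 * INR Z) by (rewrite mult_INR; replace (INR 64) with 64 by (rewrite INR_IZR_INZ; reflexivity); auto).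
  pose proof PI2_3_2 as Hpi1. pose proof PI_4 as Hpi2.
  set (a := INR n + 80 * INR M). set (u0 := ln (4 * INR M * INR Z)).
  set (h0 := 2 * PI / INR (64 * Z)).
  assert (Hh0 : 0 < h0) by (unfold h0; apply Rdiv_lt_0_compat; lra).
  assert (Hh1 : h0 <= 1 / (8 * INR Z)).
  { unfold h0. rewrite HN. apply (Rmult_le_reg_r (64 * INR Z)); [lra|].
    replace (2 * PI / (64 * INR Z) * (64 * INR Z)) with (2 * PI) by (field; lra).
    replace (1 / (8 * INR Z) * (64 * INR Z)) with 8 by (field; lra). lra. }
  assert (Hap : 0 < a) by (unfold a; lra).
  assert (Hu1 : u0 <= ln a).
  { unfold u0. left. apply ln_increasing; unfold a; lra. }
  assert (Hu2 : ln a - u0 <= 3) by (apply ln_le_ln_plus_3; unfold a; lra).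
  set (t := (ln a - u0) / h0).
  assert (Ht : t * h0 = ln a - u0) by (unfold t; field; lra).
  assert (Ht0 : 0 <= t) by (unfold t; apply Rmult_le_pos; [lra|left; apply Rinv_0_lt_compat; auto]).
  destruct (archimed t) as [A1 A2].
  set (l := Z.to_nat (up t)).
  assert (Hl : INR l = IZR (up t)).
  { unfold l. rewrite INR_IZR_INZ, Z2Nat.id; auto. apply le_IZR. lra. }
  assert (Hg : grid M Z l = u0 + INR l * h0) by (unfold grid, h0, u0; field; rewrite HN; lra).
  exists l. split.
  - apply INR_lt. rewrite Hl, HN.
    assert (t <= 32 * INR Z + 1).
    { apply (Rmult_le_reg_r h0); auto. rewrite Ht. unfold h0. rewrite HN.
      replace ((32 * INR Z + 1) * (2 * PI / (64 * INR Z))) with (PI + 2 * PI / (64 * INR Z)) by (field; lra).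
      assert (0 < 2 * PI / (64 * INR Z)) by (apply Rdiv_lt_0_compat; lra). lra. }
    lra.
  - assert (E1 : ln a < grid M Z l <= ln a + h0) by (rewrite Hg, Hl; nra).
    fold a. split.
    + rewrite <- (exp_ln a) at 1 by auto. apply exp_increasing. lra.
    + apply Rle_trans with (a * exp h0).
      * replace (a * exp h0) with (exp (ln a + h0)) by (rewrite exp_plus, exp_ln; auto).
        destruct (proj2 E1) as [H|H]; [left; apply exp_increasing; auto|right; now f_equal].
      * assert (Hs : h0 <= 1 / 2).
        { eapply Rle_trans; [exact Hh1|]. apply div_le; lra. }
        assert (He : exp h0 <= 1 + 2 * h0).
        { pose proof (exp_ineq1_le (- h0)) as H. pose proof (exp_pos h0).
          assert (exp h0 * exp (- h0) = 1) by (rewrite <- exp_plus, Rplus_opp_r, exp_0; auto).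
          assert (exp h0 * (1 - h0) <= 1) by nra. nra. }
        assert (a * (2 * h0) <= 3 * INR M).
        { apply Rle_trans with ((10 * (INR M * INR Z)) * (2 * (1 / (8 * INR Z)))).
          - apply Rmult_le_compat; try lra. unfold a; lra.
          - replace (10 * (INR M * INR Z) * (2 * (1 / (8 * INR Z)))) with (5 / 2 * INR M) by (field; lra). lra. }
        assert (a * exp h0 <= a * (1 + 2 * h0)) by (apply Rmult_le_compat_l; lra).
        unfold a in *. lra.
Qed.

Lemma nrm2_seq_shift (a L : nat) (f : nat -> R) :
  nrm2 (seq a L) f = nrm2 (seq 0 L) (fun i => f (a + i)%nat).
Proof. unfold nrm2. now rewrite !(lsum_seq_shift a). Qed.

Definition smooth_free (y n k : nat) : Prop := forall m, (n < m <= n + k)%nat -> ~ smooth y m.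

(** The frequencies reach [2 Z = 2 w^(2 be r)] with [be = shift_exp r], and [Q] differencings treat
    [t] up to [w^(Q be)]; so [Q = 2r + 1] is enough. *)
Definition differencings (r : nat) : nat := (2 * r + 1)%nat.
Definition savings (r : nat) : nat := (2 ^ S (differencings r))%nat.
Definition shift_exp (r : nat) : nat := ((differencings r + 2) * savings r + 10)%nat.
Definition len_exp (r : nat) : nat := (2 * shift_exp r)%nat.

Lemma smooth_free_count (r : nat) : (1 <= r)%nat -> exists w0, forall w, (w0 <= w)%nat ->
  let M := (w ^ len_exp r)%nat in let Z := (M ^ r)%nat in
  forall L : list nat, NoDup L ->
  (forall n, In n L -> (4 * M * Z <= n <= 9 * M * Z)%nat /\ smooth_free (10 * M) n (200 * M)) ->
  INR (length L) * INR w <= 512000000 * INR M * INR Z.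
Proof.
  intros Hr.
  destruct (log_exponential_sum (differencings r)) as [w1 Hw1].
  destruct (many_smooth_numbers r (len_exp r) Hr ltac:(unfold len_exp, shift_exp; lia)) as [w2 Hw2].
  exists (w1 + w2 + 1000)%nat. intros w Hw M Z L HL HLin.
  specialize (Hw1 w ltac:(lia)). specialize (Hw2 w ltac:(lia)). cbv zeta in Hw1, Hw2.
  fold (savings r) in Hw1. fold (shift_exp r) in Hw1. fold (len_exp r) in Hw1. fold M in Hw1, Hw2. fold Z in Hw2.
  set (E := savings r) in *. set (be := shift_exp r) in *.
  assert (HbeE : (2 * E + 10 <= be)%nat) by (unfold be, shift_exp; fold E; nia).
  set (G := filter _ _) in Hw2.
  set (J1 := (w ^ (E + 1))%nat). set (n0 := (w * (J1 * J1))%nat).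
  (* As [n0 = w * w^(2(E+1)) = w^(2E+3)], this is the exact quotient [M / n0]. *)
  set (k := (w ^ (2 * be - (2 * E + 3)))%nat).
  assert (Hpow : forall j, (1 <= w ^ j)%nat).
  { intros j. apply pow_ge_1. lia. }
  assert (HMk : M = (n0 * k)%nat).
  { unfold M, n0, J1, k, len_exp. fold be.
    rewrite <- Nat.pow_add_r. rewrite <- (Nat.pow_1_r w) at 2. rewrite <- !Nat.pow_add_r. f_equal. lia. }
  assert (HM1 : (1 <= M)%nat) by apply Hpow.
  assert (Hkw : (w <= k)%nat).
  { unfold k. rewrite <- (Nat.pow_1_r w) at 1. apply Nat.pow_le_mono_r; lia. }
  assert (HMZ : (M <= Z)%nat).
  { unfold Z. rewrite <- (Nat.pow_1_r M) at 1. apply Nat.pow_le_mono_r; lia. }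
  assert (Hn0w : (w <= n0)%nat).
  { unfold n0. assert (1 <= J1 * J1)%nat by (pose proof (Hpow (E + 1)%nat); fold J1 in H; nia). nia. }
  assert (Hn0Z : (7 * n0 <= Z)%nat) by (rewrite HMk in HMZ; nia).
  assert (HZ1000 : (1000 <= Z)%nat) by lia.
  assert (HGZ : forall g, In g G -> (Z < g <= 2 * Z)%nat).
  { intros g Hg. apply filter_In in Hg. destruct Hg as [Hg _]. apply in_seq in Hg. lia. }
  assert (HG : NoDup G) by apply NoDup_filter, seq_NoDup.
  assert (Hes : forall j : nat, (J1 <= j < 2 * Z)%nat ->
    nrm2 (seq (S M) (9 * M)) (fun m => INR j * ln (INR m)) <= (INR (9 * M) / INR w) ^ 2).
  { intros j Hj. rewrite nrm2_seq_shift.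
    rewrite (nrm2_ext _ _ (fun i => INR j * ln (INR M + 1 + INR i))).
    2:{ intros i _. do 2 f_equal. rewrite plus_INR, S_INR. ring. }
    apply Hw1. rewrite <- !pow_INR. split; [apply le_INR; unfold J1 in Hj; lia|].
    apply le_INR. apply Nat.le_trans with (2 * Z)%nat; [lia|].
    unfold Z, M, len_exp. fold be. rewrite <- Nat.pow_mul_r.
    apply Nat.le_trans with (w ^ 1 * w ^ (2 * be * r))%nat.
    - apply Nat.mul_le_mono_r. rewrite Nat.pow_1_r. lia.
    - rewrite <- Nat.pow_add_r. apply Nat.pow_le_mono_r; [lia|]. unfold differencings. nia. }
  set (sel := fun n => epsilon (inhabits 0%nat) (fun l => (l < 64 * Z)%nat /\
     INR n + 80 * INR M < exp (grid M Z l) <= INR n + 83 * INR M)).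
  assert (HnR : forall n, In n L -> 4 * INR M * INR Z <= INR n <= 9 * INR M * INR Z).
  { intros n Hn. destruct (HLin n Hn) as [Hn' _].
    replace 4 with (INR 4) by (simpl; lra). replace 9 with (INR 9) by (simpl; lra).
    rewrite <- !mult_INR. split; apply le_INR; lia. }
  assert (Hsel : forall n, In n L -> (sel n < 64 * Z)%nat /\
     INR n + 80 * INR M < exp (grid M Z (sel n)) <= INR n + 83 * INR M).
  { intros n Hn. unfold sel. apply epsilon_spec. apply nearby_grid_point; auto. }
  set (B := nodup Nat.eq_dec (map sel L)).
  assert (HB : INR (length B) * INR w <= 102400000 * INR Z).
  { apply (bad_grid_points w M Z J1 n0 G); try apply NoDup_nodup; auto; try lia; try apply Hpow.
    - intros l Hl. apply nodup_In in Hl. apply in_map_iff in Hl. destruct Hl as [n [<- Hn]].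
      destruct (Hsel n Hn) as [H1 H2]. destruct (HLin n Hn) as [_ Hfree].
      split; auto. split.
      + apply (kernel_sum_nonpos M Z n0 k G HM1 ltac:(lia) HMk Hn0Z HZ1000 HGZ n (sel n) (HnR n Hn) H2).
        intros m g Hp Hmg. apply (Hfree (m * g)%nat); auto.
        apply in_prod_iff in Hp. destruct Hp as [Hm Hg]. apply in_seq in Hm.
        apply filter_In in Hg. destruct Hg as [_ Hg]. rewrite holdsb_true in Hg.
        apply smooth_mul; [apply smooth_le; lia|]. apply (smooth_mono (2 * M)); auto. lia.
      + apply (coarse_sum_large M Z n0 k G HM1 ltac:(lia) HMk Hn0Z HZ1000 HGZ n (sel n) (HnR n Hn) H2). }
  (* A grid point determines [n] up to an offset in [[0, 3M + 1]], so it is selected by at most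
     [3 M + 2] values of [n]. *)
  assert (HLB : (length L <= length B * (3 * M + 2))%nat).
  { rewrite <- (length_seq (3 * M + 2) 0), <- length_prod.
    set (e := fun l => Z.to_nat (up (exp (grid M Z l)))).
    assert (He : forall n, In n L -> (n + 80 * M <= e (sel n) <= n + 83 * M + 1)%nat).
    { intros n Hn. destruct (Hsel n Hn) as [_ H2]. set (X := exp (grid M Z (sel n))) in *.
      destruct (archimed X) as [A1 A2]. pose proof (pos_INR n). pose proof (pos_INR M).
      assert (He : INR (e (sel n)) = IZR (up X)).
      { unfold e. fold X. rewrite INR_IZR_INZ, Z2Nat.id; auto. apply le_IZR. lra. }
      split; apply INR_le; rewrite ?plus_INR, ?mult_INR, ?(INR_IZR_INZ 80), ?(INR_IZR_INZ 83), He; simpl; lra. }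
    apply (inj_length (fun n => (sel n, (e (sel n) - (n + 80 * M))%nat))); auto.
    - intros x y Hx Hy Exy. injection Exy as E1 E2. pose proof (He x Hx) as Hex. pose proof (He y Hy) as Hey.
      rewrite <- E1 in *. lia.
    - intros x Hx. pose proof (He x Hx). apply in_prod.
      + apply nodup_In, in_map; auto.
      + apply in_seq. lia. }
  apply le_INR in HLB. rewrite mult_INR, plus_INR, mult_INR in HLB. simpl (INR 3) in HLB. simpl (INR 2) in HLB.
  assert (HMR : 1 <= INR M) by (apply le_IZR_INR; lia).
  pose proof (pos_INR (length B)) as HB0. pose proof (pos_INR w) as Hw0.
  assert (H1 : INR (length L) * INR w <= (INR (length B) * (5 * INR M)) * INR w).
  { apply Rmult_le_compat_r; auto. eapply Rle_trans; [exact HLB|]. apply Rmult_le_compat_l; lra. }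
  assert (H2 : (5 * INR M) * (INR (length B) * INR w) <= (5 * INR M) * (102400000 * INR Z)) by (apply Rmult_le_compat_l; lra).
  lra.
Qed.

Lemma flat_map_length_ge {A B : Type} (f : A -> list B) (l : list A) (c : nat) :
  (forall x, In x l -> (c <= length (f x))%nat) -> (length l * c <= length (flat_map f l))%nat.
Proof.
  induction l as [|a l IH]; simpl; intros H; [lia|].
  rewrite length_app. specialize (H a (or_introl eq_refl)) as Ha.
  assert (length l * c <= length (flat_map f l))%nat by (apply IH; intros; apply H; auto). lia.
Qed.

(* Each of the [40M] windows that is not smooth-free supplies its own smooth number, so Hall's
   condition allows at most [10M] of them. *)
Lemma many_smooth_free_windows (M n : nat) :
  prime_rep n (200 * M * (40 * M)) ->
  (30 * M <= length (filter (fun i => holdsb (smooth_free (10 * M) (n + 200 * M * i) (200 * M))) (seq 0 (40 * M))))%nat.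
Proof.
  intros Hrep.
  pose proof (filter_length (fun i => holdsb (smooth_free (10 * M) (n + 200 * M * i) (200 * M))) (seq 0 (40 * M))) as HF.
  rewrite length_seq in HF. set (D := filter (fun x => negb _) _) in HF.
  assert (HD : (length D <= 10 * M)%nat); [|lia].
  set (Sm := filter (fun m => holdsb (smooth (10 * M) m)) (seq (S n) (200 * M * (40 * M)))).
  apply Nat.le_trans with (length Sm).
  - set (sel := fun i => epsilon (inhabits 0%nat) (fun m =>
      (n + 200 * M * i < m <= n + 200 * M * i + 200 * M)%nat /\ smooth (10 * M) m)).
    assert (Hsel : forall i, In i D -> (i < 40 * M)%nat /\
      (n + 200 * M * i < sel i <= n + 200 * M * i + 200 * M)%nat /\ smooth (10 * M) (sel i)).
    { intros i Hi. apply filter_In in Hi. destruct Hi as [Hi Hn]. apply in_seq in Hi.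
      split; [lia|]. unfold sel. apply epsilon_spec. apply Bool.negb_true_iff in Hn.
      destruct (excluded_middle_informative (exists m, (n + 200 * M * i < m <= n + 200 * M * i + 200 * M)%nat /\ smooth (10 * M) m)) as [|Hno]; auto.
      exfalso. assert (Ht : holdsb (smooth_free (10 * M) (n + 200 * M * i) (200 * M)) = true).
      { apply holdsb_true. intros m Hm Hsm. apply Hno. eauto. }
      congruence. }
    apply (inj_length sel).
    + apply NoDup_filter, seq_NoDup.
    + intros x y Hx Hy Exy. destruct (Hsel x Hx) as [_ [H1 _]]. destruct (Hsel y Hy) as [_ [H2 _]].
      rewrite Exy in H1. destruct (Nat.lt_trichotomy x y) as [H|[H|H]]; auto; exfalso; nia.
    + intros x Hx. destruct (Hsel x Hx) as [H0 [H1 H2]]. apply filter_In. split.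
      * apply in_seq. nia.
      * apply holdsb_true; auto.
  - apply (hall_smooth n (200 * M * (40 * M))); auto.
    + apply NoDup_filter, seq_NoDup.
    + intros m Hm. apply filter_In in Hm. destruct Hm as [Hm1 Hm2]. apply in_seq in Hm1.
      rewrite holdsb_true in Hm2. split; [lia|exact Hm2].
Qed.

(** Double counting of pairs [(n, i)]: each [n] has at least [30 M] smooth-free windows, while a
    starting point arises from at most [40 M] pairs, one for each [i]. The upper end [17/2] instead
    of 9 leaves room for the windows, of total length [8000 M^2]. *)
Lemma prime_rep_count (r : nat) : (2 <= r)%nat -> exists w0, forall w, (w0 <= w)%nat ->
  let M := (w ^ len_exp r)%nat in let Z := (M ^ r)%nat in
  forall L : list nat, NoDup L ->
  (forall n, In n L -> (8 * (M * Z) <= 2 * n <= 17 * (M * Z))%nat /\ prime_rep n (200 * M * (40 * M))) ->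
  INR (length L) * INR w <= 700000000 * INR (M * Z).
Proof.
  intros Hr. destruct (smooth_free_count r ltac:(lia)) as [w0 Hw0].
  exists (w0 + 4 * (40 * 100) + 1)%nat. intros w Hw M Z L HL HLin.
  specialize (Hw0 w ltac:(lia)). cbv zeta in Hw0. fold M in Hw0. fold Z in Hw0.
  set (Bad := filter (fun n => holdsb (smooth_free (10 * M) n (200 * M))) (seq (4 * M * Z) (5 * M * Z + 1))).
  assert (HBad : INR (length Bad) * INR w <= 512000000 * INR M * INR Z).
  { apply Hw0; [apply NoDup_filter, seq_NoDup|]. intros n Hn. apply filter_In in Hn.
    destruct Hn as [H1 H2]. apply in_seq in H1. rewrite holdsb_true in H2. split; auto. lia. }
  assert (HM : (w <= M)%nat).
  { unfold M. rewrite <- (Nat.pow_1_r w) at 1. apply Nat.pow_le_mono_r; [lia|]. unfold len_exp, shift_exp. lia. }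
  assert (HMZ : (M * M <= Z)%nat).
  { unfold Z. rewrite <- Nat.pow_2_r. apply Nat.pow_le_mono_r; lia. }
  assert (Hbig : (2 * (200 * M * (40 * M)) <= M * Z)%nat).
  { apply Nat.le_trans with (M * (M * M))%nat; [|apply Nat.mul_le_mono_l; auto].
    assert (2 * (200 * 40) <= M)%nat by lia.
    replace (2 * (200 * M * (40 * M)))%nat with ((2 * (200 * 40)) * (M * M))%nat by ring.
    apply Nat.mul_le_mono_r; auto. }
  set (good := fun n i => holdsb (smooth_free (10 * M) (n + 200 * M * i) (200 * M))).
  set (T := flat_map (fun n => map (pair n) (filter (good n) (seq 0 (40 * M)))) L).
  assert (HT1 : (length L * (30 * M) <= length T)%nat).
  { apply flat_map_length_ge. intros n Hn. rewrite length_map. apply many_smooth_free_windows, HLin; auto. }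
  assert (HT2 : (length T <= length Bad * (40 * M))%nat).
  { rewrite <- (length_seq (40 * M) 0), <- length_prod.
    assert (HTin : forall x, In x T -> In (fst x) L /\ (snd x < 40 * M)%nat /\ good (fst x) (snd x) = true).
    { intros [n i] Hx. apply in_flat_map in Hx. destruct Hx as [n' [Hn' Hx]].
      apply in_map_iff in Hx. destruct Hx as [i' [Ei Hi]]. injection Ei as -> ->.
      apply filter_In in Hi. destruct Hi as [Hi Hg]. apply in_seq in Hi. cbn [fst snd]. repeat split; auto. lia. }
    apply (inj_length (fun x => ((fst x + 200 * M * snd x)%nat, snd x))).
    - apply NoDup_flat_map_disjoint; auto.
      + intros n Hn. apply Injective_map_NoDup; [intros u v H; inversion H; auto|apply NoDup_filter, seq_NoDup].
      + intros x y z _ _ H1 H2. apply in_map_iff in H1, H2.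
        destruct H1 as [u [<- _]]. destruct H2 as [v [E _]]. inversion E; auto.
    - intros [n i] [n' i'] _ _ E. cbn [fst snd] in E. injection E as E1 E2. subst. f_equal. lia.
    - intros [n i] Hx. destruct (HTin _ Hx) as [H1 [H2 H3]]. cbn [fst snd] in *.
      destruct (HLin n H1) as [Hn _].
      assert (200 * M * i <= 200 * M * (40 * M))%nat by (apply Nat.mul_le_mono_l; lia).
      apply in_prod; [|apply in_seq; lia]. apply filter_In. split; auto. apply in_seq. lia. }
  assert (HLB : (3 * length L <= 4 * length Bad)%nat).
  { assert (10 * M * (3 * length L) <= 10 * M * (4 * length Bad))%nat by lia.
    apply Nat.mul_le_mono_pos_l in H; lia. }
  apply le_INR in HLB. rewrite !mult_INR in HLB. simpl (INR 3) in HLB. simpl (INR 4) in HLB.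
  rewrite mult_INR. pose proof (pos_INR w).
  assert (H1 : (3 * INR (length L)) * INR w <= (4 * INR (length Bad)) * INR w) by (apply Rmult_le_compat_r; lra).
  pose proof (Rmult_le_pos _ _ (pos_INR M) (pos_INR Z)). lra.
Qed.

(** * The exceptional set *)

Definition large (eps : R) (n : nat) : bool :=
  if Rle_dec (Rpower (INR n) eps) (INR (g n)) then true else false.

Lemma large_prime_rep (eps : R) (n k : nat) : (1 <= n)%nat ->
  large eps n = true -> INR k <= Rpower (INR n) eps -> prime_rep n k.
Proof.
  intros Hn Hl Hk. unfold large in Hl. destruct (Rle_dec _ _) as [H|]; [|discriminate].
  destruct (excluded_middle_informative (prime_rep n k)) as [|Hno]; auto. exfalso.
  destruct (g_spec n k Hn Hno) as [_ Hg]. apply lt_INR in Hg. lra.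
Qed.

(** For [w >= 17 D] one has [(1 + 1/w)^D <= 17/16], which places all of [(Y, 2Y]] between [4 w^D]
    and [17/2 w^D]. *)
Lemma root_window (D Y w : nat) : (17 * D <= w)%nat -> (1 <= D)%nat ->
  (w ^ D <= Y / 4 < S w ^ D)%nat -> (4 * w ^ D <= Y /\ 4 * Y <= 17 * w ^ D)%nat.
Proof.
  intros Hw HD [H1 H2].
  pose proof (Nat.div_mod_eq Y 4). pose proof (Nat.mod_upper_bound Y 4 ltac:(lia)).
  pose proof (pow_succ_bound w D D (le_n _) ltac:(lia)) as H3.
  set (A := (S w ^ D)%nat) in *. set (B := (w ^ D)%nat) in *. clearbody A B. split; [lia|].
  assert (HAB : (16 * A <= 17 * B)%nat).
  { assert (16 * A * (w - D) <= 17 * B * (w - D))%nat.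
    { apply Nat.le_trans with (16 * (B * w))%nat; [lia|].
      replace (17 * B * (w - D))%nat with (B * (17 * (w - D)))%nat by ring.
      replace (16 * (B * w))%nat with (B * (16 * w))%nat by ring. apply Nat.mul_le_mono_l. lia. }
    apply Nat.mul_le_mono_pos_r in H4; lia. }
  lia.
Qed.

Lemma dyadic_count (eps : R) : 0 < eps -> exists (D Y0 : nat) (B : R), (2 <= D)%nat /\ 0 < B /\
  forall Y, (Y0 <= Y)%nat ->
  INR (length (filter (large eps) (seq (S Y) Y))) <= B * Rpower (INR Y) (1 - / INR D).
Proof.
  intros Heps.
  (* As [n] is of size [w^D = M^(r+1)], the bound [r eps >= 3] gives [n^eps >= M^3], which exceeds
     the length [8000 M^2] of the interval under study. *)
  destruct (INR_unbounded (3 / eps)) as [r0 Hr0]. set (r := (r0 + 2)%nat).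
  destruct (prime_rep_count r ltac:(lia)) as [w0 Hw0].
  set (D := (len_exp r * (r + 1))%nat).
  assert (Hlen : (2 <= len_exp r)%nat) by (unfold len_exp, shift_exp; lia).
  assert (HD : (2 <= D)%nat) by (unfold D; nia).
  set (w1 := (w0 + 17 * D + 200 * 40)%nat).
  (* Twice the constant of [prime_rep_count], because [Y^(1/D) <= 2 w]. *)
  exists D, (4 * w1 ^ D)%nat, 1400000000. split; auto. split; [lra|]. intros Y HY.
  destruct (exists_root D (Y / 4) ltac:(lia)) as [w Hw].
  assert (Hww : (w1 <= w)%nat).
  { destruct (le_lt_dec w1 w) as [|H]; auto. exfalso.
    assert (S w ^ D <= w1 ^ D)%nat by (apply Nat.pow_le_mono_l; lia).
    assert (w1 ^ D <= Y / 4)%nat by (apply Nat.div_le_lower_bound; lia). lia. }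
  destruct (root_window D Y w ltac:(lia) ltac:(lia) Hw) as [HY1 HY2].
  specialize (Hw0 w ltac:(lia)). cbv zeta in Hw0.
  set (M := (w ^ len_exp r)%nat) in *. set (Z := (M ^ r)%nat) in *.
  assert (HMZ : (M * Z = w ^ D)%nat).
  { unfold Z, M, D. rewrite <- !Nat.pow_mul_r, <- Nat.pow_add_r. f_equal. lia. }
  rewrite HMZ in Hw0.
  set (L := filter (large eps) (seq (S Y) Y)).
  assert (HwD : (1 <= w ^ D)%nat) by (apply pow_ge_1; lia).
  assert (HwR : 1 <= INR w) by (apply le_IZR_INR; lia).
  assert (HYR : 1 <= INR Y) by (apply le_IZR_INR; lia).
  assert (HL : INR (length L) * INR w <= 700000000 * INR (w ^ D)).
  { apply Hw0; [apply NoDup_filter, seq_NoDup|]. intros n Hn. apply filter_In in Hn.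
    destruct Hn as [Hn Hlarge]. apply in_seq in Hn. split; [lia|].
    apply (large_prime_rep eps); auto; [lia|].
    apply Rle_trans with (INR (w ^ (3 * len_exp r))).
    - apply le_INR. replace (3 * len_exp r)%nat with (len_exp r + (len_exp r + len_exp r))%nat by lia.
      rewrite !Nat.pow_add_r. fold M.
      replace (200 * M * (40 * M))%nat with ((200 * 40) * (M * M))%nat by ring. apply Nat.mul_le_mono_r.
      apply Nat.le_trans with w; [lia|]. unfold M. rewrite <- (Nat.pow_1_r w) at 1. apply Nat.pow_le_mono_r; lia.
    - apply Rle_trans with (Rpower (INR (w ^ D)) eps).
      + rewrite !pow_INR, <- !Rpower_pow, Rpower_mult by lra.
        apply Rle_Rpower; auto. unfold D. rewrite !mult_INR, plus_INR.
        assert (Hr3 : 3 <= INR r * eps).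
        { apply (Rmult_lt_compat_r eps) in Hr0; auto. unfold Rdiv in Hr0.
          rewrite Rmult_assoc, Rinv_l, Rmult_1_r in Hr0 by lra.
          assert (INR r0 <= INR r) by (apply le_INR; unfold r; lia). nra. }
        pose proof (pos_INR (len_exp r)). simpl (INR 3). simpl (INR 1).
        replace (INR (len_exp r) * (INR r + 1) * eps) with (INR (len_exp r) * (INR r * eps + eps)) by ring.
        replace ((1 + 1 + 1) * INR (len_exp r)) with (INR (len_exp r) * 3) by ring.
        apply Rmult_le_compat_l; lra.
      + apply Rle_Rpower_l; [lra|]. split; [apply lt_0_INR; lia|]. apply le_INR. lia. }
  assert (HDR : 0 < INR D) by (apply lt_0_INR; lia).
  assert (Hroot : Rpower (INR Y) (/ INR D) <= 2 * INR w).
  { replace (2 * INR w) with (Rpower (Rpower (2 * INR w) (INR D)) (/ INR D)).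
    - apply Rle_Rpower_l; [left; apply Rinv_0_lt_compat; auto|]. split; [lra|].
      rewrite Rpower_pow by lra. replace (2 * INR w) with (INR (2 * w)) by (rewrite mult_INR; simpl; ring).
      rewrite <- pow_INR. apply le_INR. rewrite Nat.pow_mul_l.
      assert (H8 : (2 ^ 3 <= 2 ^ D)%nat) by (apply Nat.pow_le_mono_r; [lia|unfold D; nia]).
      assert (8 * w ^ D <= 2 ^ D * w ^ D)%nat by (apply Nat.mul_le_mono_r; exact H8).
      lia.
    - rewrite Rpower_mult, Rinv_r, Rpower_1; lra. }
  assert (HYs : INR Y = Rpower (INR Y) (/ INR D) * Rpower (INR Y) (1 - / INR D)).
  { rewrite <- Rpower_plus. replace (/ INR D + (1 - / INR D)) with 1 by ring. rewrite Rpower_1; lra. }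
  assert (HwY : INR (w ^ D) <= INR Y) by (apply le_INR; lia).
  set (P := Rpower (INR Y) (1 - / INR D)) in *.
  assert (HP : 0 < P) by apply exp_pos.
  apply (Rmult_le_reg_r (INR w)); [lra|].
  apply Rle_trans with (700000000 * INR Y); [lra|]. rewrite HYs. nra.
Qed.

(** Induction by halving [N]. Since [2^ga >= sqrt 2 >= 7/5], the step closes once
    [A + B + 1 <= 7/5 A], which dictates [5/2 (B + 1)]; the added 1 accounts for the last integer
    when [N] is odd. *)
Lemma large_count (eps : R) : 0 < eps -> exists (D : nat) (A : R), (2 <= D)%nat /\ 0 < A /\
  forall N, (1 <= N)%nat ->
  INR (length (filter (large eps) (seq 2 (N - 1)))) <= A * Rpower (INR N) (1 - / INR D).
Proof.
  intros Heps. destruct (dyadic_count eps Heps) as [D [Y0 [B [HD [HB HY]]]]].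
  set (ga := 1 - / INR D).
  assert (HDR : 2 <= INR D) by (apply le_IZR_INR; lia).
  assert (Hga : 1 / 2 <= ga < 1).
  { unfold ga. assert (/ INR D <= / 2) by (apply Rinv_le_contravar; lra).
    assert (0 < / INR D) by (apply Rinv_0_lt_compat; lra). lra. }
  set (A := 5 / 2 * (B + 1) + INR (2 * Y0 + 2)).
  assert (HA : 0 < A) by (unfold A; pose proof (pos_INR (2 * Y0 + 2)); lra).
  assert (Hf1 : forall n, (1 <= n)%nat -> 1 <= Rpower (INR n) ga).
  { intros n Hn. rewrite <- (Rpower_O (INR n)) by (apply lt_0_INR; lia).
    apply Rle_Rpower; [apply le_IZR_INR; lia|lra]. }
  exists D, A. split; auto. split; auto. fold ga.
  intros N. induction N as [N IH] using lt_wf_ind. intros HN.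
  destruct (lt_dec N (2 * Y0 + 2)) as [Hs|Hs].
  - apply Rle_trans with (A * 1).
    + apply Rle_trans with (INR N).
      * apply le_INR. eapply Nat.le_trans; [apply filter_length_le|]. rewrite length_seq. lia.
      * apply lt_INR in Hs. unfold A. lra.
    + apply Rmult_le_compat_l; [lra|auto].
  - pose proof (Nat.div_mod_eq N 2) as E1. pose proof (Nat.mod_upper_bound N 2 ltac:(lia)) as E2.
    set (Y := (N / 2)%nat) in *.
    specialize (IH Y ltac:(lia) ltac:(lia)). specialize (HY Y ltac:(lia)). fold ga in HY.
    assert (Hsplit : (length (filter (large eps) (seq 2 (N - 1))) <=
      length (filter (large eps) (seq 2 (Y - 1))) + (length (filter (large eps) (seq (S Y) Y)) + 1))%nat).
    { replace (N - 1)%nat with ((Y - 1) + (N - Y))%nat by lia.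
      rewrite seq_app, filter_app, length_app. apply Nat.add_le_mono_l.
      replace (2 + (Y - 1))%nat with (S Y) by lia.
      apply Nat.le_trans with (length (filter (large eps) (seq (S Y) (Y + 1)))).
      - replace (Y + 1)%nat with ((N - Y) + (Y + 1 - (N - Y)))%nat by lia.
        rewrite seq_app, filter_app, length_app. lia.
      - rewrite seq_app, filter_app, length_app. apply Nat.add_le_mono_l.
        eapply Nat.le_trans; [apply filter_length_le|]. simpl; lia. }
    apply le_INR in Hsplit. rewrite !plus_INR in Hsplit. simpl (INR 1) in Hsplit.
    pose proof (Hf1 Y ltac:(lia)) as HfY.
    assert (Hhalf : 7 / 5 * Rpower (INR Y) ga <= Rpower (INR N) ga).
    { apply Rle_trans with (Rpower 2 ga * Rpower (INR Y) ga).
      - apply Rmult_le_compat_r; [lra|]. apply Rle_trans with (Rpower 2 (1 / 2)).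
        + replace (1 / 2) with (/ 2) by field. rewrite Rpower_sqrt by lra.
          apply Rsqr_incr_0_var; [|apply sqrt_pos]. rewrite Rsqr_sqrt by lra. unfold Rsqr; lra.
        + apply Rle_Rpower; lra.
      - rewrite Rpower_mult_distr by (try lra; apply lt_0_INR; lia).
        apply Rle_Rpower_l; [lra|]. split.
        + apply Rmult_lt_0_compat; [lra|apply lt_0_INR; lia].
        + replace 2 with (INR 2) by (simpl; lra). rewrite <- mult_INR. apply le_INR. lia. }
    set (P := Rpower (INR Y) ga) in *.
    apply Rle_trans with ((A + B + 1) * P); [lra|].
    apply Rle_trans with (A * (7 / 5 * P)); [|apply Rmult_le_compat_l; lra].
    assert (B + 1 <= 2 / 5 * A) by (unfold A; pose proof (pos_INR (2 * Y0 + 2)); lra). nra.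
Qed.

(** The exponent [1/3 - eps] is below [1/2], and [sqrt L <= L / c] as soon as [L >= c^2]. *)
Lemma power_saving_beats (eps c L : R) : 0 < eps -> 2 <= c -> c ^ 2 <= L ->
  Rpower L (1 / 3 - eps) <= / c * L.
Proof.
  intros He Hc HL. assert (HL1 : 1 <= L) by nra.
  apply Rle_trans with (Rpower L (/ 2)); [apply Rle_Rpower; lra|].
  rewrite Rpower_sqrt by lra.
  assert (Hs : c <= sqrt L).
  { rewrite <- (sqrt_pow2 c) by lra. apply sqrt_le_1; nra. }
  apply (Rmult_le_reg_l c); [lra|]. rewrite <- Rmult_assoc, Rinv_r, Rmult_1_l by lra.
  rewrite <- (sqrt_sqrt L) at 2 by lra. apply Rmult_le_compat_r; [apply sqrt_pos|auto].
Qed.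

Theorem theorem1p1 :
  (exists alpha : R, alpha < 1/2 /\
     exists N : nat, forall n : nat, (N <= n)%nat -> INR (g n) < Rpower (INR n) alpha)
  /\
  (forall eps : R, 0 < eps ->
     exists C : R, 0 < C /\
     exists X0 : R, forall X : R, X0 <= X ->
       INR (count_large eps X) <= C * X * exp (- Rpower (ln X) (1/3 - eps))).
Proof.
  split.
  - exists (11 / 23). split; [lra|]. exact grimm_below_sqrt.
  - intros eps Heps. destruct (large_count eps Heps) as [D [A [HD [HA H]]]].
    (* This threshold means [ln X >= D^2], so that [power_saving_beats] applies with [c = D]. *)
    exists A. split; auto. exists (exp (INR D ^ 2)). intros X HX.
    assert (HDR : 2 <= INR D) by (apply le_IZR_INR; lia).
    assert (HX1 : 1 < X).
    { eapply Rlt_le_trans; [|exact HX]. rewrite <- exp_0. apply exp_increasing. nra. }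
    assert (HlnX : INR D ^ 2 <= ln X).
    { rewrite <- (ln_exp (INR D ^ 2)). destruct HX as [HX|HX]; [left; apply ln_increasing; auto; apply exp_pos|rewrite HX; lra]. }
    unfold count_large. fold (large eps).
    destruct (base_Int_part X) as [I1 I2].
    set (N := Z.to_nat (Int_part X)).
    assert (HI : (1 <= Int_part X)%Z).
    { assert (IZR 0 < IZR (Int_part X)) by lra. apply lt_IZR in H0. lia. }
    assert (HN : INR N = IZR (Int_part X)).
    { unfold N. rewrite INR_IZR_INZ, Z2Nat.id; auto. lia. }
    assert (HN1 : (1 <= N)%nat) by (unfold N; lia).
    eapply Rle_trans; [apply (H N HN1)|]. rewrite Rmult_assoc. apply Rmult_le_compat_l; [lra|].
    assert (/ INR D <= / 2) by (apply Rinv_le_contravar; lra).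
    apply Rle_trans with (Rpower X (1 - / INR D)).
    + apply Rle_Rpower_l; [lra|]. split; [apply lt_0_INR; lia|lra].
    + unfold Rpower at 1. rewrite <- (exp_ln X) at 2 by lra. rewrite <- exp_plus.
      pose proof (power_saving_beats eps (INR D) (ln X) Heps HDR HlnX).
      assert (Hle : (1 - / INR D) * ln X <= ln X + - Rpower (ln X) (1 / 3 - eps)) by lra.
      destruct Hle as [Hle|Hle]; [left; apply exp_increasing; auto|right; now f_equal].
Qed.
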